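(* Let $G$ be a maximal triangle-free graph with vertex set $\mathbb N=\{1,2,3,\dots\}$. If $\inf\{\underline{\deg}(v): v\in\mathbb N\}>1/3$, then $G$ is a blow-up of either an Andrásfai graph $\Gamma_k$ ($k\ge1$) or a Vega graph $\Upsilon_i^{\mu\nu}$ ($i\ge2$, $\mu,\nu\in\{0,1\}$).
   Context: For $v\in\mathbb N$, $\underline{\deg}(v)=\liminf_{n\to\infty}\frac{|\{1,\dots,n\}\cap\mathrm N(v)|}{n}$, where $\mathrm N(v)$ is the neighbourhood of $v$. A graph is maximal triangle-free if it contains no triangle but adding any new edge creates a triangle. A blow-up of $H$ is any graph obtained by replacing each vertex of $H$ by a non-empty (possibly infinite) independent set and each edge of $H$ by the complete bipartite graph between the corresponding sets, with no further edges. Andrásfai graph $\Gamma_k$: vertex set $\mathbb Z/(3k-1)\mathbb Z$, $ij$ an edge iff $i-j\in\{k,\dots,2k-1\}$ mod $3k-1$. Vega graphs: for $i\ge2$, $\Upsilon_i^{00}$ has vertex set $\mathbb Z/(3i-1)\mathbb Z\cup\{a,b,c,u,v,w,x,y\}$; edges: those of $\Gamma_i$; the hexagon $av,vc,cu,ub,bw,wa$; all edges from $a,u$ to $\{0,\dots,i-1\}$; from $b,v$ to $\{i,\dots,2i-1\}$; from $c,w$ to $\{2i,\dots,3i-2\}$; and $xa,xb,xc,yu,yv,yw,xy$. Further $\Upsilon_i^{10}=\Upsilon_i^{00}-y$, $\Upsilon_i^{01}=\Upsilon_i^{00}-(2i-1)$, $\Upsilon_i^{11}=\Upsilon_i^{00}-\{y,2i-1\}$.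 *)

(* Defs.v *)
From HB Require Import structures.
From mathcomp Require Import all_boot all_order all_algebra.
From mathcomp Require Import all_classical all_reals.
From mathcomp Require Import ereal topology normedtype sequences.
Set Implicit Arguments. Unset Strict Implicit. Unset Printing Implicit Defensive.
Import Order.TTheory GRing.Theory Num.Theory.
Local Open Scope ring_scope.
Local Open Scope classical_set_scope.

(* A simple graph on the vertex set N: the natural number v : nat stands for
   the vertex v+1 of {1,2,3,...}. *)
Definition simple_graph (E : rel nat) : Prop :=
  (forall x y, E x y = E y x) /\ (forall x, ~~ E x x).

Definition triangle_free (E : rel nat) : Prop :=
  forall x y z, ~ [/\ E x y, E y z & E x z].

(* maximal triangle-free: triangle-free, and adding any new edge xy
   (x <> y, xy not an edge) creates a triangle, i.e. x,y have a common
   neighbour. *)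
Definition maximal_triangle_free (E : rel nat) : Prop :=
  simple_graph E /\ triangle_free E /\
  forall x y, x <> y -> ~~ E x y -> exists z, E x z && E z y.

(* |{1,..,n} ∩ N(v)| / n   (vertices 1..n are the nats 0..n-1) *)
Definition nbr_density (R : realType) (E : rel nat) (v n : nat) : R :=
  (\sum_(i < n) (E v i : nat))%:R / n%:R.

Definition lower_deg (R : realType) (E : rel nat) (v : nat) : \bar R :=
  limn_einf (fun n => (nbr_density R E v n)%:E).

(* G is a blow-up of the subgraph of H induced on S: there is a map f
   from the vertices of G onto S (the fibres are the non-empty blobs)
   such that xy is an edge of G iff f x f y is an edge of H.
   (Since H is loopless, fibres are independent sets.) *)
Definition blowup_of (E : rel nat) (V : Type) (H : V -> V -> bool)
    (S : V -> bool) : Prop :=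
  exists f : nat -> V,
    (forall x, S (f x)) /\ (forall s, S s -> exists x, f x = s) /\
    (forall x y, E x y = H (f x) (f y)).

Definition andr_adj (k p q : nat) : bool :=
  let m := (3 * k - 1)%N in
  let d := ((p + m - q) %% m)%N in
  (k <= d <= 2 * k - 1)%N.

Definition andrasfai (k : nat) : 'I_(3 * k - 1) -> 'I_(3 * k - 1) -> bool :=
  fun p q => andr_adj k p q.

Inductive vextra := Va | Vb | Vc | Vu | Vv | Vw | Vx | Vy.
Definition vextra_eqb (s t : vextra) : bool :=
  match s, t with
  | Va, Va | Vb, Vb | Vc, Vc | Vu, Vu | Vv, Vv | Vw, Vw | Vx, Vx | Vy, Vy => true
  | _, _ => false
  end.

Definition vega_vertex (i : nat) : Type := ('I_(3 * i - 1) + vextra)%type.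

Definition vega_arc (i : nat) (s t : vega_vertex i) : bool :=
  match s, t with
  | inl p, inl q => andr_adj i p q
  | inr Va, inr Vv | inr Vv, inr Vc | inr Vc, inr Vu
  | inr Vu, inr Vb | inr Vb, inr Vw | inr Vw, inr Va => true
  | inr Vx, inr Va | inr Vx, inr Vb | inr Vx, inr Vc
  | inr Vy, inr Vu | inr Vy, inr Vv | inr Vy, inr Vw | inr Vx, inr Vy => true
  | inr Va, inl p | inr Vu, inl p => (p < i)%N
  | inr Vb, inl p | inr Vv, inl p => (i <= p <= 2 * i - 1)%N
  | inr Vc, inl p | inr Vw, inl p => (2 * i <= p <= 3 * i - 2)%N
  | _, _ => false
  end.

Definition vega (i : nat) (s t : vega_vertex i) : bool :=
  vega_arc s t || vega_arc t s.

Definition vega_keep (i : nat) (mu nu : bool) (s : vega_vertex i) : bool :=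
  match s with
  | inl p => ~~ (nu && (nat_of_ord p == 2 * i - 1)%N)
  | inr t => ~~ (mu && vextra_eqb t Vy)
  end.

(* Main.v *)
(* The density hypothesis is used only through two consequences: for every finite
   family of weighted vertices some vertex sees more than a third of the total
   weight, and the sequences s_0, ..., s_(L-1) in which s_i s_j is an edge
   whenever i < j and j - i = 1 mod 3 have bounded length.  Up to renumbering,
   the Andrasfai graph of order k is such a sequence of length 3k-1, and a Vega
   graph is a core a, b, c, u, v, w, x, possibly y, together with such a
   sequence of length 3i-1 or 3i-2, where s_j is adjacent to the two vertices
   of the hexagon whose class is j mod 3.

   Suppose that for every copy of a pattern H in G, every vertex of G has the same
   neighbours in the copy as some vertex of H (full traces).  If no neighbourhood
   in H contains another one, then G is a blow-up of H.  So it suffices to find a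
   pattern with full traces.

   If G has no induced hexagon, every finite independent set has a common
   neighbour, and a longest sequence of length 3k-1 has full traces.  If G has an
   induced hexagon, it contains the Vega pattern with L = 4, and a maximal Vega
   pattern has full traces.  For L <= 5, and for the local structure around the
   pattern with L = 7, this is a finite search: each case is refuted by a tree
   whose nodes use the weighted degree condition, common neighbours of
   non-adjacent vertices, and the excluded larger patterns; such trees are
   verified by computation.  For L >= 7 the local structure puts the vertices of
   the three classes in a linear order that extends the sequence, and a vertex that
   is not a twin of some s_j yields a longer one. *)
Require Import Defs.
From Stdlib Require Import String.
From mathcomp Require Import all_boot.
From mathcomp Require Import zify.
From mathcomp Require Import boolp.
Set Implicit Arguments. Unset Strict Implicit. Unset Printing Implicit Defensive.

(** The renumbering of the Andrasfai graph is multiplication by 3 modulo 3k-1, with inverse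
    multiplication by k because 3k = 1 there. It turns the differences k, ..., 2k-1 into 1, 4, ...,
    3k-2, so that a shorter sequence is a segment of a longer one; the vertex 2i-1 that some Vega
    graphs lack becomes the last term. Although the vertex set is infinite, a maximal pattern exists
    because densities above (1 + 1/K)/3 keep all lengths below 3K. Its length is never divisible by
    3, since the weighted degree condition then yields a longer sequence. The vertex y enters only
    from L = 5 on: with L = 4 the pattern with y contains the pattern with L = 5. The pattern with L
    = 7 is studied without excluding anything larger, so that its traces also describe the vertices
    of longer sequences; the facts found there about arbitrary vertices of the three classes replace
    a search for each length. *)

Definition wdeg (E : rel nat) (z : nat) (g ws : seq nat) : nat :=
  sumn [seq p.2 * E z p.1 | p <- zip g ws].

Definition heavy_nbr (E : rel nat) : Prop :=
  forall g ws : seq nat, size g = size ws -> 0 < sumn ws ->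
  exists z, sumn ws < 3 * wdeg E z g ws.

(** Loops are excluded by [dg_tri] with x = y = z. For x = y, [dg_com] says that no vertex is
    isolated. *)
Record dense_graph (E : rel nat) : Prop := DenseGraph {
  dg_sym : symmetric E;
  dg_tri : forall x y z, E x y -> E y z -> ~~ E x z;
  dg_com : forall x y, ~~ E x y -> exists2 z, E x z & E z y;
  dg_heavy : heavy_nbr E }.

(** * Refutation certificates *)

(* A state is a finite set of vertices with some known edges and some known
   non-edges.  [cX]: the state is contradictory; [cK]: apply the closure rules
   of the context; [cD ws]: for the weights [ws], no vertex can see more than a
   third of the total; [cW ws b]: every vertex that does sees all of one of the
   lists of [b], and a new vertex seeing that list refutes the state; [cS i j]:
   split on the edge ij; [cC i j]: add a common neighbour of the non-adjacent
   i, j; [cT k h]: [h] is a copy of the k-th excluded graph. *)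
Inductive cert :=
  | cX
  | cK of cert
  | cD of seq nat
  | cW of seq nat & branches
  | cS of nat & nat & cert & cert
  | cC of nat & nat & cert
  | cT of nat & seq nat
with branches := bN | bC of seq nat & cert & branches.

Scheme cert_mut := Induction for cert Sort Prop
  with branches_mut := Induction for branches Sort Prop.
Combined Scheme cert_branches_ind from cert_mut, branches_mut.

Fixpoint orm (a b : bitseq) : bitseq :=
  match a, b with
  | x :: a', y :: b' => (x || y) :: orm a' b'
  | [::], _ => b
  | _, [::] => a
  end.

Fixpoint overlap (a b : bitseq) : bool :=
  match a, b with
  | x :: a', y :: b' => (x && y) || overlap a' b'
  | _, _ => false
  end.

Fixpoint subm (a b : bitseq) : bool :=
  match a, b with
  | x :: a', y :: b' => (x ==> y) && subm a' b'
  | x :: a', [::] => ~~ x && subm a' [::]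
  | [::], _ => true
  end.

(** Bit matrices of known edges and known non-edges. Missing rows and bits read as unknown; only the
    first matrix fixes the number of vertices. *)
Definition state := (seq bitseq * seq bitseq)%type.

Definition row (r : seq bitseq) i : bitseq := nth [::] r i.
Definition bit (r : seq bitseq) i j : bool := nth false (row r i) j.
Definition setb (r : seq bitseq) i j : seq bitseq :=
  set_nth [::] r i (set_nth false (row r i) j true).
Definition set2 (r : seq bitseq) (p : nat * nat) := setb (setb r p.1 p.2) p.2 p.1.
Definition add_edges (s : state) (l : seq (nat * nat)) : state :=
  (foldl set2 s.1 l, s.2).
Definition add_nons (s : state) (l : seq (nat * nat)) : state :=
  (s.1, foldl set2 s.2 l).

Fixpoint rows_of (e : seq bitseq) (a : bitseq) (r : seq bitseq) : bitseq :=
  match a, r with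
  | true :: a', x :: r' => orm x (rows_of e a' r')
  | false :: a', _ :: r' => rows_of e a' r'
  | _, _ => [::]
  end.

(** Triangle-freeness: vertices with a common neighbour are non-adjacent. This also marks the
    diagonal entry of every vertex with a known neighbour. *)
Definition norm (s : state) : state :=
  (s.1, [seq orm (row s.2 i) (rows_of s.1 (row s.1 i) s.1) | i <- iota 0 (size s.1)]).

Definition bad (s : state) : bool :=
  has (fun p => overlap p.1 p.2) (zip s.1 s.2).

(* [ctg]: excluded graphs; [cba]: neighbourhoods of the vertices of the base
   graph, which occupies the first codes; [cpr]: pairs (i, j) such that any
   vertices that see the neighbourhoods of i and of j are adjacent; [cal]: the
   possible traces of vertices on the base (no restriction if empty); [cfz]: no
   vertex sees both the vertex coded by [size cba] and the neighbourhood of a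
   base vertex that is not adjacent to it. *)
Record context := Context {
  ctg : seq (seq (nat * nat));
  cba : seq (seq nat);
  cpr : seq (nat * nat);
  cal : seq bitseq;
  cfz : bool }.

Definition covers (l : seq nat) (m : bitseq) := all (nth false m) l.

Definition pair_step (c : context) (s : state) : state :=
  foldl (fun s p =>
    let li := nth [::] (cba c) p.1 in
    let lj := nth [::] (cba c) p.2 in
    let ti := [seq t <- iota 0 (size s.1) | covers li (row s.1 t)] in
    let tj := [seq t <- iota 0 (size s.1) | covers lj (row s.1 t)] in
    add_edges s [seq (t, u) | t <- ti, u <- tj]) s (cpr c).

Definition trace_step (c : context) (s : state) : state :=
  if cal c is [::] then s else
  let n := size (cba c) in
  foldl (fun s v =>
    (* If no candidate survives, every base vertex enters both lists below and the state becomes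
       contradictory, as it should. *)
    let cp := [seq T <- cal c | subm (take n (row s.1 v)) T
                               & ~~ overlap (row s.2 v) T] in
    add_nons
      (add_edges s [seq (v, i) | i <- iota 0 n & all (fun T => nth false T i) cp])
      [seq (v, i) | i <- iota 0 n & all (fun T => ~~ nth false T i) cp])
    s (iota 0 (size s.1)).

Definition forbs (c : context) (s : state) : seq (seq nat) :=
  if cfz c then
    let n := size (cba c) in
    [seq n :: nth [::] (cba c) i | i <- iota 0 n & bit s.2 n i]
  else [::].

Definition forb_step (c : context) (s : state) : state :=
  foldl (fun s f =>
    foldl (fun s v =>
      (* No vertex sees all of [f]: a single undecided member is a non-neighbour, and if all are
         seen already, the added non-edges make the state contradictory. *)
      match [seq i <- f | ~~ bit s.1 v i] with
      | [::] => add_nons s [seq (v, i) | i <- f]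
      | [:: i] => add_nons s [:: (v, i)]
      | _ => s
      end) s (iota 0 (size s.1))) s (forbs c s).

Definition closure (c : context) (s : state) : state :=
  norm (forb_step c (norm (trace_step c (norm (pair_step c s))))).

(* Branch and bound over the sets containing [M]: such a set is independent,
   avoids [F] and contains no list of [av] only if its weight is at most a
   third of the total.  Here [b] is what is left of that third and [r] the
   weight of the vertices from [i] on. *)
Fixpoint light (e : seq bitseq) (av : seq (seq nat)) (i : nat) (ws : seq nat)
    (M F : bitseq) (b r : nat) : bool :=
  if r <= b then true else
  if ws is w :: ws' then
    if light e av i.+1 ws' M F b (r - w) then
      if (w == 0) || nth false F i then true else
      let M' := set_nth false M i true in
      if has (fun l => covers l M') av then true else
      if w <= b then light e av i.+1 ws' M' (orm F (row e i)) (b - w) (r - w)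
      else false
    else false
  else false.

Fixpoint third (n : nat) : nat := if n is n'.+3 then (third n').+1 else 0.

Definition wcheck (s : state) (av : seq (seq nat)) (ws : seq nat) : bool :=
  let r := sumn ws in
  [&& 0 < r, size ws == size s.1 & light s.1 av 0 ws [::] [::] (third r) r].

Definition new_vertex (s : state) (l : seq nat) : state :=
  let n := size s.1 in
  norm (add_edges (rcons s.1 [::], s.2) [seq (n, i) | i <- l]).

Fixpoint masks (b : branches) : seq (seq nat) :=
  if b is bC l _ b' then l :: masks b' else [::].

Fixpoint check (c : context) (s : state) (t : cert) {struct t} : bool :=
  if bad s then true else
  match t with
  | cX => false
  | cK t' => check c (closure c s) t'
  | cD ws => wcheck s (forbs c s) ws
  | cW ws b => wcheck s (masks b ++ forbs c s) ws && checkb c s b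
  | cS i j t1 t2 =>
      [&& i < size s.1, j < size s.1,
      check c (norm (add_edges s [:: (i, j)])) t1 &
      check c (norm (add_nons s [:: (i, j)])) t2]
  | cC i j t' =>
      [&& bit s.2 i j, i < size s.1, j < size s.1 &
      check c (new_vertex s [:: i; j]) t']
  | cT k h =>
      let tg := nth [::] (ctg c) k in
      (k < size (ctg c)) && all (fun p =>
        [&& p.1 < size h, p.2 < size h & bit s.1 (nth 0 h p.1) (nth 0 h p.2)]) tg
  end
with checkb (c : context) (s : state) (b : branches) {struct b} : bool :=
  match b with
  | bN => true
  | bC l t b' => check c (new_vertex s l) t && checkb c s b'
  end.

Definition init (n : nat) (el nl : seq (nat * nat)) : state :=
  norm (add_nons (add_edges (nseq n [::], [::]) el) nl).

(** * Soundness of the certificate checker *)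

Lemma nth_orm a b i : nth false (orm a b) i = nth false a i || nth false b i.
Proof.
elim: a b i => [|x a IH] [|y b] [|i] //=; by rewrite ?nth_nil ?orbF.
Qed.

Lemma overlapP a b : reflect (exists2 i, nth false a i & nth false b i) (overlap a b).
Proof.
apply: (iffP idP).
  elim: a b => [|x a IH] [|y b] //= /orP[/andP[? ?]|/IH[i ? ?]]; first by exists 0.
  by exists i.+1.
case=> i; elim: a b i => [|x a IH] [|y b] [|i] //=; rewrite ?nth_nil //.
  by move=> -> ->.
by move=> p q; rewrite (IH _ i) ?orbT.
Qed.

Lemma submP a b : reflect (forall i, nth false a i -> nth false b i) (subm a b).
Proof.
apply: (iffP idP).
  elim: a b => [|x a IH] b; first by move=> _ i; rewrite nth_nil.
  case: b => [|y b] /=.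
    by move=> /andP[/negPf-> /IH{}IH] [|i] //= /IH; rewrite nth_nil.
  by move=> /andP[/implyP xy /IH{}IH] [|i] /=; [exact: xy|exact: IH].
elim: a b => [|x a IH] [|y b] //= h.
  have /= := h 0; case: x h => [h /(_ isT)//|h _] /=.
  by apply: IH => i /(h i.+1); rewrite /= nth_nil.
by apply/andP; split; [apply/implyP/(h 0)|apply: IH => i /(h i.+1)].
Qed.

Lemma bit_setb r i j k l : bit (setb r i j) k l = bit r k l || (k == i) && (l == j).
Proof.
rewrite /bit /setb /row nth_set_nth /=; case: eqP => [->|_] /=; last by rewrite orbF.
by rewrite nth_set_nth /=; case: eqP => [->|_] /=; rewrite ?orbT ?orbF.
Qed.

Lemma bit_set2 r p k l : bit (set2 r p) k l =
  [|| bit r k l, (k == p.1) && (l == p.2) | (k == p.2) && (l == p.1)].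
Proof. by rewrite /set2 !bit_setb orbA. Qed.

Lemma size_set2 r p : p.1 < size r -> p.2 < size r -> size (set2 r p) = size r.
Proof. by move=> h1 h2; rewrite /set2 /setb !size_set_nth; lia. Qed.

Lemma bit_foldl_set2 l r i j : bit (foldl set2 r l) i j ->
  [\/ bit r i j, (i, j) \in l | (j, i) \in l].
Proof.
elim: l r => [|[a b] l IH] r /=; first by move=> ?; constructor 1.
case/IH => [|h|h]; last by constructor 3; rewrite inE h orbT.
  rewrite bit_set2 /= => /or3P[?|/andP[/eqP-> /eqP->]|/andP[/eqP-> /eqP->]].
  - by constructor 1.
  - by constructor 2; rewrite mem_head.
  - by constructor 3; rewrite mem_head.
by constructor 2; rewrite inE h orbT.
Qed.

Lemma size_foldl_set2 l r : {in l, forall p, p.1 < size r /\ p.2 < size r} ->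
  size (foldl set2 r l) = size r.
Proof.
elim: l r => [|p l IH] r //= h.
have [h1 h2] := h p (mem_head _ _).
rewrite IH size_set2 // => q ql; apply: h; by rewrite inE ql orbT.
Qed.

Lemma nth_rows_of e a r j : nth false (rows_of e a r) j ->
  exists2 k, nth false a k & bit r k j.
Proof.
elim: a r => [|x a IH] [|y r] /=; try by case: x; rewrite nth_nil.
  by rewrite nth_nil.
  by rewrite nth_nil.
case: x; rewrite ?nth_orm; last by case/IH => k; exists k.+1.
by case/orP => [?|/IH[k]]; [exists 0|exists k.+1].
Qed.

Section Soundness.
Variables (E : rel nat) (GE : dense_graph E).
Variables (c : context) (b : seq nat).
Notation "b `_ i" := (nth 0 b i) : nat_scope.
Let n := size (cba c).
Let z := b`_n.

Definition sees t l := all (fun i => E t b`_i) l.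

Hypothesis base_le : n <= size b.
Hypothesis base_bound : {in cba c, forall l, all (fun i => i < n) l}.
Hypothesis no_target : {in ctg c, forall tg, forall h : seq nat,
  ~ {in tg, forall p, E h`_p.1 h`_p.2}}.
Hypothesis good_pair : {in cpr c, forall p, forall t u,
  sees t (nth [::] (cba c) p.1) -> sees u (nth [::] (cba c) p.2) -> E t u}.
Hypothesis traces : cal c <> [::] ->
  forall v, exists2 T, T \in cal c & forall i, nth false T i = (i < n) && E v b`_i.
Hypothesis forbidden : cfz c -> n < size b /\
  forall i, i < n -> ~~ E z b`_i -> forall t,
  E t z -> ~~ sees t (nth [::] (cba c) i).

(** New vertices are appended to [g]. Keeping [b] as a prefix makes the hypotheses on the context,
    which speak of [b], available at every node of the tree. *)
Definition sat (g : seq nat) (s : state) : Prop :=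
  [/\ take (size b) g = b, size s.1 = size g,
      forall i j, bit s.1 i j -> [/\ i < size g, j < size g & E g`_i g`_j]
    & forall i j, bit s.2 i j -> [/\ i < size g, j < size g & ~~ E g`_i g`_j]].

Let sym x y : E x y = E y x. Proof. exact: (dg_sym GE). Qed.

Let nb i : i < n -> i < size b.
Proof. by move=> h; apply: leq_trans h base_le. Qed.

Lemma sat_prefix g s i : sat g s -> i < size b -> g`_i = b`_i.
Proof. by case=> h _ _ _ ib; rewrite -h nth_take. Qed.

Lemma sat_size g s : sat g s -> size b <= size g.
Proof. by case=> h _ _ _; rewrite -h size_take; case: ltnP => //; lia. Qed.

Lemma sat_edges g s l : sat g s ->
  {in l, forall p, [/\ p.1 < size g, p.2 < size g & E g`_p.1 g`_p.2]} ->
  sat g (add_edges s l).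
Proof.
move=> [h1 h2 h3 h4] hl; split=> //=.
  rewrite size_foldl_set2 // h2 => p /hl[*]; by split.
move=> i j /bit_foldl_set2[/h3//|/hl[]//|/hl[*]]; by rewrite sym.
Qed.

Lemma sat_nons g s l : sat g s ->
  {in l, forall p, [/\ p.1 < size g, p.2 < size g & ~~ E g`_p.1 g`_p.2]} ->
  sat g (add_nons s l).
Proof.
move=> [h1 h2 h3 h4] hl; split=> //= i j /bit_foldl_set2[/h4//|/hl//|/hl[*]].
by rewrite sym.
Qed.

Lemma sat_norm g s : sat g s -> sat g (norm s).
Proof.
move=> [h1 h2 h3 h4]; split=> //= i j.
rewrite /bit {1}/row.
case: (ltnP i (size s.1)) => hi; last first.
  by rewrite (nth_default [::]) ?nth_nil // size_map size_iota.
rewrite (nth_map 0) ?size_iota // nth_iota // add0n nth_orm.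
case/orP => [/h4//|/nth_rows_of[k ik kj]].
have [ig _ e1] := h3 i k ik; have [_ jg e2] := h3 k j kj.
by split=> //; apply: dg_tri GE _ _ _ e1 e2.
Qed.

Lemma sat_bad g s : sat g s -> ~~ bad s.
Proof.
move=> [h1 h2 h3 h4]; apply/negP => /hasP[p /(nthP ([::], [::]))[i hi <-]].
rewrite nth_zip_cond hi /= => /overlapP[j /(h3 i j)[_ _ ij] /(h4 i j)[_ _ /negP]].
by [].
Qed.

Lemma sees_cover g s t l : sat g s -> all (fun i => i < n) l ->
  covers l (row s.1 t) -> sees g`_t l.
Proof.
move=> gs /allP ln /allP cl; apply/allP => i il.
have [_ _ h _] := gs.
have ib : i < size b by apply: leq_trans (ln i il) base_le.
by have [_ _] := h _ _ (cl i il); rewrite (sat_prefix gs ib).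
Qed.

Lemma cba_bound i : all (fun i => i < n) (nth [::] (cba c) i).
Proof.
case: (ltnP i (size (cba c))) => hi; last by rewrite nth_default.
exact/base_bound/mem_nth.
Qed.

Lemma sat_foldl (T : eqType) (f : state -> T -> state) g s (l : seq T) :
  (forall s x, x \in l -> sat g s -> sat g (f s x)) -> sat g s -> sat g (foldl f s l).
Proof.
elim: l s => [|x l IH] s //= h gs; apply: IH.
  by move=> s' y yl; apply: h; rewrite inE yl orbT.
by apply: h => //; rewrite mem_head.
Qed.

Lemma sat_pair g s : sat g s -> sat g (pair_step c s).
Proof.
apply: sat_foldl => {}s [i j] ij gs; apply: sat_edges => // p.
case/allpairsP => -[t u] /= [].
rewrite !mem_filter !mem_iota /= add0n => /andP[ct ht] /andP[cu hu] -> /=.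
have [_ hs _ _] := gs; rewrite -hs; split=> //.
exact: (good_pair ij (sees_cover gs (cba_bound i) ct) (sees_cover gs (cba_bound j) cu)).
Qed.

Lemma sat_trace g s : sat g s -> sat g (trace_step c s).
Proof.
rewrite /trace_step; case ec : (cal c) => [|T0 al] //; rewrite -ec => gs.
have [_ hs _ _] := gs.
apply: sat_foldl => // {gs}s' v; rewrite mem_iota add0n /= hs => hv gs.
set cp := [seq T <- cal c | _].
have ne : cal c <> [::] by rewrite ec.
have [T Tin HT] := traces ne (nth 0 g v).
have ng i : i < n -> i < size g.
  by move/nb => hi; apply: leq_trans hi (sat_size gs).
have Tcp : T \in cp.
  have [_ _ h3 h4] := gs.
  rewrite mem_filter Tin andbT; apply/andP; split.
    apply/submP => i; case: (ltnP i n) => hi; last first.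
      by rewrite nth_default // size_take; case: ltnP => // /leq_trans->.
    rewrite nth_take // => /(h3 v i)[_ _].
    by rewrite HT hi (sat_prefix gs (nb hi)).
  apply/negP => /overlapP[i /(h4 v i)[_ _ vi]]; rewrite HT => /andP[hi].
  by rewrite -(sat_prefix gs (nb hi)); apply/negP.
apply: sat_nons; first apply: sat_edges => //.
- move=> p /mapP[i]; rewrite mem_filter mem_iota => /andP[/allP ai hi] -> /=.
  have := ai _ Tcp; rewrite HT => /andP[_ e]; rewrite (sat_prefix gs (nb hi)).
  by split=> //; apply: ng.
- move=> p /mapP[i]; rewrite mem_filter mem_iota => /andP[/allP ai hi] -> /=.
  by have := ai _ Tcp; rewrite HT (sat_prefix gs (nb hi)) (hi : i < n); split=> //; apply: ng.
Qed.

Lemma sat_forb g s : sat g s -> sat g (forb_step c s).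
Proof.
rewrite /forb_step /forbs; case fz : (cfz c) => // gs.
have [nb0 fb] := forbidden fz.
apply: sat_foldl => // s' f /mapP[i]; rewrite mem_filter mem_iota add0n /= => /andP[ni hi] -> gs'.
have [_ hsz _ _] := gs'.
have nz : ~~ E z b`_i.
  have [_ _ _ h4] := gs.
  have [_ _] := h4 _ _ ni.
  by rewrite (sat_prefix gs nb0) (sat_prefix gs (nb hi)).
have hf t : ~~ all (fun k => E g`_t g`_k) (n :: nth [::] (cba c) i).
  rewrite /= (sat_prefix gs nb0).
  apply/negP => /andP[tz ta]; have /negP := fb i hi nz g`_t tz; apply.
  apply/allP => k kl; move/allP: ta => /(_ _ kl).
  by have /allP/(_ _ kl) /nb kn := cba_bound i; rewrite (sat_prefix gs kn).
have hb : {in n :: nth [::] (cba c) i, forall k, k < size g}.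
  move=> k; rewrite inE => kl; apply: leq_trans (sat_size gs).
  by case/orP: kl => [/eqP->//|kl]; have /allP/(_ _ kl)/nb := cba_bound i.
move: (n :: _) hf hb => l hf hb.
apply: sat_foldl => // {gs'}s2 v; rewrite mem_iota add0n /= hsz => hv gs2.
have [_ _ h3 _] := gs2.
have : has [pred k | ~~ E g`_v g`_k] l by have := hf v; rewrite -has_predC.
case/hasP => k kl /= nk.
have : k \in [seq k <- l | ~~ bit s2.1 v k].
  by rewrite mem_filter kl andbT; apply: contra nk => /h3[].
case: [seq k <- l | _] => [|k1 [|k2 r]] //; rewrite inE => /eqP <-.
apply: sat_nons => // p; rewrite inE => /eqP-> /=; by split=> //; apply: hb.
Qed.

Lemma sat_closure g s : sat g s -> sat g (closure c s).
Proof.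
by move=> gs; rewrite /closure; apply/sat_norm/sat_forb/sat_norm/sat_trace/sat_norm/sat_pair.
Qed.

Definition nbr (g : seq nat) t i := (i < size g) && E t g`_i.

(** Invariant of the search: t sees all of [M] and nothing in [F], and what it sees from position i
    on must fit in the remaining budget. Once t sees i, triangle-freeness moves the neighbours of i
    into [F]. *)
Lemma light_sound g s av t (gs : sat g s) :
  {in av, forall l, ~~ all (nbr g t) l} ->
  forall ws i M F m r, light s.1 av i ws M F m r ->
  r = sumn ws -> size ws = size g - i ->
  (forall k, nth false M k -> nbr g t k) -> (forall k, nth false F k -> ~~ E t g`_k) ->
  wdeg E t (drop i g) ws <= m.
Proof.
have [_ _ h3 _] := gs => hav; rewrite /wdeg.
elim=> [|w ws IH] i M F m r; first by case: (drop i g).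
move=> hl er hs hM hF; move: hl; rewrite /= er /=.
have ig : i < size g by move: hs => /=; lia.
have -> : drop i g = g`_i :: drop i.+1 g by rewrite -drop_nth.
case: ifP => [h _|_].
  apply: leq_trans h; rewrite /=; apply: leq_add; first by case: (E _ _); lia.
  elim: (drop i.+1 g) ws {IH er hs} => [|x d IHd] [|v ws] //=.
  by apply: leq_add; [case: (E _ _); lia|exact: IHd].
rewrite addKn; case: ifP => // h1 h2.
have hs' : size ws = size g - i.+1 by move: hs => /=; lia.
have := IH _ _ _ _ _ h1 erefl hs' hM hF => {h1} /=.
case ti : (E t g`_i); last by rewrite muln0.
case: eqP h2 => [-> //|_] /=.
case Fi : (nth false F i); first by have := hF _ Fi; rewrite ti.
rewrite muln1 /= => h2 _.
have hM' k : nth false (set_nth false M i true) k -> nbr g t k.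
  by rewrite nth_set_nth /=; case: eqP => [-> _|_ /hM//]; rewrite /nbr ig ti.
case: hasP h2 => [[l lav /allP cl] _|_].
  have /negP[] := hav l lav; apply/allP => k /cl; exact: hM'.
case: ifP => // wm h2.
have : wdeg E t (drop i.+1 g) ws <= m - w.
  rewrite /wdeg; apply: IH h2 _ _ hM' _ => // k; rewrite nth_orm => /orP[/hF//|].
  move/(h3 i k) => [_ _ e]; exact: dg_tri GE _ _ _ ti e.
by rewrite /wdeg; lia.
Qed.

Lemma thirdP m : 3 * third m <= m.
Proof. by have [k] := ubnP m; elim: k m => // k IH [|[|[|m]]] //= /ltnSE h; have := IH m; lia. Qed.

(** The vertex t from [dg_heavy] exceeds the budget, so the search can only have succeeded by
    pruning at a list of [av]; t sees such a list. *)
Lemma wcheck_sound g s av ws : sat g s -> wcheck s av ws ->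
  exists t, has (all (nbr g t)) av.
Proof.
move=> gs /and3P[h0 /eqP hs hl].
have [_ hg _ _] := gs.
have [||t ht] := dg_heavy GE (g := g) (ws := ws) => //; first by rewrite hs.
exists t; apply: contraLR ht => /hasPn nav; rewrite -leqNgt.
have n0 (P : nat -> bool) k : nth false [::] k -> P k by case: k.
have := light_sound gs nav hl erefl _ (n0 _) (n0 _).
by rewrite subn0 drop0 hs hg => /(_ erefl); have := thirdP (sumn ws); lia.
Qed.

Lemma sat_new g s l t : sat g s -> all (nbr g t) l -> sat (rcons g t) (new_vertex s l).
Proof.
move=> gs /allP hl; apply: sat_norm.
have [h1 h2 h3 h4] := gs.
have nr k : k < size g -> (rcons g t)`_k = g`_k by move=> h; rewrite nth_rcons h.
have h0 : sat (rcons g t) (rcons s.1 [::], s.2).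
  split=> /=.
  - by rewrite -cats1 takel_cat // (sat_size gs).
  - by rewrite !size_rcons h2.
  - move=> i j; rewrite size_rcons => ij.
    have /h3[hi hj e] : bit s.1 i j.
      move: ij; rewrite /bit /row nth_rcons; case: ltnP => // _.
      by case: eqP => _; rewrite nth_nil.
    by rewrite !nr //; split=> //; exact: ltnW.
  - move=> i j /h4[hi hj e]; rewrite size_rcons !nr //; split=> //; exact: ltnW.
apply: sat_edges => // p /mapP[i /hl/andP[ig ti]] -> /=.
by rewrite size_rcons h2 nth_rcons ltnn eqxx nr //; split=> //; exact: ltnW.
Qed.

Lemma forbs_sound g s t l : sat g s -> l \in forbs c s -> ~~ all (nbr g t) l.
Proof.
move=> gs; rewrite /forbs; case fz : (cfz c) => //.
have [nb0 fb] := forbidden fz; have [_ _ _ h4] := gs.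
case/mapP=> i; rewrite mem_filter mem_iota add0n /= => /andP[ni hi] ->.
have [_ _] := h4 _ _ ni.
rewrite (sat_prefix gs nb0) (sat_prefix gs (nb hi)) => nz.
rewrite /= /nbr (sat_prefix gs nb0); apply/negP => /andP[/andP[_ tz] /allP ta].
have /negP := fb i hi nz t tz; apply; apply/allP => k kl.
have /andP[_] := ta k kl; have /allP/(_ _ kl)/nb kb := cba_bound i.
by rewrite (sat_prefix gs kb).
Qed.

Let ifbad (x y : bool) : (if x then true else y) -> x \/ y.
Proof. by case: x; [left|right]. Qed.

(** For a list of branches the conclusion is about all vertices t: one that saw a mask could be
    added as the new vertex of that branch, whose certificate refutes the enlarged state. *)
Lemma check_sound :
  (forall t s g, check c s t -> ~ sat g s) /\
  (forall br s g, checkb c s br -> sat g s ->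
     forall t, {in masks br, forall l, ~~ all (nbr g t) l}).
Proof.
apply: cert_branches_ind => /=.
- by move=> s g; case: ifP => // h _ /sat_bad/negP.
- move=> t IH s g /ifbad[h /sat_bad/negP//|h gs].
  exact: IH h (sat_closure gs).
- move=> ws s g /ifbad[h /sat_bad/negP//|h gs].
  have [t /hasP[l lf tl]] := wcheck_sound gs h.
  by have := forbs_sound t gs lf; rewrite tl.
- move=> ws br IH s g /ifbad[h /sat_bad/negP//|/andP[hw hb] gs].
  have [t /hasP[l]] := wcheck_sound gs hw; rewrite mem_cat => /orP[lm|lf] tl.
    by have := IH _ _ hb gs t l lm; rewrite tl.
  by have := forbs_sound t gs lf; rewrite tl.
- move=> i j t1 IH1 t2 IH2 s g /ifbad[h /sat_bad/negP//|/and4P[hi hj c1 c2] gs].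
  have [_ hs _ _] := gs.
  case e : (E g`_i g`_j).
    apply: (IH1 _ g c1); apply/sat_norm/sat_edges => // p; rewrite inE => /eqP-> /=.
    by rewrite -hs.
  apply: (IH2 _ g c2); apply/sat_norm/sat_nons => // p; rewrite inE => /eqP-> /=.
  by rewrite -hs e.
- move=> i j t IH s g /ifbad[h /sat_bad/negP//|/and4P[hij hi hj hc] gs].
  have [_ hs _ h4] := gs; have [_ _ /(dg_com GE)[u iu uj]] := h4 _ _ hij.
  apply: (IH _ (rcons g u) hc); apply: sat_new => //; rewrite /= /nbr -hs hi hj.
  by rewrite sym iu uj.
- move=> k h s g /orP[? /sat_bad/negP//|/andP[hk /allP ht] gs].
  apply: (@no_target _ (mem_nth [::] hk) [seq g`_i | i <- h]) => p /ht.
  case/and3P=> h1 h2; have [_ _ h3 _] := gs; move/h3 => [_ _].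
  by rewrite !(nth_map 0).
- by [].
- move=> l t IH br IHb s g /andP[h1 h2] gs t' l'; rewrite inE => /orP[/eqP->|].
    by apply/negP => hl; apply: (IH _ (rcons g t') h1); apply: sat_new.
  exact: IHb h2 gs t' l'.
Qed.

Lemma refute t k el nl : check c (init k el nl) t -> size b = k ->
  all (fun p => (p.1 < k) && (p.2 < k)) (el ++ nl) ->
  {in el, forall p, E b`_p.1 b`_p.2} -> {in nl, forall p, ~~ E b`_p.1 b`_p.2} -> False.
Proof.
move=> hc hb; rewrite all_cat => /andP[/allP hel /allP hnl] he hn.
have [+ _] := check_sound; move=> /(_ _ _ b hc); apply.
apply/sat_norm/sat_nons; last first.
  by move=> p hp; have /andP[] := hnl _ hp; rewrite hb; split=> //; apply: hn.
apply: sat_edges; last first.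
  by move=> p hp; have /andP[] := hel _ hp; rewrite hb; split=> //; apply: he.
split=> //=; first by rewrite take_size.
- by rewrite size_nseq.
- by move=> i j; rewrite /bit /row nth_nseq; case: ifP => _; rewrite nth_nil.
- by move=> i j; rewrite /bit /row nth_nil nth_nil.
Qed.

End Soundness.

(** * Traces on a pattern *)

Definition hom (E : rel nat) (n : nat) (el : seq (nat * nat)) (g : seq nat) : Prop :=
  size g = n /\ {in el, forall p, E (nth 0 g p.1) (nth 0 g p.2)}.

Definition omits (E : rel nat) (tgs : seq (nat * seq (nat * nat))) : Prop :=
  {in tgs, forall p, forall g, ~ hom E p.1 p.2 g}.

Definition trace (E : rel nat) (n : nat) (g : seq nat) (z : nat) : seq nat :=
  [seq i <- iota 0 n | E z (nth 0 g i)].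

Section Family.
Variables (n : nat) (el : seq (nat * nat)) (tgs : seq (nat * seq (nat * nat))).

Definition adjl i := [seq j <- iota 0 n | ((i, j) \in el) || ((j, i) \in el)].
Definition adjs := [seq adjl i | i <- iota 0 n].
Definition edges_from (k : nat) (l : seq nat) := [seq (k, i) | i <- l].
Definition compl (l : seq nat) := [seq i <- iota 0 n | i \notin l].
Definition tob (l : seq nat) : bitseq := [seq i \in l | i <- iota 0 n].
Definition insert_at i (l : seq nat) := [seq j <- iota 0 n | (j == i) || (j \in l)].
Definition indep (A : seq (seq nat)) (l : seq nat) :=
  all (fun i => let ai := nth [::] A i in ~~ has (fun j => j \in ai) l) l.
Definition tg_edges := [seq p.2 | p <- tgs].

(** Enumerates the independent sets of the pattern, since by triangle-freeness every trace is one of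
    them. *)
Fixpoint indeps (A : seq (seq nat)) (m k : nat) (l : seq nat) : seq (seq nat) :=
  if m is m'.+1 then
    let ak := nth [::] A k in
    indeps A m' k.+1 l ++
    (if has (fun j => j \in ak) l then [::] else indeps A m' k.+1 (rcons l k))
  else [:: l].

Definition wf_edges := all (fun p => [&& p.1 < n, p.2 < n & p.1 != p.2]) el.

Definition wf_targets :=
  all (fun t => all (fun p => (p.1 < t.1) && (p.2 < t.1)) t.2) tgs.

Definition pair_ok A (p : nat * nat * cert) :=
  let: (i, j, t) := p in
  [&& i < n, j < n &
  check (Context tg_edges [::] [::] [::] false)
    (init n.+2 (el ++ edges_from n (nth [::] A i) ++ edges_from n.+1 (nth [::] A j)) [:: (n, n.+1)]) t].

Definition pairs_of (P : seq (nat * nat * cert)) := [seq p.1 | p <- P].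

(** Used for admissible traces T: when enlarging a trace by i produces T instead of an excluded
    trace, a vertex with trace T must be shown to see all twins of i, not only the one in the
    copy. *)
Definition transfer_ok A P (p : seq nat * nat * cert) :=
  let: (T, i, t) := p in
  [&& all (fun k => k < n) T, i < n &
  check (Context tg_edges A (pairs_of P) [::] false)
    (init n.+2 (el ++ edges_from n T ++ edges_from n.+1 (nth [::] A i))
       (edges_from n (compl T) ++ [:: (n, n.+1)])) t].

Definition handled A P (R : seq (seq nat * nat * cert)) (T : seq nat) i :=
  ((T, i) \in [seq p.1 | p <- R]) ||
  has (fun p => (T == nth [::] A p.1) && (p.2 == i) || (T == nth [::] A p.2) && (p.1 == i)) (pairs_of P).

(* Replacing the base vertex i by a twin that sees z enlarges the trace of z by
   i.  Excluding the traces in the order of [Ts], with larger ones first, one may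
   therefore assume that no twin of a vertex outside the trace sees z. *)
Fixpoint traces_ok A legit P R (pre : seq (seq nat)) (Ts : seq (seq nat * cert)) : bool :=
  if Ts is (T, t) :: Ts' then
    [&& all (fun k => k < n) T,
     check (Context tg_edges A (pairs_of P) [seq tob l | l <- legit ++ [seq p.1 | p <- Ts]] true)
      (init n.+1 (el ++ edges_from n T) (edges_from n (compl T))) t,
     all (fun i => let T' := insert_at i T in
            [|| ~~ indep A T', T' \in pre | (T' \in legit) && handled A P R T' i]) (compl T) &
     traces_ok A legit P R (T :: pre) Ts']
  else true.

Definition family_ok legit P R Ts :=
  let A := adjs in
  [&& wf_edges, wf_targets, all (pair_ok A) P, all (transfer_ok A P) R,
   traces_ok A legit P R [::] Ts &
   all (fun l => (l \in legit) || (l \in [seq p.1 | p <- Ts])) (indeps A n 0 [::])].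

End Family.

Lemma all_fst (A : eqType) (B : Type) (a : pred (A * B)) s : all a s ->
  {in [seq p.1 | p <- s], forall x, exists t, a (x, t)}.
Proof.
elim: s => [|[x t] s IH] //= /andP[h /IH{}IH] y; rewrite inE => /orP[/eqP->|/IH//].
by exists t.
Qed.

Section Soundness.
Variables (E : rel nat) (GE : dense_graph E).
Variables (n : nat) (el : seq (nat * nat)).
Hypothesis wfe : wf_edges n el.
Notation hom := (hom E n el).
Notation trace := (trace E n).
Notation adjl := (adjl n el).
Notation adjs := (adjs n el).

(** Exactly what allows t to replace the i-th vertex of the copy [g]; see [set_hom]. *)
Definition twin g t i := sees E g t (adjl i).

Let sym x y : E x y = E y x. Proof. exact: (dg_sym GE). Qed.

Let irr x : ~~ E x x.
Proof. by apply/negP => e; have := dg_tri GE e e; rewrite e. Qed.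

Lemma size_adjs : size adjs = n.
Proof. by rewrite size_map size_iota. Qed.

Lemma nth_adjs i : i < n -> nth [::] adjs i = adjl i.
Proof. by move=> hi; rewrite (nth_map 0) ?size_iota // nth_iota. Qed.

Lemma adjl_bound i : all (fun k => k < n) (adjl i).
Proof. by apply/allP => k; rewrite mem_filter mem_iota => /andP[]. Qed.

Lemma adjs_bound : {in adjs, forall l, all (fun i => i < n) l}.
Proof. by move=> _ /mapP[i _ ->]; apply: adjl_bound. Qed.

Lemma adjl_edge g i k : hom g -> k \in adjl i -> E (nth 0 g i) (nth 0 g k).
Proof.
case=> _ h; rewrite mem_filter => /andP[/orP[/h//|/h/=]]; by rewrite sym.
Qed.

Lemma adjl_irr i : i \notin adjl i.
Proof.
apply/negP; rewrite mem_filter => /andP[h _]; have {h} : (i, i) \in el by case/orP: h.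
by move/(allP wfe)/and3P => [_ _]; rewrite eqxx.
Qed.

Lemma mem_trace g z i : (i \in trace g z) = (i < n) && E z (nth 0 g i).
Proof. by rewrite mem_filter mem_iota add0n andbC. Qed.

Lemma trace_indep g z : hom g -> indep adjs (trace g z).
Proof.
move=> hg; apply/allP => i; rewrite mem_trace => /andP[hi zi] /=.
rewrite nth_adjs //; apply/hasPn => j; rewrite mem_trace => /andP[_ zj]; apply/negP => ij.
have := dg_tri GE (y := nth 0 g i) zi (adjl_edge hg ij); by rewrite zj.
Qed.

Lemma indepsP m k l (P : pred nat) : k + m = n ->
  (forall i, P i -> forall j, P j -> j \notin adjl i) ->
  l = [seq i <- iota 0 k | P i] ->
  [seq i <- iota 0 n | P i] \in indeps adjs m k l.
Proof.
move=> + hP; elim: m k l => [|m IH] k l; rewrite /=.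
  by rewrite addn0 => -> ->; rewrite mem_head.
move=> hk hl; rewrite mem_cat nth_adjs; last by lia.
have hk' : k.+1 + m = n by lia.
have e : [seq i <- iota 0 k.+1 | P i] = if P k then rcons l k else l.
  by rewrite -addn1 iotaD filter_cat /= add0n -hl; case: (P k); rewrite ?cats1 ?cats0.
case Pk : (P k) e => e; last by rewrite IH.
rewrite ifF; first by rewrite (IH k.+1 (rcons l k)) ?orbT.
apply/negbTE/hasPn => j; rewrite hl mem_filter => /andP[Pj _]; exact: hP.
Qed.

Lemma set_hom g i t : hom g -> i < n -> twin g t i -> hom (set_nth 0 g i t).
Proof.
move=> [hs hg] hi /allP ht; split; first by rewrite size_set_nth; lia.
move=> [a b] ab; rewrite !nth_set_nth /=.
have /and3P[/= ha hb nab] := allP wfe _ ab.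
case: eqP => [ea|_]; case: eqP => [eb|_].
- by rewrite ea eb eqxx in nab.
- by apply: ht; rewrite mem_filter mem_iota -ea ab hb.
- by rewrite sym; apply: ht; rewrite mem_filter mem_iota -eb ab ha orbT.
- exact: (hg _ ab).
Qed.

Lemma trace_set g i t z : hom g -> i < n -> E z t ->
  trace (set_nth 0 g i t) z = insert_at n i (trace g z).
Proof.
move=> [hs _] hi zt; apply: eq_in_filter => j; rewrite mem_iota add0n /= => hj.
by rewrite nth_set_nth /=; case: eqP => //= _; rewrite mem_trace hj.
Qed.

Lemma twin_set g i t z j : hom g -> i < n -> twin g z j -> i \notin adjl j ->
  twin (set_nth 0 g i t) z j.
Proof.
move=> hg hi /allP h nij; apply/allP => k kj; rewrite nth_set_nth /=.
by case: eqP => [ki|_]; [rewrite -ki kj in nij|apply: h].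
Qed.

Lemma twin_self g i : hom g -> twin g (nth 0 g i) i.
Proof. by move=> hg; apply/allP => k; apply: adjl_edge. Qed.

Lemma trace_twin g z i : trace g z = adjl i -> twin g z i.
Proof. by move=> e; apply/allP => k; rewrite -e mem_trace => /andP[]. Qed.

Lemma nth_ext g l i : size g = n -> i < n -> nth 0 (g ++ l) i = nth 0 g i.
Proof. by move=> hs hi; rewrite nth_cat hs hi. Qed.

Variable tgs : seq (nat * seq (nat * nat)).
Hypothesis noT : omits E tgs.
Hypothesis wft : wf_targets tgs.

Lemma no_tg : {in tg_edges tgs, forall tg, forall h : seq nat,
  ~ {in tg, forall p, E (nth 0 h p.1) (nth 0 h p.2)}}.
Proof.
move=> _ /mapP[t ht ->] h hh; have := noT ht (g := mkseq (nth 0 h) t.1); apply.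
split=> [|p hp]; first by rewrite size_mkseq.
have /allP/(_ p hp)/andP[h1 h2] := allP wft t ht.
by rewrite !nth_mkseq //; apply: hh.
Qed.

Lemma pair_sound g i j t x y : hom g -> pair_ok n el tgs adjs (i, j, t) ->
  twin g x i -> twin g y j -> E x y.
Proof.
move=> [hs hg] /and3P[hi hj]; rewrite !nth_adjs // => hc xi yj; apply: contraT => nxy; exfalso.
have hb k : k < n -> nth 0 (g ++ [:: x; y]) k = nth 0 g k by apply: nth_ext.
have hx : nth 0 (g ++ [:: x; y]) n = x by rewrite nth_cat hs ltnn subnn.
have hy : nth 0 (g ++ [:: x; y]) n.+1 = y by rewrite nth_cat hs ltnNge leqnSn subSnn.
apply: (refute GE (b := g ++ [:: x; y]) _ _ _ _ _ _ hc) => //; try exact: no_tg.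
- by rewrite size_cat hs addn2.
- rewrite !all_cat !all_map /= ltnSn leqnSn /= !andbT.
  apply/and3P; split; first by apply: sub_all wfe => p /and3P[]; lia.
    by apply: sub_all (adjl_bound i) => k /=; lia.
  by apply: sub_all (adjl_bound j) => k /=; lia.
- move=> p; rewrite !mem_cat => /or3P[pe|/mapP[k ki ->]|/mapP[k kj ->]] /=.
  + by have /and3P[h1 h2 _] := allP wfe _ pe; rewrite !hb //; apply: hg.
  + by rewrite hx hb ?(allP (adjl_bound i)) //; apply: (allP xi).
  + by rewrite hy hb ?(allP (adjl_bound j)) //; apply: (allP yj).
- by move=> p; rewrite inE => /eqP-> /=; rewrite hx hy.
Qed.

Lemma pairs_sound g P : hom g -> all (pair_ok n el tgs adjs) P ->
  {in pairs_of P, forall p, forall x y, twin g x p.1 -> twin g y p.2 -> E x y}.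
Proof.
by move=> hg /all_fst hP [i j] /hP[t ht] x y; apply: pair_sound hg ht.
Qed.

Section Pairs.
Variable P : seq (nat * nat * cert).
Hypothesis hP : all (pair_ok n el tgs adjs) P.

Lemma pairs_bound : {in pairs_of P, forall p, p.1 < n /\ p.2 < n}.
Proof. by move=> [i j] /(all_fst hP)[t /and3P[]]. Qed.

Lemma good_pairs g l : hom g -> {in pairs_of P, forall p, forall t u,
  sees E (g ++ l) t (nth [::] adjs p.1) -> sees E (g ++ l) u (nth [::] adjs p.2) -> E t u}.
Proof.
move=> hg p pP t u; have [h1 h2] := pairs_bound pP; rewrite !nth_adjs // => ht hu.
have [hs _] := hg.
have tr x i : sees E (g ++ l) x (adjl i) -> twin g x i.
  move=> /allP h; apply/allP => k ki; have := h k ki; rewrite nth_ext //.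
  exact: (allP (adjl_bound i)).
exact: (pairs_sound hg hP pP (tr _ _ ht) (tr _ _ hu)).
Qed.

Lemma transfer_sound g T i t x y : hom g -> transfer_ok n el tgs adjs P (T, i, t) ->
  trace g x = T -> twin g y i -> E x y.
Proof.
move=> hg /and3P[hT hi]; rewrite nth_adjs // => hc xT yi; apply: contraT => nxy; exfalso.
have [hs he] := hg.
have hb k : k < n -> nth 0 (g ++ [:: x; y]) k = nth 0 g k by apply: nth_ext.
have hx : nth 0 (g ++ [:: x; y]) n = x by rewrite nth_cat hs ltnn subnn.
have hy : nth 0 (g ++ [:: x; y]) n.+1 = y by rewrite nth_cat hs ltnNge leqnSn subSnn.
apply: (refute GE (b := g ++ [:: x; y]) _ _ _ _ _ _ hc) => //=; try exact: no_tg.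
- by rewrite size_adjs size_cat hs leq_addr.
- by rewrite size_adjs; apply: adjs_bound.
- exact: good_pairs.
- by rewrite size_cat hs addn2.
- rewrite !all_cat !all_map /= ltnSn leqnSn /= !andbT.
  rewrite -!andbA; apply/and4P; split; first by apply: sub_all wfe => p /and3P[]; lia.
  + by apply: sub_all hT => k /=; lia.
  + by apply: sub_all (adjl_bound i) => k /=; lia.
  + by apply/allP => k; rewrite mem_filter mem_iota /= => /andP[]; lia.
- move=> p; rewrite !mem_cat => /or3P[pe|/mapP[k ki ->]|/mapP[k kj ->]] /=.
  + by have /and3P[h1 h2 _] := allP wfe _ pe; rewrite !hb //; apply: he.
  + by rewrite hx hb ?(allP hT) //; move: ki; rewrite -xT mem_trace => /andP[].
  + by rewrite hy hb ?(allP (adjl_bound i)) //; apply: (allP yi).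
- move=> p; rewrite mem_cat inE => /orP[/mapP[k ki ->]|/eqP->] /=; last by rewrite hx hy.
  move: ki; rewrite mem_filter mem_iota /= add0n -xT mem_trace => /andP[h kn].
  by rewrite hx hb //; rewrite kn in h.
Qed.

Section Traces.
Variables (R : seq (seq nat * nat * cert)) (legit : seq (seq nat)).
Hypothesis hR : all (transfer_ok n el tgs adjs P) R.

Lemma handled_sound g T i x y : hom g -> handled adjs P R T i ->
  trace g x = T -> twin g y i -> E x y.
Proof.
move=> hg /orP[/(all_fst hR)[t ht]|/hasP[p pP]].
  exact: transfer_sound hg ht.
have [p1 p2] := pairs_bound pP; rewrite !nth_adjs //.
move=> + xT yi; case/orP => /andP[/eqP e /eqP ei].
  apply: (pairs_sound hg hP pP); last by rewrite ei.
  by apply: trace_twin; rewrite xT.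
rewrite sym; apply: (pairs_sound hg hP pP); first by rewrite ei.
by apply: trace_twin; rewrite xT.
Qed.

(** Excluded traces accumulate in [pre]. The certificate for T may assume that every trace is
    admissible or still to be excluded, so later certificates work with fewer candidates. *)
Lemma traces_sound Ts pre : traces_ok n el tgs adjs legit P R pre Ts ->
  (forall g z, hom g -> [|| trace g z \in pre, trace g z \in legit | trace g z \in [seq p.1 | p <- Ts]]) ->
  (forall g z, hom g -> trace g z \notin pre) ->
  forall g z, hom g -> trace g z \in legit.
Proof.
elim: Ts pre => [|[T t] Ts IH] pre /=.
  by move=> _ hall hpre g z hg; have := hall g z hg; rewrite (negPf (hpre g z hg)) orbF.
move=> /and4P[hT hc hs hk] hall hpre.
have hT0 g z : hom g -> trace g z != T.
  move=> hg; apply/eqP => e.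
  have [hsz he] := hg.
  have hb k : k < n -> nth 0 (rcons g z) k = nth 0 g k.
    by move=> h; rewrite -cats1 nth_ext.
  have hz : nth 0 (rcons g z) n = z by rewrite -cats1 nth_cat hsz ltnn subnn.
  apply: (refute GE (b := rcons g z) _ _ _ _ _ _ hc) => //=; try exact: no_tg.
  - by rewrite size_adjs size_rcons hsz.
  - by rewrite size_adjs; apply: adjs_bound.
  - by rewrite -cats1; apply: good_pairs.
  - move=> _ v; exists (tob n (trace g v)).
      apply: map_f; rewrite mem_cat inE; have := hall g v hg.
      by rewrite (negPf (hpre g v hg)) /= inE.
    move=> i; rewrite size_adjs; case: (ltnP i n) => hi /=.
      by rewrite (nth_map 0) ?size_iota // nth_iota // mem_trace hi /= hb.
    by rewrite nth_default // size_map size_iota.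
  - rewrite size_adjs size_rcons hsz; split=> // i hi; rewrite hz hb // nth_adjs //.
    move=> nzi u uz; apply/negP => ui.
    have {}ui : twin g u i.
      apply/allP => k ki; have := allP ui k ki; rewrite hb //.
      exact: (allP (adjl_bound i)).
    have zu : E z u by rewrite sym.
    have hg' := set_hom hg hi ui.
    have e' : trace (set_nth 0 g i u) z = insert_at n i T by rewrite trace_set // e.
    have /(allP hs) /or3P[] : i \in compl n T.
      by rewrite mem_filter mem_iota add0n hi andbT -e mem_trace negb_and nzi orbT.
    + by rewrite -e' trace_indep.
    + by rewrite -e' (negPf (hpre _ z hg')).
    (* The enlarged trace is admissible. The former i-th vertex is a twin of i in the new copy as
       well, so z has to see it, although i is outside T. *)
    case/andP => _ hh; move/negP: nzi; apply.
    apply: (handled_sound hg' hh e').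
    by apply: twin_set => //; [apply: twin_self|apply: adjl_irr].
  - by rewrite size_rcons hsz.
  - rewrite !all_cat !all_map; rewrite -?andbA; apply/and3P; split.
    + by apply: sub_all wfe => p /and3P[]; lia.
    + by apply: sub_all hT => k /=; lia.
    + by apply/allP => k; rewrite mem_filter mem_iota /= => /andP[]; lia.
  - move=> p; rewrite mem_cat => /orP[pe|/mapP[k ki ->]] /=.
    + by have /and3P[h1 h2 _] := allP wfe _ pe; rewrite !hb //; apply: he.
    + by rewrite hz hb ?(allP hT) //; move: ki; rewrite -e mem_trace => /andP[].
  - move=> p /mapP[k ki ->] /=.
    move: ki; rewrite mem_filter mem_iota /= add0n -e mem_trace => /andP[h kn].
    by rewrite hz hb //; rewrite kn in h.
apply: (IH (T :: pre)) => // g z hg.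
  by have := hall g z hg; rewrite !inE; case: (_ == T); rewrite ?orbT.
by rewrite inE negb_or hT0 // hpre.
Qed.

End Traces.
End Pairs.

(** The form used once traces are known: the copy is extended by vertices [xs] with prescribed edges
    and non-edges. An empty [legit] stands for no knowledge of the traces. *)
Lemma closed_sound legit P g xs eln nl t : hom g -> all (pair_ok n el tgs adjs) P ->
  (legit <> [::] -> forall z, trace g z \in legit) ->
  check (Context (tg_edges tgs) adjs (pairs_of P) [seq tob n l | l <- legit] false)
    (init (n + size xs) (el ++ eln) nl) t ->
  all (fun p => (p.1 < n + size xs) && (p.2 < n + size xs)) (eln ++ nl) ->
  {in eln, forall p, E (nth 0 (g ++ xs) p.1) (nth 0 (g ++ xs) p.2)} ->
  {in nl, forall p, ~~ E (nth 0 (g ++ xs) p.1) (nth 0 (g ++ xs) p.2)} -> False.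
Proof.
move=> hg hP hl hc hb heln hnl; have [hs he] := hg.
apply: (refute GE (b := g ++ xs) _ _ _ _ _ _ hc) => //=; try exact: no_tg.
- by rewrite size_adjs size_cat hs leq_addr.
- by rewrite size_adjs; apply: adjs_bound.
- exact: good_pairs.
- move=> hne v; exists (tob n (trace g v)).
    apply: map_f; apply: hl; by case: (legit) hne.
  move=> i; rewrite size_adjs; case: (ltnP i n) => hi /=.
    by rewrite (nth_map 0) ?size_iota // nth_iota // mem_trace hi /= nth_ext.
  by rewrite nth_default // size_map size_iota.
- by rewrite size_cat hs.
- rewrite -catA all_cat hb andbT.
  by apply: sub_all wfe => p /and3P[]; lia.
- move=> p; rewrite mem_cat => /orP[pe|/heln//].
  by have /and3P[h1 h2 _] := allP wfe _ pe; rewrite !nth_ext //; apply: he.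
Qed.

Lemma family_sound legit P R Ts : family_ok n el tgs legit P R Ts ->
  [/\ forall g z, hom g -> trace g z \in legit,
      forall g, hom g -> {in pairs_of P, forall p, forall x y, twin g x p.1 -> twin g y p.2 -> E x y}
    & forall g, hom g -> {in [seq r.1 | r <- R], forall r, forall x y, trace g x = r.1 -> twin g y r.2 -> E x y}].
Proof.
rewrite /family_ok; case/and5P=> _ _ hP hR /andP[hT /allP hi]; split=> [|g hg|g hg].
- apply: (traces_sound hP hR hT) => // g z hg.
  apply: hi; apply: indepsP => // i zi j zj.
  by apply/negP => ij; have := dg_tri GE zi (adjl_edge hg ij); rewrite zj.
- exact: pairs_sound.
- by move=> [T i] /(all_fst hR)[t ht] x y; apply: transfer_sound ht.
Qed.
End Soundness.

(* Lists of indices and of weights are written as strings of base 36 digits. *)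
Definition digit (a : Ascii.ascii) : nat :=
  let n := Ascii.nat_of_ascii a in if n < 58 then n - 48 else n - 87.
Fixpoint digits (s : string) : seq nat :=
  if s is String a s' then digit a :: digits s' else [::].
Coercion digits : string >-> list.
(** A pair whose declared argument type triggers the coercion from strings to lists. *)
Definition excl (s : seq nat) (t : cert) := (s, t).

(** * Refutation trees for the finite cases *)

Section Certificates.
Local Open Scope string_scope.

Definition pairs4 : seq (nat * nat * cert) := [::
(0, 4, cC 11 12 (cW "11110011111111" (bC "127ad" (cD "111001111101111") bN)));
(0, 5, cC 11 12 (cW "11110011111111" (bC "127ad" (cD "111010101111111") bN)));
(0, 6, cC 11 12 (cW "11111101110111" (bC "1479d" (cD "111111000111111") bN)));
(0, 7, cC 11 12 (cW "11111100111111" (bC "258ad" (cD "111110101011111") bN)));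
(0, 10, cC 11 12 (cW "11111101110111" (bC "1479d" (cD "111101110101111") bN)));
(1, 3, cC 11 12 (cW "21111111111111" (bC "4567ad" (cW "111111001111110" (bC "258ad" (cT 0 "2ebd346c78fa") bN)) bN)));
(1, 5, cC 11 12 (cW "11111010111111" (bC "3469d" (cW "210110112111111" (bC "038d" (cT 0 "08e96f45bdc1") bN)) bN)));
(1, 6, cC 11 12 (cW "11111100111111" (bC "258ad" (cW "211211011011111" (bC "038d" (cT 0 "03e25fa6bdc1") bN)) bN)));
(1, 8, cC 11 12 (cW "21111111111111" (bC "4567ad" (cW "001101010101111" (bC "257d" (cD "1121111111011101") (bC "2bce" (cT 0 "3ecf1a7b5926") bN))) bN)));
(2, 3, cC 11 12 (cW "21111111111111" (bC "4567ad" (cW "111111011101110" (bC "1479d" (cT 0 "1ebd356ca9f7") bN)) bN)));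
(2, 4, cC 11 12 (cW "11110111110111" (bC "3568d" (cW "201101111211111" (bC "039d" (cT 0 "09e86f54bdc2") bN)) bN)));
(2, 6, cC 11 12 (cW "11111101110111" (bC "1479d" (cW "211211010111111" (bC "039d" (cT 0 "03e14f76bdc2") bN)) bN)));
(2, 9, cC 11 12 (cW "21111111111111" (bC "4567ad" (cW "010110001011111" (bC "14ad" (cD "1211111011111101") (bC "1bce" (cT 0 "3e841a7bfc26") bN))) bN)));
(3, 7, cC 11 12 (cW "11111100111111" (bC "258ad" (cW "221111101011111" (bC "012d" (cT 0 "01e8af57bdc3") bN)) bN)));
(3, 10, cC 11 12 (cW "11111101110111" (bC "1479d" (cW "212111110101111" (bC "012d" (cT 0 "02e97f4abdc3") bN)) bN)));
(4, 8, cC 11 12 (cW "11110011111111" (bC "127ad" (cW "211001111211111" (bC "019d" (cT 0 "09e27fa4cdb8") bN)) bN)));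
(5, 9, cC 11 12 (cW "11110011111111" (bC "127ad" (cW "211010112111111" (bC "028d" (cT 0 "08e1af75cdb9") bN)) bN)));
(7, 8, cC 11 12 (cW "11111010111111" (bC "3469d" (cW "220111101111111" (bC "019d" (cT 0 "01e34f67cdb8") bN)) bN)));
(8, 9, cC 11 12 (cW "21111111111111" (bC "4567ad" (cW "122211111111111" (bC "127ad" (cT 0 "12e45f68cdb9") bN)) bN)));
(9, 10, cC 11 12 (cW "11110111110111" (bC "3568d" (cW "202111111101111" (bC "028d" (cT 0 "02e35f6abdc9") bN)) bN)))].

(** The first entry is the trace of y. Its certificate exhibits the pattern with L = 5 and no y
    inside the pattern with L = 4 together with y. *)
Definition traces4 : seq (seq nat * cert) := [::
excl "3456" (cT 0 "03814a76295b");
excl "4567" (cC 10 11 (cW "1111110111111" (bC "1479c" (cD "11110111011111") bN)));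
excl "4679" (cT 0 "09186a54237b");
excl "456a" (cC 7 11 (cW "1111110111111" (bC "258ac" (cD "11111011101111") bN)));
excl "147a" (cT 0 "0123456789ab");
excl "257a" (cT 0 "0213546a987b");
excl "457a" (cC 6 11 (cW "1111111111011" (bC "1479c" (cD "11111110011111") bN)));
excl "467a" (cC 5 11 (cW "1111011111111" (bC "127ac" (cD "11101110111111") bN)));
excl "567a" (cC 4 11 (cW "1111101111111" (bC "127ac" (cD "11101111110111") bN)));
excl "568a" (cT 0 "0829674513ab");
excl "345" (cC 6 11 (cW "2112111111111" (bC "039c" (cD "11111110110111") (bC "038c" (cD "11111110110111") bN))));
excl "346" (cC 9 11 (cW "1101100011111" (bC "038c" (cD "21111110121111") (bC "14ac" (cD "12111110121111") bN))));
excl "356" (cC 8 11 (cW "1011010111011" (bC "039c" (cD "21111111210111") (bC "257c" (cD "11211111210111") bN))));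
excl "456" (cD "111211011111");
excl "127" (cC 10 11 (cW "1111110111111" (bC "1479c" (cW "21211111011111" (bC "012c" (cT 0 "2dac349b70e1") bN)) bN)));
excl "147" (cC 9 11 (cW "1111110001011" (bC "012c" (cD "21111101121111") (bC "345c" (cK cX) bN))));
excl "257" (cC 10 11 (cW "2121111111111" (bC "012c" (cD "11110101111111") (bC "028c" (cD "11110101111111") bN))));
excl "457" (cW "112212010101" (bC "257" (cK cX) (bC "345" (cK cX) bN)));
excl "467" (cD "111101111211");
excl "567" (cC 4 11 (cW "1111101111111" (bC "127ac" (cD "11101111110111") bN)));
excl "258" (cC 10 11 (cW "1111011111111" (bC "3568c" (cW "20211111111111" (bC "028c" (cT 0 "2dac963b50e8") bN)) bN)));
excl "358" (cC 6 11 (cW "1111111011111" (bC "258ac" (cW "21121111101111" (bC "038c" (cT 0 "3d6c1a2b50e8") bN)) bN)));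
excl "368" (cC 5 11 (cW "1111111011111" (bC "3469c" (cW "21011111211111" (bC "038c" (cT 0 "8d5c149b60e3") bN)) bN)));
excl "568" (cC 3 11 (cW "1011001111011" (bC "028c" (cD "21120111111111") (bC "679c" (cD "11120111121111") bN))));
excl "149" (cC 7 11 (cW "1111101111111" (bC "3469c" (cW "22011111111111" (bC "019c" (cT 0 "1d7c863b40e9") bN)) bN)));
excl "349" (cC 6 11 (cW "1111111111011" (bC "1479c" (cW "21121111011111" (bC "039c" (cT 0 "3d6c271b40e9") bN)) bN)));
excl "369" (cC 4 11 (cW "1111111111011" (bC "3568c" (cW "20111111121111" (bC "039c" (cT 0 "9d4c258b60e3") bN)) bN)));
excl "469" (cC 3 11 (cW "1101001011111" (bC "019c" (cD "21121011111111") (bC "68ac" (cD "11121011211111") bN))));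
excl "179" (cC 4 11 (cW "1111101111111" (bC "127ac" (cW "21101111121111" (bC "019c" (cT 0 "9d4c8a2b70e1") bN)) bN)));
excl "479" (cW "111101110101" (bC "356b" (cK cX) bN));
excl "679" (cC 4 11 (cW "2111111112111" (bC "019c" (cD "11111011110111") (bC "039c" (cD "11111011110111") bN))));
excl "12a" (cC 7 11 (cW "1111110111111" (bC "258ac" (cW "22111111101111" (bC "012c" (cT 0 "1d7c358ba0e2") bN)) bN)));
excl "14a" (cC 7 11 (cW "2211111211122" (bC "012c" (cD "11111001111111") (bC "019c" (cD "11111001111111") bN))));
excl "25a" (cW "111111011001" (bC "147b" (cK cX) bN));
excl "45a" (cW "121221001011" (bC "14a" (cK cX) (bC "345" (cK cX) bN)));
excl "46a" (cC 7 11 (cW "1111110111111" (bC "258ac" (cD "11111011101111") bN)));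
excl "56a" (cD "111110112111");
excl "17a" (cW "111010101111" (bC "469b" (cK cX) bN));
excl "27a" (cW "111001111101" (bC "568b" (cK cX) bN));
excl "47a" (cD "121111101111");
excl "57a" (cD "112111111101");
excl "67a" (cC 4 11 (cW "1111101111111" (bC "127ac" (cD "11101111110111") bN)));
excl "28a" (cC 5 11 (cW "1111011111111" (bC "127ac" (cW "21101111211111" (bC "028c" (cT 0 "8d5c971ba0e2") bN)) bN)));
excl "58a" (cW "111110101011" (bC "346b" (cK cX) bN));
excl "68a" (cC 5 11 (cW "2111111121111" (bC "028c" (cD "11110110111111") (bC "038c" (cD "11110110111111") bN))));
excl "01" (cW "111110001111" (bC "28ab" (cK cX) (bC "349b" (cK cX) bN)));
excl "02" (cW "111101011101" (bC "179b" (cK cX) (bC "358b" (cK cX) bN)));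
excl "12" (cW "211111011111" (bC "457ab" (cK cX) bN));
excl "03" (cW "111111001101" (bC "149b" (cK cX) (bC "258b" (cK cX) bN)));
excl "14" (cW "221221001121" (bC "14a" (cK cX) bN));
excl "34" (cW "221222001111" (bC "345" (cK cX) bN));
excl "25" (cW "111111011001" (bC "147b" (cK cX) bN));
excl "35" (cW "212222011101" (bC "345" (cK cX) bN));
excl "45" (cD "111211011111");
excl "36" (cD "211111112211");
excl "46" (cD "221211112221");
excl "56" (cD "212211122211");
excl "17" (cD "212111111211");
excl "27" (cW "212102121201" (bC "257" (cK cX) bN));
excl "47" (cD "222212111211");
excl "57" (cD "112111111101");
excl "67" (cD "111101111211");
excl "08" (cW "111100101111" (bC "12ab" (cK cX) (bC "369b" (cK cX) bN)));
excl "28" (cW "211101111111" (bC "567ab" (cK cX) bN));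
excl "38" (cW "211111101111" (bC "456ab" (cK cX) bN));
excl "58" (cD "212211111111");
excl "68" (cW "101100111111" (bC "27ab" (cK cX) bN));
excl "09" (cW "111100111101" (bC "127b" (cK cX) (bC "368b" (cK cX) bN)));
excl "19" (cW "211110111111" (bC "467ab" (cK cX) bN));
excl "39" (cW "211111111101" (bC "4567b" (cK cX) bN));
excl "49" (cD "221211111111");
excl "69" (cW "110100111111" (bC "17ab" (cK cX) bN));
excl "79" (cW "111101110101" (bC "356b" (cK cX) bN));
excl "1a" (cW "221120102121" (bC "14a" (cK cX) bN));
excl "2a" (cD "221111112111");
excl "4a" (cD "121111101111");
excl "5a" (cD "222221112111");
excl "6a" (cD "111110112111");
excl "7a" (cD "222111212211");
excl "8a" (cW "111110101011" (bC "346b" (cK cX) bN));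
excl "0" (cD "222211112211");
excl "1" (cD "322221112221");
excl "2" (cD "322212122211");
excl "3" (cD "322222112211");
excl "4" (cD "221211111111");
excl "5" (cD "212211111111");
excl "6" (cD "211111112211");
excl "7" (cD "212111111211");
excl "8" (cD "322211212221");
excl "9" (cD "322211222211");
excl "a" (cD "221111112111");
excl "" (cD "222211112211")].

Definition pairs5 : seq (nat * nat * cert) := [::
(0, 4, cC 12 13 (cW "111100111110111" (bC "127ae" (cD "1110011111001111") bN)));
(0, 5, cC 12 13 (cW "111100111110111" (bC "127ae" (cD "1110101011101111") bN)));
(0, 6, cC 12 13 (cW "111111011100111" (bC "1479e" (cD "1111110001101111") bN)));
(0, 7, cC 12 13 (cW "111111001110111" (bC "258ae" (cD "1111101010101111") bN)));
(0, 10, cC 12 13 (cW "111111011100111" (bC "1479e" (cD "1111011101001111") bN)));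
(1, 3, cC 12 13 (cW "111010101111111" (bC "028be" (cD "2111011111101111") bN)));
(1, 5, cC 12 13 (cW "111010101111111" (bC "028be" (cD "1111001011101111") bN)));
(1, 6, cC 12 13 (cW "111111000111111" (bC "039be" (cD "1111110011001111") bN)));
(1, 8, cC 12 13 (cW "111111000111111" (bC "039be" (cD "2111111111001111") bN)));
(1, 11, cC 12 13 (cW "111111001110111" (bC "258ae" (cD "1111101010101111") bN)));
(2, 3, cC 12 13 (cW "211111111110111" (bC "4567ae" (cW "1111110111001110" (bC "1479e" (cT 1 "19fa6g53ced24") bN)) bN)));
(2, 4, cC 12 13 (cW "121111101111111" (bC "3568be" (cW "1111110001111110" (bC "039be" (cT 1 "09f86g54ced23") bN)) bN)));
(2, 6, cC 12 13 (cW "111111000111111" (bC "039be" (cW "1101100010001111" (bC "038e" (cD "11111100110011101") (bC "8cdf" (cT 0 "03814f76cgd2b") bN))) bN)));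
(2, 9, cC 12 13 (cW "121111101111111" (bC "3568be" (cW "1001100010101111" (bC "038e" (cD "21111110111011101") (bC "0cdf" (cT 0 "0f234g678dabc") bN))) bN)));
(3, 7, cC 12 13 (cW "111111001110111" (bC "258ae" (cW "2211111010101111" (bC "012e" (cT 1 "01f8ag57ced32") bN)) bN)));
(3, 10, cC 12 13 (cW "111010101111111" (bC "028be" (cD "1111010111001111") bN)));
(4, 8, cC 12 13 (cW "111111000111111" (bC "039be" (cD "1111001111001111") bN)));
(4, 11, cC 12 13 (cW "111111001110111" (bC "258ae" (cW "2211111010101111" (bC "012e" (cT 1 "10fa8g5bced42") bN)) bN)));
(5, 9, cC 12 13 (cW "111010101111111" (bC "028be" (cW "1101000010101111" (bC "038e" (cD "11110010111011101") (bC "3cdf" (cT 0 "0831af75dgc9b") bN))) bN)));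
(7, 8, cC 12 13 (cW "111110101110111" (bC "3469e" (cW "2201111011101111" (bC "019e" (cT 1 "01f34g67dec89") bN)) bN)));
(7, 11, cC 12 13 (cW "221111101110111" (bC "012e" (cD "1111100011101111") (bC "019e" (cD "1111100011101111") bN))));
(8, 9, cC 12 13 (cW "211111111110111" (bC "4567ae" (cW "1222111111101111" (bC "127ae" (cT 1 "12f45g68dec9a") bN)) bN)));
(9, 10, cC 12 13 (cW "121111101111111" (bC "3568be" (cW "2121211011111111" (bC "028be" (cT 1 "02f35g6aced98") bN)) bN)));
(10, 11, cC 12 13 (cW "111110101110111" (bC "3469e" (cW "2201111011101111" (bC "019e" (cT 1 "10f43g6bceda9") bN)) bN)))].

Definition traces5 : seq (seq nat * cert) := [::
excl "3456" (cT 0 "0123456789abc");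
excl "4567" (cC 10 12 (cW "12221211122121" (bC "12ac" (cD "111111011110101") (bC "3568bd" (cD "101111011110111") bN))));
excl "3568" (cC 11 12 (cW "11111100111111" (bC "258ad" (cD "111110101011111") bN)));
excl "4679" (cT 1 "109a865b4237c");
excl "456a" (cC 7 12 (cW "11111101111011" (bC "258ad" (cD "111110111010111") bN)));
excl "257a" (cT 1 "1024356ba987c");
excl "457a" (cC 6 12 (cW "11111111110011" (bC "1479d" (cD "111111100110111") bN)));
excl "467a" (cC 5 12 (cW "11110111111011" (bC "127ad" (cD "111011101110111") bN)));
excl "567a" (cC 4 12 (cW "11111011111011" (bC "127ad" (cD "111011111100111") bN)));
excl "568a" (cT 0 "0831a475926cb");
excl "356b" (cC 8 12 (cW "21111111211011" (bC "028c" (cD "111111001111101") (bC "4567ad" (cD "011111001111111") bN))));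
excl "258b" (cT 1 "0123456789abc");
excl "358b" (cC 6 12 (cW "11111110011111" (bC "039bd" (cD "111111101100111") bN)));
excl "368b" (cC 5 12 (cW "11101110111111" (bC "028bd" (cD "111101101110111") bN)));
excl "568b" (cC 3 12 (cW "11111010111111" (bC "028bd" (cD "111101100111111") bN)));
excl "369b" (cT 1 "0198a657324bc");
excl "345" (cC 6 12 (cW "11111110011111" (bC "039bd" (cD "111111101100111") bN)));
excl "346" (cC 9 12 (cW "11011000111011" (bC "038d" (cD "211111101210111") (bC "14ad" (cD "121111101210111") bN))));
excl "356" (cC 11 12 (cW "11111100111111" (bC "258ad" (cD "222221112111111") bN)));
excl "456" (cC 7 12 (cW "11111101111011" (bC "258ad" (cD "222221111121111") bN)));
excl "127" (cC 10 12 (cW "11101100011110" (bC "45ac" (cD "111111011110101") (bC "09bc" (cW "111010101111111" (bC "028bd" (cD "1111010111101101") bN)) bN))));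
excl "257" (cC 10 12 (cW "22312211122221" (bC "028bd" (cD "111101011110111") (bC "258bd" (cK cX) bN))));
excl "457" (cW "1222220001111" (bC "12ac" (cD "11111101111011") (bC "345" (cK cX) bN)));
excl "467" (cW "1111011112101" (bC "039c" (cD "12111110121111") bN));
excl "567" (cD "1121111112111");
excl "028" (cC 11 12 (cW "11111100111111" (bC "258ad" (cW "110000101011111" (bC "68ad" (cD "1111101010111101") (bC "6bce" (cW "2211002121211011" (bC "127af" (cT 1 "0e186a5cfb42g") (bC "369bce" (cK cX) bN))) bN))) bN)));
excl "038" (cC 11 12 (cW "22111110111111" (bC "012d" (cD "111110001111111") (bC "019d" (cD "111110001111111") bN))));
excl "258" (cW "2122120100112" (bC "03c" (cC 10 12 (cW "222212111121201" (bC "3568be" (cW "3132221111212011" (bC "028be" (cW "11111100111111000" (bC "258bd" (cK cX) (bC "258ad" (cT 1 "02f35g6dceah8") bN))) bN)) bN))) (bC "257a" (cK cX) bN)));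
excl "358" (cC 6 12 (cW "11111110011111" (bC "039bd" (cD "111111101100111") bN)));
excl "368" (cC 5 12 (cW "11101110111111" (bC "028bd" (cD "111101101110111") bN)));
excl "568" (cC 11 12 (cW "11111010111111" (bC "3469d" (cD "111211011111111") bN)));
excl "039" (cC 11 12 (cW "11111010111111" (bC "3469d" (cW "220111101111111" (bC "019d" (cW "2212210111011111" (bC "1479d" (cT 1 "01e34f67g9abd") (bC "258bcef" (cK cX) bN))) bN)) bN)));
excl "149" (cC 7 12 (cW "11111011111011" (bC "3469d" (cW "220111111110111" (bC "019d" (cW "2212210101111111" (bC "257acef" (cK cX) (bC "039bd" (cT 1 "0e13f46g987dc") bN))) bN)) bN)));
excl "349" (cC 6 12 (cW "11111110011111" (bC "039bd" (cW "111111111100110" (bC "1479d" (cT 0 "3f04e17cd629b") bN)) bN)));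
excl "369" (cC 4 12 (cW "22112121221121" (bC "3568bd" (cC 11 12 (cW "3111212123212110" (bC "039bd" (cW "31112121221121111" (bC "4567afg" (cW "211121112211211100" (bC "1479ef" (cW "1111101011111001000" (bC "3469f" (cT 1 "9he6ig5j4dcfb") bN)) bN)) bN)) bN))) bN)));
excl "469" (cW "1101001111101" (bC "038c" (cK cX) (bC "17ac" (cK (cC 2 13 (cW "433222322331222" (bC "4567ae" (cW "3443222334212220" (bC "1479e" (cW "11111011111011000" (bC "3469d" (cT 1 "19fa6g532edh4") bN)) bN)) bN)))) bN)));
excl "179" (cC 4 12 (cW "11101010011110" (bC "46ac" (cD "111110111110101") (bC "02bc" (cW "111111000111111" (bC "039bd" (cD "1111101111001101") bN)) bN))));
excl "479" (cW "1211111001111" (bC "12ac" (cD "22111111111011") (bC "356bc" (cK cX) bN)));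
excl "679" (cC 4 12 (cW "32323222142232" (bC "039bd" (cD "111110111100111") (bC "369bd" (cK cX) bN))));
excl "12a" (cC 7 12 (cW "11111101111011" (bC "258ad" (cW "221111111010111" (bC "012d" (cW "2210101121211111" (bC "028bd" (cT 1 "0e18fa5g237dc") (bC "4679cef" (cK cX) bN))) bN)) bN)));
excl "14a" (cC 7 12 (cW "22111111111011" (bC "012d" (cD "111110011110111") (bC "019d" (cD "111110011110111") bN))));
excl "25a" (cW "1111110110001" (bC "147c" (cC 8 12 (cW "222122112111201" (bC "4567ae" (cW "1222111111101111" (bC "127ae" (cW "11111101111011000" (bC "258ad" (cT 1 "12f45g6dce8ha") bN)) bN)) bN))) (bC "038c" (cK cX) bN)));
excl "45a" (cC 7 12 (cW "11111101111011" (bC "258ad" (cD "111110111010111") bN)));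
excl "46a" (cC 7 12 (cW "11111101111011" (bC "258ad" (cD "111110111010111") bN)));
excl "56a" (cW "1111101121101" (bC "028c" (cK cX) (bC "038c" (cK cX) bN)));
excl "17a" (cW "1110101011101" (bC "028c" (cK cX) (bC "469c" (cK cX) bN)));
excl "27a" (cW "1210111011111" (bC "149c" (cK cX) (bC "568bc" (cK cX) bN)));
excl "47a" (cW "1211111011101" (bC "3568c" (cK cX) bN));
excl "57a" (cW "1121111111001" (bC "028c" (cK cX) bN));
excl "67a" (cC 5 12 (cW "11101110111111" (bC "028bd" (cD "222212112210111") (bC "258bc" (cK cX) bN))));
excl "28a" (cC 5 12 (cW "11101110111111" (bC "028bd" (cW "111101111110110" (bC "127ad" (cT 0 "8f0ae17cd592b") bN)) bN)));
excl "58a" (cW "1111101010101" (bC "346c" (cK cX) bN));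
excl "68a" (cC 5 12 (cW "11101110111111" (bC "028bd" (cD "111101101110111") bN)));
excl "02b" (cW "1111010111001" (bC "358c" (cK cX) (bC "179c" (cK cX) bN)));
excl "03b" (cW "1111110011001" (bC "149c" (cK cX) (bC "258c" (cK cX) bN)));
excl "25b" (cW "2122120211001" (bC "257" (cK cX) (bC "03c" (cW "11111101110111" (bC "258bd" (cK cX) (bC "1479d" (cD "111111000111111") bN))) bN)));
excl "35b" (cW "2122220111001" (bC "028c" (cK cX) (bC "345" (cK cX) bN)));
excl "36b" (cW "2111111122101" (bC "028c" (cK cX) bN));
excl "56b" (cD "1121111112111");
excl "08b" (cW "1111001011101" (bC "12ac" (cK cX) (bC "369c" (cK cX) bN)));
excl "28b" (cW "2111011111101" (bC "039c" (cK cX) (bC "567ac" (cK cX) bN)));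
excl "38b" (cW "2111111011101" (bC "456ac" (cK cX) bN));
excl "58b" (cW "2122111111101" (bC "039c" (cK cX) bN));
excl "68b" (cW "1011001111101" (bC "039c" (cK cX) (bC "27ac" (cK cX) bN)));
excl "09b" (cW "1111001111001" (bC "368c" (cK cX) (bC "127c" (cK cX) bN)));
excl "39b" (cW "2111111111001" (bC "028c" (cK cX) (bC "4567c" (cK cX) bN)));
excl "69b" (cW "2111002222101" (bC "679" (cK cX) (bC "08c" (cW "11110011111111" (bC "369bd" (cK cX) (bC "127ad" (cD "111010101111111") bN))) bN)));
excl "01" (cW "1111100011101" (bC "28ac" (cK cX) (bC "349c" (cK cX) bN)));
excl "02" (cW "1111010111001" (bC "358c" (cK cX) (bC "179c" (cK cX) bN)));
excl "12" (cW "1110110001111" (bC "45ac" (cK cX) (bC "09bc" (cK cX) bN)));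
excl "03" (cW "1111110011001" (bC "149c" (cK cX) (bC "258c" (cK cX) bN)));
excl "34" (cW "2212220011101" (bC "345" (cK cX) bN));
excl "25" (cD "1111110111111");
excl "35" (cW "2122220111001" (bC "028c" (cK cX) (bC "345" (cK cX) bN)));
excl "45" (cW "1112110111101" (bC "039c" (cK cX) (bC "038c" (cK cX) bN)));
excl "36" (cW "2111111122101" (bC "028c" (cK cX) bN));
excl "46" (cW "2212111122201" (bC "03c" (cK (cK cX)) bN));
excl "56" (cD "1121111112111");
excl "27" (cD "2221121112111");
excl "57" (cD "2232221112111");
excl "67" (cD "2221112123211");
excl "08" (cW "1111001011101" (bC "12ac" (cK cX) (bC "369c" (cK cX) bN)));
excl "28" (cW "2111011111101" (bC "039c" (cK cX) (bC "567ac" (cK cX) bN)));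
excl "38" (cW "2111111011101" (bC "456ac" (cK cX) bN));
excl "58" (cW "2122111111101" (bC "039c" (cK cX) bN));
excl "68" (cW "1011001111101" (bC "039c" (cK cX) (bC "27ac" (cK cX) bN)));
excl "09" (cW "1111001111001" (bC "368c" (cK cX) (bC "127c" (cK cX) bN)));
excl "19" (cW "2111101111101" (bC "08c" (cK (cK cX)) (bC "467ac" (cK cX) bN)));
excl "39" (cW "2111111111001" (bC "028c" (cK cX) (bC "4567c" (cK cX) bN)));
excl "49" (cW "1211111001111" (bC "12ac" (cK cX) (bC "356bc" (cK cX) bN)));
excl "69" (cD "1111101111111");
excl "79" (cD "2221112112111");
excl "1a" (cW "1110101011101" (bC "028c" (cK cX) (bC "469c" (cK cX) bN)));
excl "2a" (cW "2211111121101" (bC "38c" (cK (cK cX)) bN));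
excl "4a" (cW "1211111011101" (bC "3568c" (cK cX) bN));
excl "5a" (cW "2222211121101" (bC "028c" (cK cX) (bC "038c" (cK cX) bN)));
excl "6a" (cW "1111101121101" (bC "08c" (cK (cK cX)) bN));
excl "7a" (cW "2221112122101" (bC "028c" (cK cX) (bC "3568c" (cK cX) bN)));
excl "8a" (cW "1111101010101" (bC "346c" (cK cX) bN));
excl "0b" (cW "1221111012111" (bC "12ac" (cK cX) (bC "149c" (cK cX) bN)));
excl "2b" (cD "2221121112111");
excl "3b" (cW "3222221122101" (bC "028c" (cK cX) bN));
excl "5b" (cD "2232221112111");
excl "6b" (cD "2221112123211");
excl "8b" (cW "3222112122201" (bC "039c" (cK cX) bN));
excl "9b" (cD "2221112112111");
excl "0" (cW "2322211022211" (bC "149c" (cK cX) (bC "1ac" (cK (cK cX)) bN)));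
excl "2" (cD "2221121112111");
excl "3" (cW "3222221122101" (bC "028c" (cK cX) bN));
excl "5" (cD "1111110111111");
excl "6" (cD "2211111122211");
excl "8" (cC 2 12 (cK (cK cX)));
excl "9" (cD "2211111111111");
excl "a" (cC 2 12 (cK (cK cX)));
excl "b" (cD "3332222123211");
(* Placed late, when few candidate traces are left: a common neighbour of the new vertex and one
   base vertex then admits no trace. *)
excl "147" (cC 9 12 (cK cX));
excl "14" (cC 9 12 (cK cX));
excl "17" (cC 10 12 (cK cX));
excl "47" (cC 6 12 (cK cX));
excl "1" (cW "3222211122201" (bC "028c" (cK cX) (bC "03c" (cK (cK cX)) bN)));
excl "4" (cC 6 12 (cK cX));
excl "7" (cD "3332222123211");
excl "" (cD "2222211122211")].

Definition pairs5y : seq (nat * nat * cert) := [::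
(0, 4, cC 13 14 (cW "1112110111101111" (bC "127acf" (cD "12101110111101111") bN)));
(0, 5, cC 13 14 (cW "1112110111101111" (bC "127acf" (cD "11101010111001111") bN)));
(0, 6, cC 13 14 (cW "1111110111000111" (bC "1479f" (cD "11111100011001111") bN)));
(0, 7, cC 13 14 (cW "1111110011100111" (bC "258af" (cD "11111010101001111") bN)));
(0, 10, cC 13 14 (cW "1111110111000111" (bC "1479f" (cD "12111110011101111") bN)));
(1, 3, cC 13 14 (cW "1111210011111111" (bC "028bcf" (cD "21110111111001111") bN)));
(1, 5, cC 13 14 (cW "1111210011111111" (bC "028bcf" (cD "11110010111001111") bN)));
(1, 6, cC 13 14 (cW "1111110001110111" (bC "039bf" (cD "11111100110001111") bN)));
(1, 8, cC 13 14 (cW "1111110001110111" (bC "039bf" (cD "21111111110001111") bN)));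
(1, 11, cC 13 14 (cW "1111110011100111" (bC "258af" (cD "11111010101001111") bN)));
(2, 3, cC 13 14 (cW "1101110011101111" (bC "019cf" (cD "21111011111001111") bN)));
(2, 4, cC 13 14 (cW "1101110011101111" (bC "019cf" (cD "12111010111101111") bN)));
(2, 6, cC 13 14 (cW "1111110111000111" (bC "1479f" (cW "11111100011101110" (bC "039bf" (cT 0 "03g14h76dfe29") bN)) bN)));
(2, 9, cC 13 14 (cW "1211111011110111" (bC "3568bf" (cW "10011000101001111" (bC "038f" (cD "211111101110011101") (bC "0deg" (cT 0 "038g4a762ehd9") bN))) bN)));
(3, 12, cC 13 14 (cW "1111110111000111" (bC "1479f" (cD "11111100011001111") bN)));
(3, 7, cC 13 14 (cW "1101110011101111" (bC "019cf" (cD "11111000111001111") bN)));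
(3, 10, cC 13 14 (cW "1111210011111111" (bC "028bcf" (cD "11110101110001111") bN)));
(4, 12, cC 13 14 (cW "1111110001110111" (bC "039bf" (cD "11111100110001111") bN)));
(4, 8, cC 13 14 (cW "1111110001110111" (bC "039bf" (cD "11121101110011111") bN)));
(4, 11, cC 13 14 (cW "1101110011101111" (bC "019cf" (cD "11111000111001111") bN)));
(5, 12, cC 13 14 (cW "1111110111000111" (bC "1479f" (cW "11111100011101110" (bC "039bf" (cT 0 "30g41h7cdfe59") bN)) bN)));
(5, 9, cC 13 14 (cW "1112110111101111" (bC "127acf" (cW "11112100111111110" (bC "028bcf" (cT 0 "08g1ah75efd92") bN)) bN)));
(6, 12, cC 13 14 (cW "1111110001110111" (bC "039bf" (cD "11111100110001111") bN)));
(7, 8, cC 13 14 (cW "1111101011100111" (bC "3469f" (cW "11011100111011110" (bC "019cf" (cT 0 "01g34h67efd89") bN)) bN)));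
(7, 11, cC 13 14 (cW "1101110011101111" (bC "019cf" (cD "11111000111001111") bN)));
(8, 9, cC 13 14 (cW "2111111111100111" (bC "4567af" (cW "11121101111011110" (bC "127acf" (cT 0 "12g45h68efd9a") bN)) bN)));
(9, 10, cC 13 14 (cW "1211111011110111" (bC "3568bf" (cW "11112100111111110" (bC "028bcf" (cT 0 "02g35h6adfe98") bN)) bN)));
(10, 11, cC 13 14 (cW "1111101011100111" (bC "3469f" (cW "11011100111011110" (bC "019cf" (cT 0 "10g43h6bdfea9") bN)) bN)))].

Definition traces5y : seq (seq nat * cert) := [::
excl "4567" (cC 10 13 (cW "121111101121011" (bC "12ad" (cD "1111110111100101") (bC "3568be" (cD "1011110111100111") bN))));
excl "127c" (cC 10 13 (cW "101111011110111" (bC "028ce" (cD "1111010111100111") bN)));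
excl "3568" (cC 11 13 (cW "111111001111011" (bC "258ae" (cD "1111101010110111") bN)));
excl "028c" (cC 11 13 (cW "110111001111111" (bC "019ce" (cD "1111100011110111") bN)));
excl "4679" (cT 0 "109a865b4237d");
excl "179c" (cT 0 "039257a6184cd");
excl "456a" (cC 7 13 (cW "111111011110011" (bC "258ae" (cD "1111101110100111") bN)));
excl "12ac" (cC 7 13 (cW "110111011110111" (bC "019ce" (cD "1111100111100111") bN)));
excl "127a" (cC 12 13 (cW "111111011100111" (bC "1479e" (cD "1111110001101111") bN)));
excl "257a" (cT 0 "1024356ba987d");
excl "457a" (cC 6 13 (cW "111111111100011" (bC "1479e" (cD "1111111001100111") bN)));
excl "467a" (cC 5 13 (cW "111101111110011" (bC "127ae" (cD "1110111011100111") bN)));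
excl "567a" (cC 4 13 (cW "111221011110111" (bC "127ace" (cD "1110111111000111") (bC "349d" (cT 0 "43510fcba987d") bN))));
excl "17ac" (cC 2 13 (cW "111111001110111" (bC "019ce" (cD "1011100111101111") bN)));
excl "27ac" (cC 1 13 (cW "221111111110011" (bC "019d" (cT 0 "10243f6ba987d") (bC "4567ae" (cD "0111110111001111") bN))));
excl "568a" (cT 0 "30841a7c5926d");
excl "28ac" (cT 0 "03814a76295cd");
excl "356b" (cC 8 13 (cW "211111112110011" (bC "028d" (cD "1111110011110101") (bC "4567ae" (cD "0111110011110111") bN))));
excl "02bc" (cC 8 13 (cW "111111001111011" (bC "039be" (cD "0111110011011111") bN)));
excl "028b" (cC 12 13 (cW "111111000111111" (bC "039be" (cD "1111110011001111") bN)));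
excl "258b" (cT 0 "0123456789abd");
excl "358b" (cC 6 13 (cW "111111100111011" (bC "039be" (cD "1111111011000111") bN)));
excl "368b" (cC 5 13 (cW "111011101111011" (bC "028be" (cD "1111011011100111") bN)));
excl "568b" (cW "10110011111001" (bC "039d" (cT 0 "30841e7c5926d") (bC "27ad" (cW "101111011110111" (bC "27acd" (cK cX) bN)) bN)));
excl "08bc" (cC 2 13 (cW "111111001110111" (bC "019ce" (cD "0111100011111111") bN)));
excl "28bc" (cW "11100110011101" (bC "019d" (cT 0 "01234e6789abd") (bC "56ad" (cW "111101111110011" (bC "567ad" (cK cX) bN)) bN)));
excl "369b" (cT 0 "0198a657324bd");
excl "09bc" (cT 0 "14925b860a3cd");
excl "012" (cC 12 13 (cW "111111000111111" (bC "039be" (cD "1111110011001111") bN)));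
excl "345" (cC 6 13 (cW "111111100111011" (bC "039be" (cD "1111111011000111") bN)));
excl "356" (cC 8 13 (cW "111111001111011" (bC "028bd" (cK cX) (bC "039be" (cW "1110111011010111" (bC "028bd" (cK cX) bN)) bN))));
excl "456" (cC 7 13 (cW "111111011110011" (bC "127ad" (cK cX) (bC "258ae" (cD "1112210111211111") bN))));
excl "02c" (cC 11 13 (cW "111111001111011" (bC "358bd" (cK cX) (bC "258ae" (cD "2211111121110111") bN))));
excl "12c" (cC 7 13 (cW "111111011110011" (bC "457ad" (cK cX) (bC "258ae" (cD "2211111111210111") bN))));
excl "127" (cC 12 13 (cW "111111000111111" (bC "039be" (cD "2112220122002112") (bC "09bcd" (cK cX) bN))));
excl "257" (cC 10 13 (cW "111121001121111" (bC "028bce" (cD "1111010111100111") (bC "14ad" (cD "1111110111100101") bN))));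
excl "457" (cC 6 13 (cW "111111100111011" (bC "039be" (cD "1112111111001111") (bC "369bd" (cK cX) bN))));
excl "467" (cW "12122200122111" (bC "12acd" (cK cX) (bC "358bd" (cK cX) bN)));
excl "567" (cW "11211111121101" (bC "028bd" (cK cX) bN));
excl "17c" (cW "22212110122101" (bC "028bd" (cK cX) (bC "456ad" (cK cX) bN)));
excl "27c" (cW "22211211121101" (bC "019d" (cD "111111011100111") bN));
excl "028" (cC 12 13 (cW "111111000111111" (bC "039be" (cD "1111110011001111") bN)));
excl "038" (cC 11 13 (cW "110111001111111" (bC "019ce" (cD "1111100011110111") bN)));
excl "258" (cW "21221201001102" (bC "03d" (cC 10 13 (cW "2122220111211201" (bC "028bcf" (cW "11110100001001011" (bC "1adg" (cW "111111001111011000" (bC "258be" (cK cX) (bC "258ae" (cT 0 "02135g6edhai8") bN))) (bC "012f" (cD "222212011121020101") bN))) bN))) (bC "257a" (cK cX) bN)));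
excl "358" (cC 6 13 (cW "111111100111011" (bC "039be" (cD "1111111011000111") bN)));
excl "368" (cC 11 13 (cW "110111001111111" (bC "019ce" (cD "1111100011110111") (bC "09bcd" (cK cX) bN))));
excl "568" (cW "10110011111001" (bC "039d" (cT 0 "30841e7c5926d") (bC "27ad" (cW "101111011110111" (bC "27acd" (cK cX) bN)) bN)));
excl "08c" (cC 11 13 (cW "110111001111111" (bC "019ce" (cD "1111100011110111") bN)));
excl "28c" (cW "10010101111011" (bC "039d" (cT 0 "03814e76295cd") (bC "57ad" (cW "111101111110011" (bC "567ad" (cK cX) bN)) bN)));
excl "019" (cC 12 13 (cW "111111000111111" (bC "039be" (cW "1111110111001110" (bC "1479e" (cW "22122010111011111" (bC "28acdfg" (cK cX) (bC "3469e" (cT 0 "03g14f76h95ce") bN))) bN)) bN)));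
excl "039" (cC 11 13 (cW "110111001111111" (bC "019ce" (cW "1111100000010111" (bC "012e" (cD "11111000111101101") (bC "2bdf" (cW "22222101110101011" (bC "1479g" (cT 0 "01234f67h9abg") (bC "258bdf" (cK cX) bN))) bN))) bN)));
excl "149" (cC 7 13 (cW "110111011110111" (bC "019ce" (cW "1111100100000111" (bC "012e" (cD "11111001111001101") (bC "27df" (cW "22222101011101011" (bC "257adf" (cK cX) (bC "039bg" (cT 0 "0213f46h987gd") bN))) bN))) bN)));
excl "349" (cC 6 13 (cW "111111100111011" (bC "039be" (cW "1101101010000111" (bC "038e" (cD "11111110110001101") (bC "68df" (cW "22022110211011011" (bC "568adf" (cK cX) (bC "019cg" (cT 0 "0831f47h926gd") bN))) bN))) bN)));
excl "369" (cW "10011101110011" (bC "08cd" (cK cX) (bC "457d" (cK cX) bN)));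
excl "469" (cW "11010011111001" (bC "038d" (cK cX) (bC "17ad" (cW "110111011110111" (bC "17acd" (cK cX) bN)) bN)));
excl "09c" (cW "11110011110001" (bC "127d" (cK cX) (bC "368d" (cK cX) bN)));
excl "19c" (cW "10011001111011" (bC "038d" (cK cX) (bC "47ad" (cW "111110111110011" (bC "467ad" (cK cX) bN)) bN)));
excl "179" (cW "10111101010011" (bC "02cd" (cK cX) (bC "345d" (cK cX) bN)));
excl "479" (cW "11110111010001" (bC "012d" (cK cX) (bC "356d" (cK cX) bN)));
excl "679" (cD "11111111121111");
excl "79c" (cD "11111111121111");
excl "12a" (cC 7 13 (cW "110111011110111" (bC "019ce" (cD "1111100111100111") bN)));
excl "14a" (cC 7 13 (cW "110111011110111" (bC "019ce" (cD "1111100111100111") bN)));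
excl "25a" (cW "11111101100001" (bC "038d" (cK cX) (bC "147d" (cC 8 13 (cW "1222220121111201" (bC "127acf" (cW "11101100100001011" (bC "012f" (cD "322122013221020202") (bC "08dg" (cW "111111001000010001" (bC "038d" (cK cX) (bC "345h" (cK (cK cX)) bN))) bN))) bN))) bN)));
excl "45a" (cC 7 13 (cW "111111011110011" (bC "258ae" (cD "1111101110100111") bN)));
excl "46a" (cW "01011100111011" (bC "358d" (cK cX) (bC "19cd" (cK cX) bN)));
excl "56a" (cW "11111011211001" (bC "028d" (cK cX) (bC "038d" (cK cX) bN)));
excl "1ac" (cW "11101010111001" (bC "028d" (cK cX) (bC "469d" (cK cX) bN)));
excl "2ac" (cW "11011101211011" (bC "358d" (cK cX) (bC "038d" (cK cX) bN)));
excl "17a" (cW "11101010111001" (bC "028d" (cK cX) (bC "469d" (cK cX) bN)));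
excl "27a" (cW "11100111110001" (bC "019d" (cK cX) (bC "568d" (cK cX) bN)));
excl "47a" (cW "01011100111011" (bC "358d" (cK cX) (bC "19cd" (cK cX) bN)));
excl "57a" (cW "11211111110001" (bC "028d" (cK cX) (bC "012d" (cK cX) bN)));
excl "67a" (cW "11111111221011" (bC "028cd" (cK cX) bN));
excl "7ac" (cW "12112110222111" (bC "149d" (cK cX) bN));
excl "28a" (cW "11011100101011" (bC "01cd" (cC 5 13 (cW "2211221021211201" (bC "028bcf" (cW "33242312323023120" (bC "127acf" (cW "111111001110111000" (bC "258ae" (cT 0 "08h1ag7edf5i2") bN)) bN)) bN))) (bC "345d" (cK cX) bN)));
excl "58a" (cW "11111010101001" (bC "012d" (cK cX) (bC "346d" (cC 2 13 (cW "2122211121201201" (bC "4567af" (cW "01111000101001011" (bC "14af" (cD "132222102120131202") (bC "12dg" (cW "111110001010010001" (bC "012d" (cK cX) (bC "038h" (cK (cK cX)) bN))) bN))) bN))) bN)));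
excl "68a" (cC 5 13 (cW "443365205453343" (bC "028bce" (cD "1111011011100111") (bC "28ace" (cK cX) bN))));
excl "8ac" (cW "22111020212001" (bC "68a" (cK cX) (bC "01d" (cW "111110101110111" (bC "28ace" (cK cX) (bC "3469e" (cD "1101110011101111") bN))) bN)));
excl "02b" (cW "11110101110001" (bC "358d" (cK cX) (bC "179d" (cK cX) bN)));
excl "03b" (cW "11111100110001" (bC "149d" (cK cX) (bC "258d" (cK cX) bN)));
excl "25b" (cW "21221202110001" (bC "257" (cK cX) (bC "03d" (cW "111111011101011" (bC "258be" (cK cX) (bC "1479e" (cD "1111110001110111") bN))) bN)));
excl "35b" (cW "10111101110001" (bC "028d" (cK cX) (bC "479d" (cK cX) bN)));
excl "36b" (cW "11101110121101" (bC "019d" (cK cX) (bC "149d" (cK cX) bN)));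
excl "56b" (cW "11211111121101" (bC "127ad" (cK cX) bN));
excl "0bc" (cW "22221111221001" (bC "127ad" (cK cX) (bC "3568d" (cK cX) bN)));
excl "2bc" (cW "22211211121101" (bC "019d" (cK cX) bN));
excl "08b" (cW "11110010111001" (bC "12ad" (cK cX) (bC "369d" (cK cX) bN)));
excl "28b" (cW "11100110011101" (bC "019d" (cK cX) (bC "56ad" (cK cX) bN)));
excl "38b" (cW "10011100111011" (bC "45ad" (cK cX) (bC "09cd" (cK cX) bN)));
excl "58b" (cW "11211110011101" (bC "12ad" (cK cX) (bC "012d" (cK cX) bN)));
excl "68b" (cW "21121111222011" (bC "039d" (cK cX) bN));
excl "8bc" (cW "21121111222011" (bC "039d" (cK cX) bN));
excl "09b" (cW "01111100010111" (bC "12cd" (cK cX) (bC "345d" (cK cX) bN)));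
excl "39b" (cW "11101110010101" (bC "012d" (cK cX) (bC "456d" (cK cX) bN)));
excl "69b" (cD "11111111121111");
excl "9bc" (cD "11111111121111");
excl "02" (cW "11110101110001" (bC "358d" (cK cX) (bC "179d" (cK cX) bN)));
excl "12" (cW "11101100011101" (bC "45ad" (cK cX) (bC "09bd" (cK cX) bN)));
excl "03" (cW "11111100110001" (bC "149d" (cK cX) (bC "258d" (cK cX) bN)));
excl "25" (cD "11111101111101");
excl "35" (cW "10111101110001" (bC "028d" (cK cX) (bC "479d" (cK cX) bN)));
excl "45" (cW "11121101111001" (bC "127ad" (cK cX) (bC "03d" (cK (cK cX)) bN)));
excl "56" (cW "11211111121101" (bC "028bd" (cK cX) (bC "127ad" (cK cX) bN)));
excl "2c" (cW "22211211121101" (bC "019d" (cK cX) bN));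
excl "27" (cW "22211211121101" (bC "019d" (cK cX) bN));
excl "57" (cW "22322211121101" (bC "028bd" (cK cX) (bC "012d" (cK cX) bN)));
excl "67" (cD "22222211232111");
excl "7c" (cD "22222211232111");
excl "08" (cW "11110010111001" (bC "12ad" (cK cX) (bC "369d" (cK cX) bN)));
excl "28" (cW "22122200112111" (bC "14ad" (cK cX) (bC "45d" (cK (cK cX)) bN)));
excl "38" (cW "10011100111011" (bC "45ad" (cK cX) (bC "09cd" (cK cX) bN)));
excl "58" (cW "21221111111001" (bC "12d" (cK (cK cX)) (bC "039d" (cK cX) bN)));
excl "68" (cW "21121111222011" (bC "039d" (cK cX) bN));
excl "8c" (cW "21121111222011" (bC "039d" (cK cX) bN));
excl "09" (cW "11121101110011" (bC "127cd" (cK cX) (bC "35d" (cK (cK cX)) bN)));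
excl "19" (cW "11112100011111" (bC "02bcd" (cK cX) (bC "45d" (cK (cK cX)) bN)));
excl "39" (cW "21111111110001" (bC "02d" (cK (cK cX)) (bC "4567d" (cK cX) bN)));
excl "49" (cW "12111110011101" (bC "12d" (cK (cK cX)) (bC "356bd" (cK cX) bN)));
excl "69" (cD "22122111222111");
excl "9c" (cD "22122111222111");
excl "79" (cD "22222211121111");
excl "1a" (cW "11101010111001" (bC "028d" (cK cX) (bC "469d" (cK cX) bN)));
excl "2a" (cW "22122201211011" (bC "038d" (cK cX) (bC "35d" (cK (cK cX)) bN)));
excl "4a" (cW "01011100111011" (bC "358d" (cK cX) (bC "19cd" (cK cX) bN)));
excl "5a" (cW "22222111211001" (bC "012d" (cK cX) (bC "08d" (cK (cK cX)) bN)));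
excl "6a" (cW "22122111322011" (bC "028cd" (cK cX) (bC "038d" (cK cX) bN)));
excl "ac" (cW "12112110222111" (bC "149d" (cK cX) bN));
excl "7a" (cW "11111111110011" (bC "028cd" (cK cX) (bC "3568d" (cK cX) bN)));
excl "8a" (cD "11111110111011");
excl "0b" (cW "12211110121101" (bC "149d" (cK cX) (bC "12ad" (cK cX) bN)));
excl "2b" (cW "22211211121101" (bC "019d" (cK cX) bN));
excl "3b" (cW "32222211221001" (bC "019d" (cK cX) (bC "02d" (cK cX) bN)));
excl "5b" (cW "22322211121101" (bC "127ad" (cK cX) (bC "012d" (cK cX) bN)));
excl "6b" (cD "22222211232111");
excl "bc" (cD "22222211232111");
excl "8b" (cW "21121111111011" (bC "039d" (cK cX) bN));
excl "9b" (cD "22222211121111");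
excl "2" (cW "22111111111101" (bC "019d" (cK cX) bN));
excl "5" (cW "22222111222101" (bC "028bd" (cK cX) (bC "127ad" (cK cX) bN)));
excl "8" (cC 2 13 (cK (cK cX)));
excl "9" (cD "22122111111111");
excl "a" (cC 2 13 (cK (cK cX)));
excl "b" (cD "22222211121111");
excl "346" (cC 5 13 (cK cX));
excl "01c" (cC 2 13 (cK cX));
excl "147" (cC 9 13 (cK cX));
excl "01" (cC 2 13 (cK cX));
excl "14" (cC 9 13 (cK cX));
excl "34" (cC 5 13 (cK cX));
excl "36" (cC 5 13 (cK cX));
excl "46" (cC 5 13 (cK cX));
excl "0c" (cC 2 13 (cK cX));
excl "1c" (cC 2 13 (cK cX));
excl "17" (cC 10 13 (cK cX));
excl "47" (cC 10 13 (cK cX));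
excl "0" (cC 11 13 (cK cX));
excl "1" (cW "32222111222001" (bC "039d" (cK cX) (bC "08d" (cK (cK cX)) bN)));
excl "3" (cC 11 13 (cK cX));
excl "4" (cW "23222210122101" (bC "019d" (cK cX) (bC "12d" (cK (cK cX)) bN)));
excl "6" (cD "22122111222111");
excl "c" (cD "22122111222111");
excl "7" (cD "22222211121111");
excl "" (cD "22122111111111")].

Definition pairs7 : seq (nat * nat * cert) := [::
(0, 4, cC 14 15 (cW "22221111111111111" (bC "127adg" (cD "111001111100001111") bN)));
(0, 5, cC 14 15 (cW "22221111111111111" (bC "127adg" (cD "111010101110001111") bN)));
(0, 6, cC 14 15 (cW "11111101110000111" (bC "1479g" (cD "111111000100011111") bN)));
(0, 7, cC 14 15 (cW "11111100111000111" (bC "258ag" (cD "222221101011111111") bN)));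
(0, 10, cC 14 15 (cW "11111101110111111" (bC "1479cg" (cD "222212110111101111") (bC "258bdg" (cD "222221112100011111") bN))));
(0, 13, cC 14 15 (cW "11111101110000111" (bC "1479g" (cD "222212110111101111") bN)));
(1, 3, cC 14 15 (cW "21211111111110111" (bC "028bg" (cD "211101111110001111") bN)));
(1, 5, cC 14 15 (cW "21211111111110111" (bC "028bg" (cD "111100101110001111") bN)));
(1, 6, cC 14 15 (cW "11111100011100111" (bC "039bg" (cD "111111001100001111") bN)));
(1, 8, cC 14 15 (cW "11111100011100111" (bC "039bg" (cD "211111111100001111") bN)));
(1, 11, cC 14 15 (cW "11111100111000111" (bC "258ag" (cD "212211111010101111") bN)));
(2, 3, cC 14 15 (cW "22111110111111111" (bC "019cg" (cD "211110111110001111") bN)));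
(2, 4, cC 14 15 (cW "22111110111111111" (bC "019cg" (cD "111100111100001111") bN)));
(2, 6, cC 14 15 (cW "11111100011100111" (bC "039bg" (cD "111111000001101111") bN)));
(2, 9, cC 14 15 (cW "11111100001110111" (bC "14acg" (cD "332322112110111111") bN)));
(2, 12, cC 14 15 (cW "11111100011100111" (bC "039bg" (cD "211111111100001111") bN)));
(3, 7, cC 14 15 (cW "22111110111111111" (bC "019cg" (cD "111110001110001111") bN)));
(3, 10, cC 14 15 (cW "22111110111111111" (bC "019cg" (cD "111110000001111111") bN)));
(3, 13, cC 14 15 (cW "21211111111110111" (bC "028bg" (cD "111101011100001111") bN)));
(4, 8, cC 14 15 (cW "11111100011100111" (bC "039bg" (cD "111100111100001111") bN)));
(4, 11, cC 14 15 (cW "22111110111111111" (bC "019cg" (cD "111110001110001111") bN)));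
(5, 9, cC 14 15 (cW "11101010111100111" (bC "028bg" (cD "111101000011101111") bN)));
(5, 12, cC 14 15 (cW "11111100011100111" (bC "039bg" (cD "222211111101111111") bN)));
(7, 11, cC 14 15 (cW "22111110111111111" (bC "019cg" (cD "111110001110001111") bN)));
(8, 12, cC 14 15 (cW "11111100011100111" (bC "039bg" (cD "444222421303023433") bN)));
(9, 13, cC 14 15 (cW "11101010111100111" (bC "028bg" (cD "111101000011101111") bN)))].

Definition transfers7 : seq (seq nat * nat * cert) := [::
("3456" : seq nat, 3, cC 14 15 (cW "11111101110000111" (bC "1479g" (cD "111111000100011111") bN)));
("3456" : seq nat, 4, cC 14 15 (cW "11111100011100111" (bC "039bg" (cD "111111001100001111") bN)));
("3456" : seq nat, 5, cC 14 15 (cW "11111100011100111" (bC "039bg" (cD "111111000001101111") bN)));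
("3456" : seq nat, 6, cC 14 15 (cW "21121101100011111" (bC "038g" (cD "111111001111101111") (bC "03cg" (cD "111111001100001111") bN))));
("039" : seq nat, 0, cC 14 15 (cW "11111101110000111" (bC "1479g" (cD "222212110111101111") bN)));
("039" : seq nat, 3, cC 14 15 (cW "21211111111110111" (bC "028bg" (cD "111101011100001111") bN)));
("039" : seq nat, 9, cC 14 15 (cW "22221211111110111" (bC "3568bg" (cW "101111000000001111" (bC "4efh" (cC 11 14 (cW "21111110111100211101" (bC "019fhj" (cD "101110000011001111011") bN))) (bC "345g" (cD "1011110111000011101") bN))) bN)));
("147a" : seq nat, 1, cC 14 15 (cW "11111100111000111" (bC "258ag" (cD "111110101010001111") bN)));
("147a" : seq nat, 4, cC 14 15 (cW "22111110111111111" (bC "019cg" (cD "111110001110001111") bN)));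
("147a" : seq nat, 7, cC 14 15 (cW "22111110111111111" (bC "019cg" (cD "111110001110001111") bN)));
("147a" : seq nat, 10, cC 14 15 (cW "22222110111111111" (bC "3469cg" (cW "331222101111111111" (bC "019cg" (cC 12 14 (cW "11011000000110111111" (bC "03bgj" (cD "442220401123423022233") bN))) bN)) bN)));
("03b" : seq nat, 0, cC 14 15 (cW "11111100000111111" (bC "25bdg" (cD "222221101111011111") bN)));
("03b" : seq nat, 3, cC 14 15 (cW "22111110111111111" (bC "019cg" (cD "111110000001111111") bN)));
("03b" : seq nat, 11, cC 14 15 (cW "22222110111111111" (bC "3469cg" (cW "331222101111111111" (bC "019cg" (cC 9 14 (cW "21111011121000111111" (bC "028fhj" (cD "110101000110001111011") bN))) bN)) bN)));
("258b" : seq nat, 2, cC 14 15 (cW "11111100011100111" (bC "039bg" (cD "211111111100001111") bN)));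
("258b" : seq nat, 5, cC 14 15 (cW "11111100011100111" (bC "039bg" (cD "222211111101111111") bN)));
("258b" : seq nat, 8, cC 14 15 (cW "11111100011100111" (bC "039bg" (cD "212111110101111111") bN)));
("258b" : seq nat, 11, cC 14 15 (cW "21111111111111111" (bC "4567adg" (cC 13 14 (cW "2232221111111121111" (bC "028bfhi" (cD "01110100000011111111") bN))) bN)));
("147c" : seq nat, 1, cC 14 15 (cW "21111111111111111" (bC "4567adg" (cW "111111001110001110" (bC "258ag" (cD "2122111110101011101") (bC "258ae" (cD "0111110000110011111") bN))) bN)));
("147c" : seq nat, 4, cC 14 15 (cW "22221111111111111" (bC "127adg" (cW "111111001110001110" (bC "258ag" (cD "2111011110101011101") (bC "258ae" (cD "1110110000110011111") bN))) bN)));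
("147c" : seq nat, 7, cC 14 15 (cW "22222110111111111" (bC "3469cg" (cW "331222101111111111" (bC "019cg" (cC 9 14 (cW "11011000110000111111" (bC "038gj" (cD "221110201111111011111") bN))) bN)) bN)));
("147c" : seq nat, 12, cC 14 15 (cW "21111111111111111" (bC "4567adg" (cW "122211111111111111" (bC "127adg" (cW "1110110000000011101" (bC "0efi" (cC 10 14 (cW "121011101121001111101" (bC "019fhk" (cD "1111100000110011000111") bN))) (bC "012g" (cK cX) bN))) bN)) bN)));
("149c" : seq nat, 1, cC 14 15 (cW "11111100011100111" (bC "039bg" (cD "211111111101111111") bN)));
("149c" : seq nat, 4, cC 14 15 (cW "11111100011100111" (bC "039bg" (cD "222211111101111111") bN)));
("149c" : seq nat, 9, cC 14 15 (cW "21111111111111111" (bC "4567adg" (cC 7 14 (cW "2322221111111121111" (bC "019cfhi" (cD "01111001100000111111") bN))) bN)));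
("149c" : seq nat, 12, cC 14 15 (cW "11111100011100111" (bC "039bg" (cD "221111111101011111") bN)));
("258d" : seq nat, 2, cC 14 15 (cW "21111111111111111" (bC "4567adg" (cW "111111000011101110" (bC "14acg" (cD "3323221121101111101") (bC "14ace" (cD "0111110001100011111") bN))) bN)));
("258d" : seq nat, 5, cC 14 15 (cW "22221111111111111" (bC "127adg" (cW "322121112111111111" (bC "028bg" (cW "2211110011110111111" (bC "039beh" (cD "22111100100111111111") bN)) bN)) bN)));
("258d" : seq nat, 8, cC 14 15 (cW "21111111111111111" (bC "4567adg" (cC 10 14 (cW "1121111111100021111" (bC "028fhi" (cD "01110100011000111111") bN))) bN)));
("258d" : seq nat, 13, cC 14 15 (cW "22221211111110111" (bC "3568bg" (cW "101111000000001111" (bC "4efh" (cC 11 14 (cW "10111100000110110111" (bC "03cij" (cD "212111211111101001111") bN))) (bC "345g" (cD "1011110111000011101") bN))) bN)));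
("25ad" : seq nat, 2, cC 14 15 (cW "11111100001110111" (bC "14acg" (cD "222212111110101111") bN)));
("25ad" : seq nat, 5, cC 14 15 (cW "21211111111110111" (bC "028bg" (cD "111101000011101111") bN)));
("25ad" : seq nat, 10, cC 14 15 (cW "22221211111110111" (bC "3568bg" (cW "101111000000001111" (bC "4efh" (cC 8 14 (cW "42333311221111221111" (bC "039gij" (cD "424222424321103002233") (bC "4567adfj" (cD "011111001100001100111") bN)))) (bC "345g" (cD "1011110111000011101") bN))) bN)));
("25ad" : seq nat, 13, cC 14 15 (cW "21211111111110111" (bC "028bg" (cD "111101000011101111") bN)));
("147ad" : seq nat, 1, cC 14 15 (cW "11111100111000111" (bC "258ag" (cD "111110101010001111") bN)));
("147ad" : seq nat, 4, cC 14 15 (cW "22111110111111111" (bC "019cg" (cD "111110001110001111") bN)));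
("147ad" : seq nat, 7, cC 14 15 (cW "22111110111111111" (bC "019cg" (cD "111110001110001111") bN)));
("147ad" : seq nat, 10, cC 14 15 (cW "22111110111111111" (bC "019cg" (cD "111110000001111111") bN)));
("257ad" : seq nat, 2, cC 14 15 (cW "11111101110000111" (bC "1479g" (cD "222212110111101111") bN)));
("257ad" : seq nat, 5, cC 14 15 (cW "21211111111110111" (bC "028bg" (cD "111101011100001111") bN)));
("257ad" : seq nat, 10, cC 14 15 (cW "11101010111100111" (bC "028bg" (cD "111101011100001111") bN)));
("257ad" : seq nat, 13, cC 14 15 (cW "21211111111110111" (bC "028bg" (cD "111101011100001111") bN)))].

Definition traces7 : seq (seq nat * cert) := [::
excl "4567a" (cC 13 14 (cW "1111110111000111" (bC "1479f" (cD "22221211011111111") bN)));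
excl "4679c" (cD "111101110111101");
excl "467ac" (cD "111101111110101");
excl "4567d" (cC 10 14 (cW "1111110111111111" (bC "1479cf" (cD "22221211012110111") (bC "258bdf" (cD "22222111111101111") bN))));
excl "456ad" (cC 7 14 (cW "1111110111100011" (bC "258af" (cD "11111011101000111") bN)));
excl "457ad" (cC 6 14 (cW "1111111111000011" (bC "1479f" (cD "11111110011000111") bN)));
excl "467ad" (cD "121111101111111");
excl "567ad" (cD "112111111111101");
excl "568ad" (cD "111110101011111");
excl "568bd" (cD "111110101111011");
excl "4567" (cC 10 14 (cW "1111110000111111" (bC "12ade" (cD "11111101111000101") (bC "25bdf" (cD "43443312222111111") bN))));
excl "3568" (cC 11 14 (cW "1111110011110011" (bC "258af" (cD "21221111101110111") bN)));
excl "3469" (cC 12 14 (cW "1111110001111011" (bC "039bf" (cD "21111111110010111") bN)));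
excl "1479" (cC 12 14 (cW "1111110001111011" (bC "039bf" (cD "22211121010121211") bN)));
excl "4679" (cD "111101110111101");
excl "456a" (cC 7 14 (cW "1111110111100011" (bC "258af" (cD "11111011101000111") bN)));
excl "127a" (cC 13 14 (cW "2121111111111111" (bC "028bf" (cD "11110101110001111") bN)));
excl "257a" (cC 13 14 (cW "2121111111111111" (bC "028bf" (cD "11110101110001111") bN)));
excl "457a" (cC 13 14 (cW "1111110111000111" (bC "1479f" (cD "22221211011111111") bN)));
excl "467a" (cD "111101111110101");
excl "567a" (cD "112111111111101");
excl "258a" (cC 13 14 (cW "1110101011110111" (bC "028bf" (cD "11110100001111111") bN)));
excl "568a" (cD "111110101011111");
excl "356b" (cC 8 14 (cW "1111110011110011" (bC "039bf" (cD "21211211110110111") bN)));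
excl "358b" (cC 6 14 (cW "1111111001110011" (bC "039bf" (cD "11111110110000111") bN)));
excl "368b" (cD "211111101111111");
excl "568b" (cD "212211111111111");
excl "369b" (cD "211111111101111");
excl "346c" (cC 9 14 (cW "1111110001111011" (bC "14acf" (cD "33232211221011111") bN)));
excl "467c" (cD "111101110111101");
excl "349c" (cC 6 14 (cW "1111111001110011" (bC "039bf" (cD "11111110000110111") bN)));
excl "369c" (cD "211111111111101");
excl "469c" (cD "221211111111111");
excl "179c" (cC 4 14 (cW "1011110101111011" (bC "039f" (cD "11111011110000111") (bC "257af" (cD "32312222131100211") bN))));
excl "479c" (cW "111101110111101" (bC "356be" (cK cX) bN));
excl "679c" (cD "222111211222101");
excl "14ac" (cC 7 14 (cW "2211111111111111" (bC "019cf" (cD "11111001111000111") bN)));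
excl "46ac" (cD "111101111110101");
excl "17ac" (cC 4 14 (cW "1011110111101011" (bC "25af" (cD "32312221112120211") (bC "039cf" (cD "33333211222110111") bN))));
excl "47ac" (cW "222212111110101" (bC "3568e" (cK cX) bN));
excl "67ac" (cD "323212222221201");
excl "456d" (cC 7 14 (cW "1111110111100011" (bC "127ae" (cK cX) (bC "258af" (cD "33333211112211111") bN))));
excl "127d" (cC 10 14 (cW "2211111011211111" (bC "019cf" (cD "11111000001111111") bN)));
excl "147d" (cC 10 14 (cW "2211111011211111" (bC "019cf" (cD "11111000001111111") bN)));
excl "257d" (cC 10 14 (cW "2121111111211011" (bC "028bf" (cD "11110101111000111") bN)));
excl "457d" (cC 6 14 (cW "1111111111011111" (bC "1479cf" (cD "11111110011000111") (bC "258bdf" (cD "11111111100000111") bN))));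
excl "467d" (cD "121111101111111");
excl "567d" (cD "112111111211001");
excl "568d" (cD "111110101111011");
excl "12ad" (cC 7 14 (cW "2211111111111111" (bC "019cf" (cD "11111001110001111") bN)));
excl "14ad" (cC 7 14 (cW "2211111111111111" (bC "019cf" (cD "11111001111000111") bN)));
excl "45ad" (cC 6 14 (cW "1111111111000011" (bC "1479f" (cD "11111110011000111") bN)));
excl "46ad" (cD "121111101111111");
excl "56ad" (cD "112111111111101");
excl "17ad" (cD "222121101111111");
excl "27ad" (cD "222112111111101");
excl "47ad" (cD "121111101111111");
excl "57ad" (cD "112111111111101");
excl "67ad" (cD "333222212222211");
excl "28ad" (cC 5 14 (cW "1101110010111111" (bC "14af" (cD "33212220212111211") (bC "038bf" (cD "22221210112110111") bN))));
excl "58ad" (cW "222221101011111" (bC "346ce" (cK cX) bN));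
excl "68ad" (cD "332221202122221");
excl "25bd" (cC 8 14 (cW "1111110011110011" (bC "039bf" (cD "22211121210101211") bN)));
excl "56bd" (cD "111110101111011");
excl "28bd" (cC 5 14 (cW "1101110011110111" (bC "03bf" (cD "33221220111212211") (bC "14adf" (cD "33323310122211111") bN))));
excl "58bd" (cW "222221101111011" (bC "3469e" (cK cX) bN));
excl "68bd" (cD "332221202222121");
excl "345" (cC 6 14 (cW "2112111110001111" (bC "038f" (cD "22222220111110221") (bC "03cf" (cD "22222220111110221") bN))));
excl "346" (cD "221222001111111");
excl "356" (cD "212222011111101");
excl "456" (cD "111211011111111");
excl "127" (cC 13 14 (cW "2121111111111111" (bC "028bf" (cD "11110101110001111") bN)));
excl "147" (cC 12 14 (cW "1111110001111011" (bC "039bf" (cD "22111111110111111") bN)));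
excl "257" (cC 13 14 (cW "2121111111111111" (bC "028bf" (cD "11110101110001111") bN)));
excl "457" (cC 6 14 (cW "1111111001110011" (bC "039bf" (cD "22221121221000111") (bC "369be" (cK cX) bN))));
excl "467" (cD "222212111211111");
excl "567" (cD "112111111211001");
excl "028" (cC 11 14 (cW "2211111011121111" (bC "019cf" (cD "11111000111100111") bN)));
excl "038" (cC 11 14 (cW "2211111011121111" (bC "019cf" (cD "11111000111100111") bN)));
excl "258" (cC 11 14 (cC 13 14 (cW "22221211111111101" (bC "3568bg" (cW "212211111112111101" (bC "127adfh" (cD "1010110000011111111") bN)) bN))));
excl "358" (cC 6 14 (cW "1111111001110011" (bC "039bf" (cD "11111110110000111") bN)));
excl "368" (cD "211111101111111");
excl "568" (cD "212211111111111");
excl "019" (cC 12 14 (cW "1111110001111011" (bC "039bf" (cD "22221111110121111") bN)));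
excl "149" (cC 12 14 (cW "1111110001111011" (bC "039bf" (cD "22111111110111111") bN)));
excl "349" (cC 6 14 (cW "1111111001110011" (bC "039bf" (cD "11111110000110111") bN)));
excl "369" (cD "211111111111101");
excl "469" (cD "221211111111111");
excl "179" (cC 12 14 (cW "2121111111112011" (bC "028bf" (cD "42321222122120211") bN)));
excl "479" (cW "111101110111101" (bC "356be" (cK cX) bN));
excl "679" (cD "222111211212111");
excl "12a" (cC 7 14 (cW "2211111111111111" (bC "019cf" (cD "22222101111111111") bN)));
excl "14a" (cC 7 14 (cW "2211111111101121" (bC "019cf" (cD "11111001111000111") bN)));
excl "25a" (cC 13 14 (cW "2121111111111111" (bC "028bf" (cD "22221201111111111") bN)));
excl "45a" (cC 6 14 (cW "1111111111000011" (bC "1479f" (cK (cD "22232211111122211")) bN)));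
excl "46a" (cD "222212111111211");
excl "56a" (cD "323322122111211");
excl "17a" (cD "323222111111211");
excl "27a" (cD "222112111111101");
excl "47a" (cD "333323111111211");
excl "57a" (cD "112111111111101");
excl "67a" (cD "323212222221201");
excl "28a" (cC 13 14 (cW "2211111011111211" (bC "019cf" (cD "22221111111111111") bN)));
excl "58a" (cW "222221101011111" (bC "346ce" (cK cX) bN));
excl "68a" (cD "322211212121211");
excl "02b" (cW "111101011100001" (bC "179e" (cK cX) (bC "358e" (cK cX) bN)));
excl "25b" (cC 8 14 (cW "1111110011110011" (bC "039bf" (cD "21211111110111111") bN)));
excl "35b" (cW "101111011100001" (bC "028e" (cK cX) (bC "479e" (cK cX) bN)));
excl "36b" (cD "322222112211111");
excl "56b" (cD "212211111111111");
excl "08b" (cW "222211101111111" (bC "12ade" (cK cX) bN));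
excl "28b" (cD "322212111111111");
excl "38b" (cW "211111101111111" (bC "456ade" (cK cX) bN));
excl "58b" (cD "212211111111111");
excl "68b" (cD "322211212221111");
excl "09b" (cW "222211111101111" (bC "127de" (cK cX) bN));
excl "39b" (cW "211111111101111" (bC "4567de" (cK cX) bN));
excl "69b" (cD "322211222211111");
excl "01c" (cW "111110001110001" (bC "28ae" (cK cX) (bC "349e" (cK cX) bN)));
excl "03c" (cC 9 14 (cW "2121111112111011" (bC "028bf" (cD "11110100011110111") bN)));
excl "14c" (cC 7 14 (cC 9 14 (cW "22222111121111211" (bC "3469cf" (cW "221211111211111011" (bC "127adgh" (cD "1100110111000011111") bN)) bN))));
excl "34c" (cW "110111001110001" (bC "58ae" (cK cX) (bC "019e" (cK cX) bN)));
excl "36c" (cD "211111111111101");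
excl "46c" (cD "221211111111111");
excl "17c" (cW "212111110111101" (bC "02be" (cK cX) bN));
excl "47c" (cW "333323111221101" (bC "258ae" (cK cX) bN));
excl "67c" (cD "323212221222201");
excl "09c" (cW "222211111111101" (bC "127ae" (cK cX) bN));
excl "19c" (cD "322221111111111");
excl "39c" (cW "211111111111101" (bC "4567ae" (cK cX) bN));
excl "49c" (cD "221211111111111");
excl "69c" (cD "322211222211111");
excl "79c" (cD "222111211211001");
excl "1ac" (cW "212111111110101" (bC "028e" (cK cX) bN));
excl "4ac" (cW "222212111110101" (bC "3568e" (cK cX) bN));
excl "6ac" (cD "433322223221211");
excl "7ac" (cD "434323222221201");
excl "12d" (cW "111011000111001" (bC "45ae" (cK cX) (bC "09be" (cK cX) bN)));
excl "14d" (cC 7 14 (cW "2211111111111111" (bC "019cf" (cD "11111001110001111") bN)));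
excl "25d" (cC 8 14 (cW "1111110011110011" (bC "039bf" (cD "21211111110111111") bN)));
excl "45d" (cW "011111000111001" (bC "12ae" (cK cX) (bC "39be" (cK cX) bN)));
excl "46d" (cD "121111101111111");
excl "56d" (cD "333332112222111");
excl "17d" (cD "222121101111111");
excl "27d" (cD "222112111111101");
excl "47d" (cD "232222101111111");
excl "57d" (cD "223222111111101");
excl "67d" (cD "222111211222101");
excl "28d" (cW "221111101111011" (bC "019e" (cK cX) bN));
excl "58d" (cW "333332101122111" (bC "14ace" (cK cX) bN));
excl "68d" (cD "332221202222121");
excl "1ad" (cD "222121101111111");
excl "2ad" (cD "332222112111111");
excl "4ad" (cD "121111101111111");
excl "5ad" (cD "223222111111101");
excl "6ad" (cD "222221112111111");
excl "7ad" (cD "222111211111101");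
excl "8ad" (cD "332221202121111");
excl "2bd" (cW "221111101111011" (bC "019e" (cK cX) bN));
excl "5bd" (cW "222221101111011" (bC "3469e" (cK cX) bN));
excl "6bd" (cD "443332213322121");
excl "8bd" (cD "443332202222121");
excl "01" (cW "222221001111111" (bC "349ce" (cK cX) bN));
excl "02" (cW "222212011111101" (bC "358be" (cK cX) bN));
excl "12" (cW "211111011111111" (bC "457ade" (cK cX) bN));
excl "14" (cC 12 14 (cW "1111110001111011" (bC "039bf" (cD "22111111110111111") bN)));
excl "34" (cD "221222001111111");
excl "25" (cC 8 14 (cW "1111110011110011" (bC "039bf" (cD "21211111110111111") bN)));
excl "35" (cD "212222011111101");
excl "45" (cD "111211011111111");
excl "36" (cD "322222112211111");
excl "46" (cD "221211111111111");
excl "56" (cD "212211111111111");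
excl "17" (cD "323222111111211");
excl "27" (cD "222112111111101");
excl "47" (cD "333323111211111");
excl "57" (cD "223222111111101");
excl "67" (cD "212111111211111");
excl "08" (cW "222211101111111" (bC "12ade" (cK cX) bN));
excl "28" (cD "322212111111111");
excl "38" (cW "211111101111111" (bC "456ade" (cK cX) bN));
excl "58" (cD "323322111111111");
excl "68" (cD "322211212221111");
excl "09" (cD "333322111112211");
excl "19" (cD "322221111111111");
excl "39" (cD "322222111112211");
excl "49" (cD "221211111111111");
excl "69" (cD "322211222211111");
excl "79" (cD "222111211211001");
excl "1a" (cD "433332112111221");
excl "2a" (cD "433323122111211");
excl "4a" (cD "332322112111221");
excl "5a" (cD "333332112111111");
excl "6a" (cD "444322324222422");
excl "7a" (cD "434323222221201");
excl "8a" (cD "322211212120101");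
excl "0b" (cD "333322112211111");
excl "2b" (cD "322212111111111");
excl "3b" (cD "322222112211111");
excl "5b" (cD "323322111111111");
excl "6b" (cD "222211112211111");
excl "8b" (cD "433322212221111");
excl "9b" (cD "433322222211111");
excl "0c" (cW "222211111111101" (bC "127ae" (cK cX) bN));
excl "1c" (cD "322221111111111");
excl "3c" (cW "211111111111101" (bC "4567ae" (cK cX) bN));
excl "4c" (cD "221211111111111");
excl "6c" (cD "433322223321111");
excl "7c" (cD "323212221211101");
excl "9c" (cD "433322222211111");
excl "ac" (cD "544433223221211");
excl "1d" (cD "222121101111111");
excl "2d" (cD "332222112222111");
excl "4d" (cD "121111101111111");
excl "5d" (cD "333332112111111");
excl "6d" (cD "443332213332111");
excl "7d" (cD "444333212322111");
excl "8d" (cD "443332202222121");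
excl "ad" (cD "222221112111111");
excl "bd" (cD "554443213322121");
excl "1" (cD "322221111111111");
excl "2" (cD "322212111111111");
excl "4" (cD "221211111111111");
excl "5" (cD "323322111111111");
excl "6" (cD "222211112211111");
excl "7" (cD "222212111211111");
excl "8" (cD "544433212232211");
excl "9" (cD "433322222211111");
excl "a" (cD "322222112111211");
excl "b" (cD "322222112211111");
excl "c" (cD "544433223321111");
excl "d" (cD "443332212222111");
excl "03" (cC 9 14 (cC 11 14 (cK (cD "11111100011100111"))));
excl "0" (cD "333322112211111");
excl "3" (cD "322222112211111");
excl "" (cD "322222112211111")].

Definition hex_cert := cC 0 3 (cC 1 4 (cC 2 5 (cW "111111000" (bC "012" (cW "1101101100" (bC "037" (cW "11111101101" (bC "0378" (cW "011011011000" (bC "148" (cT 0 "10243597b8c") (bC "257" (cT 0 "20153498b7c") bN))) (bC "148a" (cW "101101001010" (bC "038" (cT 0 "0123459ab8c") (bC "25a" (cT 0 "2015349cab8") bN))) bN))) (bC "146" (cW "11111110101" (bC "038a" (cW "011011001010" (bC "25a" (cT 0 "20153498bac") (bC "148" (cT 0 "1024359ab8c") bN))) (bC "1468" (cW "101101101000" (bC "256" (cT 0 "2015349c6b8") (bC "038" (cT 0 "01234596b8c") bN))) bN))) bN))) (bC "345" (cW "1101101100" (bC "037" (cW "11111101101" (bC "0378" (cW "011011011000" (bC "148" (cT 0 "43510297b8c") (bC "257" (cT 0 "53420198b7c") bN))) (bC "148a" (cW "101101001010" (bC "038" (cT 0 "3450129ab8c") (bC "25a" (cT 0 "5342019cab8")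 bN))) bN))) (bC "146" (cW "11111110101" (bC "038a" (cW "011011001010" (bC "148" (cT 0 "4351029ab8c") (bC "25a" (cT 0 "53420198bac") bN))) (bC "1468" (cW "101101101000" (bC "038" (cT 0 "34501296b8c") (bC "256" (cT 0 "5342019c6b8") bN))) bN))) bN))) bN))))).
Definition vega6_cert := cW "1011010100001" (bC "03c" (cS 9 13 (cT 0 "0123456789abcd") (cC 9 13 (cW "212111111211111" (bC "028be" (cD "1111010001111111") bN)))) (bC "257" (cS 10 13 (cT 0 "2015346d789abc") (cC 10 13 (cW "212111111121111" (bC "028be" (cD "1111010111100111") bN)))) bN)).
Definition transversal_cert := cC 14 15 (cC 14 16 (cC 15 16 (cK (cD "11111100000000111111")))).

End Certificates.

(** * Vega patterns *)

Definition edges_of (n : nat) (r : rel nat) : seq (nat * nat) :=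
  [seq p <- [seq (i, j) | i <- iota 0 n, j <- iota 0 n] | r p.1 p.2].

Definition hex_edges := [:: (0, 4); (2, 4); (2, 3); (1, 3); (1, 5); (0, 5)].

(* Codes 0, ..., 6 are a, b, c, u, v, w, x; code 7 + j is the j-th vertex of
   the sequence; code 7 + L, if present, is y. *)
Definition vega_rel (L : nat) (i j : nat) : bool :=
  if j < 7 then ((i, j) \in hex_edges) || (i < 3) && (j == 6)
  else if j < 7 + L then
    if i < 7 then (i < 6) && (i %% 3 == (j - 7) %% 3)
    else (i < j) && ((j - i) %% 3 == 1)
  else 3 <= i < 7.

Definition vega_edges L (y : bool) := edges_of (7 + L + y) (vega_rel L).

Definition vtarget L y := (7 + L + nat_of_bool y, vega_edges L y).

(* The trace of a vertex of class [x] that would be inserted in the sequence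
   before its [c]-th vertex. *)
Definition cut_trace (x c : nat) : seq nat :=
  [seq i <- iota 0 14 | if i < 7 then (i < 6) && (i %% 3 == x)
     else if i - 7 < c then (x + 9 - (i - 7)) %% 3 == 1
     else (i - 7 + 3 - x) %% 3 == 1].

(** Longer sequences are allowed here, so besides the neighbourhoods in the pattern, the trace of y
    and those of vertices inserted at each of the eight places in each class are admissible. *)
Definition legit7 : seq (seq nat) :=
  adjs 14 (vega_edges 7 false) ++ [:: 3; 4; 5; 6] ::
  [seq cut_trace x c | x <- iota 0 3, c <- iota 0 8].

Lemma family4_ok : family_ok 11 (vega_edges 4 false) [:: vtarget 5 false]
  (adjs 11 (vega_edges 4 false)) pairs4 [::] traces4.
Proof. by vm_compute. Qed.

Lemma family5_ok : family_ok 12 (vega_edges 5 false) [:: vtarget 5 true; vtarget 6 false]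
  (adjs 12 (vega_edges 5 false)) pairs5 [::] traces5.
Proof. by vm_compute. Qed.

Lemma family5y_ok : family_ok 13 (vega_edges 5 true) [:: vtarget 6 false; vtarget 7 false]
  (adjs 13 (vega_edges 5 true)) pairs5y [::] traces5y.
Proof. by vm_compute. Qed.

Lemma family7_ok : family_ok 14 (vega_edges 7 false) [::]
  legit7 pairs7 transfers7 traces7.
Proof. by vm_compute. Qed.

Lemma mem_edges_of n r i j : ((i, j) \in edges_of n r) = [&& i < n, j < n & r i j].
Proof.
rewrite mem_filter /= andbC andbA; congr (_ && _).
apply/allpairsP/andP => [[[a b] /= []]|[hi hj]].
  by rewrite !mem_iota /= !add0n => ? ? [-> ->].
by exists (i, j); rewrite !mem_iota.
Qed.

Lemma hom_edges_of E n r g : hom E n (edges_of n r) g <->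
  size g = n /\ forall i j, i < n -> j < n -> r i j -> E (nth 0 g i) (nth 0 g j).
Proof.
split=> -[hs h]; split=> //.
  by move=> i j hi hj rij; apply: (h (i, j)); rewrite mem_edges_of hi hj.
by move=> [i j]; rewrite mem_edges_of => /and3P[]; apply: h.
Qed.

Lemma mem_adjl_edges_of n r i j : i < n -> j < n ->
  (j \in adjl n (edges_of n r) i) = r i j || r j i.
Proof.
by move=> hi hj; rewrite mem_filter mem_iota add0n !mem_edges_of hi hj /= !andbT.
Qed.

Lemma edges_fromP k l p : p \in edges_from k l -> exists2 i, i \in l & p = (k, i).
Proof. by case/mapP => i il ->; exists i. Qed.

(** * What the finite computations say about the graph *)

Section Local.
Variables (E : rel nat) (GE : dense_graph E).

Definition induced_hexagon := exists2 g, hom E 6 hex_edges g &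
  forall i, i < 3 -> ~~ E (nth 0 g i) (nth 0 g (i + 3)).

Definition cert_ok n el tgs P legit m eln nl t :=
  [&& wf_edges n el, wf_targets tgs, all (pair_ok n el tgs (adjs n el)) P,
   check (Context (tg_edges tgs) (adjs n el) (pairs_of P) [seq tob n l | l <- legit] false)
     (init (n + m) (el ++ eln) nl) t &
   all (fun p => (p.1 < n + m) && (p.2 < n + m)) (eln ++ nl)].

Lemma cert_sound n el tgs P legit eln nl t g xs : omits E tgs -> hom E n el g ->
  cert_ok n el tgs P legit (size xs) eln nl t ->
  (legit <> [::] -> forall z, trace E n g z \in legit) ->
  {in eln, forall p, E (nth 0 (g ++ xs) p.1) (nth 0 (g ++ xs) p.2)} ->
  {in nl, forall p, ~~ E (nth 0 (g ++ xs) p.1) (nth 0 (g ++ xs) p.2)} -> False.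
Proof.
move=> om hg /and5P[we wt hP hc hb] hl he hn.
exact: (closed_sound GE we om wt hg hP hl hc hb he hn).
Qed.

(** The hexagon being induced, opposite vertices are non-adjacent; the search starts from common
    neighbours of the three opposite pairs. *)
Lemma hex_cert_ok : cert_ok 6 hex_edges [:: vtarget 4 false] [::] [::] 0
  [::] [:: (0, 3); (1, 4); (2, 5)] hex_cert.
Proof. by vm_compute. Qed.

Lemma hexagon_vega4 : omits E [:: vtarget 4 false] -> ~ induced_hexagon.
Proof.
move=> om [g hg hn].
apply: (cert_sound (xs := [::]) om hg hex_cert_ok) => // p.
by rewrite cats0 !inE => /or3P[]/eqP->; [apply: (hn 0)|apply: (hn 1)|apply: (hn 2)].
Qed.

Lemma vega6_cert_ok : cert_ok 13 (vega_edges 6 false) [:: vtarget 7 false] [::] [::] 0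
  [::] [::] vega6_cert.
Proof. by vm_compute. Qed.

(** A pattern with L = 6 always leads to one with L = 7, so no Vega graph arises from it.
    [ladder_mod3] is the analogue for longer sequences. *)
Lemma omits_vega6 : omits E [:: vtarget 7 false] -> omits E [:: vtarget 6 false].
Proof.
move=> om p; rewrite inE => /eqP-> g hg.
by apply: (cert_sound (xs := [::]) om hg vega6_cert_ok).
Qed.

Definition full_traces n el := forall g z, hom E n el g ->
  exists2 i, i < n & trace E n g z = adjl n el i.

Lemma full_adjs n el : (forall g z, hom E n el g -> trace E n g z \in adjs n el) ->
  full_traces n el.
Proof.
move=> h g z /(h g z)/mapP[i]; rewrite mem_iota add0n => hi e.
by exists i.
Qed.

Lemma wfe4 : wf_edges 11 (vega_edges 4 false). Proof. by vm_compute. Qed.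
Lemma wfe5 : wf_edges 12 (vega_edges 5 false). Proof. by vm_compute. Qed.
Lemma wfe5y : wf_edges 13 (vega_edges 5 true). Proof. by vm_compute. Qed.
Lemma wft4 : wf_targets [:: vtarget 5 false]. Proof. by vm_compute. Qed.
Lemma wft5 : wf_targets [:: vtarget 5 true; vtarget 6 false]. Proof. by vm_compute. Qed.
Lemma wft5y : wf_targets [:: vtarget 6 false; vtarget 7 false]. Proof. by vm_compute. Qed.

Lemma full_traces4 : omits E [:: vtarget 5 false] -> full_traces 11 (vega_edges 4 false).
Proof.
by move=> om; apply: full_adjs; have [] := family_sound GE wfe4 om wft4 family4_ok.
Qed.

Lemma full_traces5 : omits E [:: vtarget 5 true; vtarget 6 false] ->
  full_traces 12 (vega_edges 5 false).
Proof.
by move=> om; apply: full_adjs; have [] := family_sound GE wfe5 om wft5 family5_ok.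
Qed.

Lemma full_traces5y : omits E [:: vtarget 6 false; vtarget 7 false] ->
  full_traces 13 (vega_edges 5 true).
Proof.
by move=> om; apply: full_adjs; have [] := family_sound GE wfe5y om wft5y family5y_ok.
Qed.

Section Seven.
Notation el := (vega_edges 7 false).
Variable g : seq nat.
Hypothesis hg : hom E 14 el g.
Notation hx i := (nth 0 g i).

Lemma omits_nil : omits E [::]. Proof. by []. Qed.

Lemma wfe7 : wf_edges 14 el. Proof. by vm_compute. Qed.

Lemma wft_nil : wf_targets [::]. Proof. by []. Qed.

Lemma trace_legit7 z : trace E 14 g z \in legit7.
Proof. by have [h _ _] := family_sound GE wfe7 omits_nil wft_nil family7_ok; apply: h. Qed.

(** On the core, the admissible traces leave three types: like a core vertex, like y, or like a
    sequence term of some class. A longer pattern inherits this from its first seven terms. *)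
Lemma cases7 z : [\/ exists2 i, i < 7 & trace E 14 g z = adjl 14 el i,
  trace E 14 g z = [:: 3; 4; 5; 6] |
  exists2 c, c < 3 & forall i, i < 7 -> E z (hx i) = (i < 6) && (i %% 3 == c)].
Proof.
have : all (fun l => [|| has (fun i => l == adjl 14 el i) (iota 0 7), l == [:: 3; 4; 5; 6] |
    has (fun c => all (fun i => (i \in l) == ((i < 6) && (i %% 3 == c))) (iota 0 7)) (iota 0 3)]) legit7.
  by vm_compute.
move=> /allP/(_ _ (trace_legit7 z))/or3P[/hasP[i]|/eqP e|/hasP[c]]; first 2 last.
- rewrite mem_iota => hc /allP h; constructor 3; exists c => // i hi.
  have hi' : i \in iota 0 7 by rewrite mem_iota.
  by have /eqP <- := h i hi'; rewrite mem_trace (leq_trans hi).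
- by rewrite mem_iota => hi /eqP e; constructor 1; exists i.
by constructor 2.
Qed.

Lemma legit7P : legit7 <> [::] -> forall z, trace E 14 g z \in legit7.
Proof. by move=> _; apply: trace_legit7. Qed.

Lemma hex_like_cert_ok : all (fun i => cert_ok 14 el [::] pairs7 legit7 2
  (edges_from 14 (adjl 14 el i) ++ [:: (15, i %% 3); (15, i %% 3 + 3)]) [:: (14, 15)]
  (cC 14 15 (cK cX))) (iota 0 6).
Proof. by vm_compute. Qed.

(** Here u is any vertex of the right class, possibly outside the copy. This carries twins of
    hexagon vertices from seven terms to the whole sequence. *)
Lemma hex_like_class i z u : i < 6 -> trace E 14 g z = adjl 14 el i ->
  E u (hx (i %% 3)) -> E u (hx (i %% 3 + 3)) -> E z u.
Proof.
move=> hi ez u1 u2; apply: contraT => nzu; exfalso.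
have [hs _] := hg.
have hb k : k < 14 -> nth 0 (g ++ [:: z; u]) k = hx k by apply: nth_ext.
have hz : nth 0 (g ++ [:: z; u]) 14 = z by rewrite nth_cat hs.
have hu : nth 0 (g ++ [:: z; u]) 15 = u by rewrite nth_cat hs.
have hi' : i \in iota 0 6 by rewrite mem_iota.
have hm := ltn_pmod i (isT : 0 < 3).
have hm1 : i %% 3 < 14 := @leq_trans 3 _ 14 hm isT.
have hm2 : i %% 3 + 3 < 14 := @leq_trans 6 _ 14 (leq_add hm (leqnn 3)) isT.
have hc := allP hex_like_cert_ok _ hi'.
apply: (cert_sound (xs := [:: z; u]) omits_nil hg hc legit7P) => p.
  rewrite mem_cat => /orP[/edges_fromP[k ki ->]|].
    rewrite [_.1]/= [_.2]/= hz hb; last exact: (allP (adjl_bound _ _ _) _ ki).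
    by move: ki; rewrite -ez mem_trace => /andP[].
  by rewrite !inE => /orP[]/eqP->; rewrite [_.1]/= [_.2]/= hu hb.
by rewrite inE => /eqP-> /=; rewrite hz hu.
Qed.

Lemma transversal_cert_ok : cert_ok 14 el [::] pairs7 legit7 3
  [:: (14, 0); (14, 3); (15, 1); (15, 4); (16, 2); (16, 5)]
  [:: (14, 15); (14, 16); (15, 16)] transversal_cert.
Proof. by vm_compute. Qed.

(** If p, q, r were pairwise non-adjacent, add a common neighbour for each pair. Among these six
    vertices and the hexagon, no vertex can see five of the twelve. *)
Lemma no_transversal p q r : E p (hx 0) -> E p (hx 3) -> E q (hx 1) -> E q (hx 4) ->
  E r (hx 2) -> E r (hx 5) -> ~~ E p q -> ~~ E p r -> ~~ E q r -> False.
Proof.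
move=> p0 p3 q1 q4 r2 r5 pq pr qr.
have [hs _] := hg.
have hb k : k < 14 -> nth 0 (g ++ [:: p; q; r]) k = hx k by apply: nth_ext.
have hp : nth 0 (g ++ [:: p; q; r]) 14 = p by rewrite nth_cat hs.
have hq : nth 0 (g ++ [:: p; q; r]) 15 = q by rewrite nth_cat hs.
have hr : nth 0 (g ++ [:: p; q; r]) 16 = r by rewrite nth_cat hs.
apply: (cert_sound (xs := [:: p; q; r]) omits_nil hg transversal_cert_ok legit7P) => e.
  by rewrite !inE => /or4P[|||/or3P[]]/eqP->; rewrite [_.1]/= [_.2]/= ?hp ?hq ?hr hb.
by rewrite !inE => /or3P[]/eqP->; rewrite [_.1]/= [_.2]/= ?hp ?hq ?hr.
Qed.

Lemma y_like_edge z u i : trace E 14 g z = [:: 3; 4; 5; 6] -> 3 <= i < 7 ->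
  trace E 14 g u = adjl 14 el i -> E z u.
Proof.
move=> ez hi eu; have [_ _ hR] := family_sound GE wfe7 omits_nil wft_nil family7_ok.
have hin : ([:: 3; 4; 5; 6], i) \in [seq r.1 | r <- transfers7].
  have : i \in [:: 3; 4; 5; 6] by rewrite !inE; lia.
  by move: i {hi eu}; apply/allP; vm_compute.
apply: (hR g hg _ hin) => //; exact: (trace_twin eu).
Qed.

End Seven.
End Local.

(** * Ladders: the Vega pattern without y, with functions for the core and the sequence *)

Definition core_edges := hex_edges ++ [:: (0, 6); (1, 6); (2, 6)].

Definition ladder (E : rel nat) (L : nat) (h s : nat -> nat) : Prop :=
  [/\ {in core_edges, forall p, E (h p.1) (h p.2)},
      forall i j, i < 6 -> j < L -> i %% 3 = j %% 3 -> E (h i) (s j)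
    & forall i j, i < j -> j < L -> (j - i) %% 3 = 1 -> E (s i) (s j)].

Lemma nth_ladder h s L k : k < 7 + L ->
  nth 0 (mkseq h 7 ++ mkseq s L) k = if k < 7 then h k else s (k - 7).
Proof.
move=> hk; rewrite nth_cat size_mkseq; case: ltnP => h7; first by rewrite nth_mkseq.
by rewrite nth_mkseq //; lia.
Qed.

Lemma ladder_hom E L h s : ladder E L h s ->
  hom E (7 + L + false) (vega_edges L false) (mkseq h 7 ++ mkseq s L).
Proof.
move=> [h1 h2 h3]; apply/hom_edges_of; split.
  by rewrite size_cat !size_mkseq addn0.
move=> i j; rewrite addn0 => hi hj; rewrite /vega_rel !nth_ladder //.
case: ltnP => j7.
  move=> hij; have -> : i < 7 by case/orP: hij => [/(allP (isT : all (fun p => p.1 < 7) hex_edges))//|/andP[]]; lia.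
  apply: (h1 (i, j)); rewrite mem_cat; case/orP: hij => [->//|/andP[i3 /eqP ->]].
  by move: i i3 {hi}; do 3!case=> //.
rewrite hj; case: ltnP => i7.
  by move=> /andP[i6 /eqP e]; apply: h2 => //; lia.
by move=> /andP[ij /eqP e]; apply: h3; lia.
Qed.

Lemma hom_ladder E L (y : bool) g : hom E (7 + L + y) (vega_edges L y) g ->
  ladder E L (nth 0 g) (fun j => nth 0 g (7 + j)).
Proof.
move=> /hom_edges_of[hs he]; split.
- have hall : all (fun p => [&& p.1 < 7, p.2 < 7 & vega_rel L p.1 p.2]) core_edges by [].
  by move=> p /(allP hall)/and3P[h1 h2 h3]; apply: he => //; lia.
- move=> i j hi hj e; apply: he; [lia|lia|].
  have -> : vega_rel L i (7 + j) = (i < 6) && (i %% 3 == (7 + j - 7) %% 3).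
    rewrite /vega_rel; have -> : (7 + j < 7) = false by lia.
    have -> : (7 + j < 7 + L) = true by lia.
    by have -> : (i < 7) = true by lia.
  by rewrite hi addKn e eqxx.
- move=> i j hij hj e; apply: he; [lia|lia|].
  have -> : vega_rel L (7 + i) (7 + j) = (7 + i < 7 + j) && ((7 + j - (7 + i)) %% 3 == 1).
    rewrite /vega_rel; have -> : (7 + j < 7) = false by lia.
    have -> : (7 + j < 7 + L) = true by lia.
    by have -> : (7 + i < 7) = false by lia.
  by rewrite ltn_add2l hij subnDl e.
Qed.

Lemma hom_ladder_y E L g : hom E (7 + L + true) (vega_edges L true) g ->
  forall i, 3 <= i < 7 -> E (nth 0 g i) (nth 0 g (7 + L)).
Proof.
move=> /hom_edges_of[hs he] i hi; apply: he; [lia|lia|].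
by rewrite /vega_rel ifN ?ifN //; lia.
Qed.

Lemma ladder_hom_y E L h s y : ladder E L h s ->
  (forall i, 3 <= i < 7 -> E (h i) y) ->
  hom E (7 + L + true) (vega_edges L true) ((mkseq h 7 ++ mkseq s L) ++ [:: y]).
Proof.
move=> hl hy; have /hom_edges_of[hs he] := ladder_hom hl.
apply/hom_edges_of; split; first by rewrite size_cat hs /= addn0.
move=> i j hi hj hij; rewrite addn0 in hs he.
have [ij|ij] := ltnP j (7 + L).
  have i7 : i < 7 + L.
    move: hij; rewrite /vega_rel; case: ltnP => j7; last by rewrite ij; case: ifP => [|_ /andP[]]; lia.
    by case/orP => [/(allP (isT : all (fun p => p.1 < 7) hex_edges))/=|/andP[]]; lia.
  by rewrite (nth_ext _ hs i7) (nth_ext _ hs ij); apply: he; rewrite ?addn0.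
have ej : j = 7 + L by lia.
have i36 : 3 <= i < 7 by move: hij; rewrite /vega_rel !ifN //; lia.
rewrite (nth_ext _ hs); last by lia.
rewrite nth_ladder; last by lia.
have -> : i < 7 by lia.
by rewrite nth_cat hs ej ltnn subnn; apply: hy.
Qed.

(** A new front vertex shifts all indices by one and hence their residues mod 3. The hexagon is
    relabelled to match, opposite pairs staying opposite; x is fixed. *)
Definition rot_code i := if i < 3 then (i + 2) %% 3 else if i < 6 then (i + 2) %% 3 + 3 else i.

Lemma ladder_cons E L h s w : ladder E L h s ->
  E (h 2) w -> E (h 5) w -> (forall j, j < L -> j %% 3 = 0 -> E w (s j)) ->
  symmetric E ->
  ladder E L.+1 (fun i => h (rot_code i)) (fun j => if j is j'.+1 then s j' else w).
Proof.
move=> [h1 h2 h3] w2 w5 hw sym; split.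
- have hall : all (fun p => ((rot_code p.1, rot_code p.2) \in core_edges) ||
    ((rot_code p.2, rot_code p.1) \in core_edges)) core_edges by [].
  by move=> p /(allP hall)/orP[/h1//|/h1]; rewrite sym.
- move=> i [hi _ e|j hi hj e].
    by have [->|->] : i = 0 \/ i = 3 by lia.
  apply: h2 => //.
    by rewrite /rot_code hi; case: ifP; lia.
  by rewrite /rot_code hi; case: ifP; lia.
- move=> [|i] [|j] //= hij hj e; last by apply: h3.
  by apply: hw => //; lia.
Qed.

Lemma ladder_le E L L' h s : L' <= L -> ladder E L h s -> ladder E L' h s.
Proof.
move=> hL [h1 h2 h3]; split=> // i j hi hj; [apply: h2|apply: h3] => //; lia.
Qed.

(** * The linear order around a longest ladder *)

Section Order.
Variables (E : rel nat) (GE : dense_graph E).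
Variables (L : nat) (h s : nat -> nat).
Hypothesis L7 : 7 <= L.
Hypothesis hl : ladder E L h s.
Hypothesis maxL : forall h' s', ~ ladder E L.+1 h' s'.

(** The vertex z is of class c: like the terms s_j with j = c mod 3, it sees the two opposite
    hexagon vertices with index c mod 3. *)
Definition cl c z := E z (h (c %% 3)) && E z (h (c %% 3 + 3)).
(* A vertex z of class X behaves as if it were inserted in the sequence; [bef X j z]
   says that s_j sees z in the way it would see a later vertex of class X. *)
Definition bef X j z := E (s j) z == ((X + 2 * j) %% 3 == 1).

Let sym : symmetric E. Proof. exact: dg_sym GE. Qed.
Let tri x y z : E x y -> E y z -> ~~ E x z. Proof. exact: (dg_tri GE). Qed.

(* [lia] becomes very slow when hypotheses on the graph are in the context. *)
Ltac mlia := repeat match goal with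
  | H : context [E] |- _ => clear H
  | H : context [cl] |- _ => clear H
  | H : context [bef] |- _ => clear H
  end; lia.

Definition base7 := mkseq h 7 ++ mkseq s 7.

Let hb : hom E 14 (vega_edges 7 false) base7.
Proof. exact: ladder_hom (ladder_le L7 hl). Qed.

Let nth_base i : i < 7 -> nth 0 base7 i = h i.
Proof. by move=> hi; rewrite nth_ladder ?hi //; mlia. Qed.

Lemma cl_seq j : j < L -> cl j (s j).
Proof.
have [_ h2 _] := hl => hj.
have := ltn_pmod j (isT : 0 < 3) => h3.
by rewrite /cl !(sym (s j)) !h2 //; mlia.
Qed.

Lemma cl_mod c d z : c %% 3 = d %% 3 -> cl c z = cl d z.
Proof. by rewrite /cl => ->. Qed.

Lemma cl_same c p q : cl c p -> cl c q -> ~~ E p q.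
Proof. by move=> /andP[p1 _] /andP[q1 _]; rewrite sym in q1; apply: tri p1 q1. Qed.

Lemma transversal c p q r : cl c p -> cl c.+1 q -> cl c.+2 r -> [|| E p q, E p r | E q r].
Proof.
move=> hp hq hr; apply: contraT; rewrite !negb_or => /and3P[pq pr qr]; exfalso.
have nt := no_transversal GE hb; rewrite !nth_base // in nt.
have [e|[e|e]] : c %% 3 = 0 \/ c %% 3 = 1 \/ c %% 3 = 2 by mlia.
- move: hp hq hr; rewrite /cl.
  have -> : c.+1 %% 3 = 1 by mlia.
  have -> : c.+2 %% 3 = 2 by mlia.
  rewrite e => /andP[? ?] /andP[? ?] /andP[? ?]; exact: (nt p q r).
- move: hp hq hr; rewrite /cl.
  have -> : c.+1 %% 3 = 2 by mlia.
  have -> : c.+2 %% 3 = 0 by mlia.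
  rewrite e => /andP[? ?] /andP[? ?] /andP[? ?].
  by apply: (nt r p q) => //; rewrite sym.
- move: hp hq hr; rewrite /cl.
  have -> : c.+1 %% 3 = 0 by mlia.
  have -> : c.+2 %% 3 = 1 by mlia.
  rewrite e => /andP[? ?] /andP[? ?] /andP[? ?].
  by apply: (nt q r p) => //; rewrite sym.
Qed.

Lemma cl_hex c z i : cl c z -> i < 6 -> E z (h i) = (i %% 3 == c %% 3).
Proof.
have [h1 _ _] := hl => /andP[z1 z2] hi; apply/idP/eqP => [zi|e]; last first.
  by have [->|->] : i = c %% 3 \/ i = c %% 3 + 3 by mlia.
have hall : all (fun i => all (fun c => [|| i %% 3 == c, (c, i) \in core_edges, (i, c) \in core_edges,
   (c + 3, i) \in core_edges | (i, c + 3) \in core_edges]) (iota 0 3)) (iota 0 6) by [].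
have hi' : i \in iota 0 6 by rewrite mem_iota.
have hc' : c %% 3 \in iota 0 3 by rewrite mem_iota ltn_pmod.
have := allP (allP hall i hi') _ hc'; case/or4P => [/eqP//|/h1 /= e|/h1 /= e|/orP[]/h1 /= e].
- by have := tri z1 e; rewrite zi.
- by rewrite sym in e; have := tri z1 e; rewrite zi.
- by have := tri z2 e; rewrite zi.
- by rewrite sym in e; have := tri z2 e; rewrite zi.
Qed.

(** Take a common neighbour t. It cannot see hexagon vertices of the classes of p and q, whereas by
    [cases7] a vertex that belongs to no class sees hexagon vertices of two classes. So t has a
    class, and only the third remains. *)
Lemma third_class c p q : cl c p -> cl c.+1 q -> ~~ E p q ->
  exists t, [/\ cl c.+2 t, E t p & E t q].
Proof.
move=> hp hq npq; have [t pt tq] := dg_com GE npq.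
exists t; split; rewrite // 1?sym //.
rewrite sym in pt.
have np i : i < 6 -> (i %% 3 == c %% 3) || (i %% 3 == c.+1 %% 3) -> ~~ E t (h i).
  move=> hi /orP[e|e].
    by apply: tri pt _; rewrite (cl_hex hp).
  by apply: tri tq _; rewrite (cl_hex hq).
have nb i : i < 7 -> (i \in trace E 14 base7 t) = E t (h i).
  by move=> hi; rewrite mem_trace nth_base // (leq_trans hi).
have two : forall l, trace E 14 base7 t = l ->
    has (fun i => has (fun j => [&& i %% 3 != j %% 3, i \in l & j \in l]) (iota 0 6)) (iota 0 6) ->
    False.
  move=> _ <- /hasP[i hi /hasP[j hj /and3P[ij]]].
  rewrite mem_iota add0n /= in hi; rewrite mem_iota add0n /= in hj.
  rewrite !nb; [|mlia|mlia] => ti tj.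
  have := np i hi; have := np j hj; rewrite ti tj; mlia.
case: (cases7 GE hb t) => [[i hi e]|e|[d hd e]].
- exfalso; apply: (two _ e) => {e}.
  have hall : all (fun k => has (fun i => has (fun j => [&& i %% 3 != j %% 3,
    i \in adjl 14 (vega_edges 7 false) k & j \in adjl 14 (vega_edges 7 false) k]) (iota 0 6)) (iota 0 6)) (iota 0 7).
    by vm_compute.
  by apply: (allP hall); rewrite mem_iota.
- by exfalso; apply: (two _ e).
have hd' i : i < 6 -> E t (h i) = (i %% 3 == d).
  by move=> hi; rewrite -nth_base ?e ?hi //; mlia.
have ed : c.+2 %% 3 = d.
  have := np (c %% 3); have := np (c.+1 %% 3); rewrite !hd'; mlia.
by rewrite /cl ed !hd' ?modnDr; mlia.
Qed.

Lemma seq_adj i j : i < j -> j < L -> E (s i) (s j) = ((j - i) %% 3 == 1).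
Proof.
have [_ _ h3] := hl => ij jL; apply/idP/eqP => [e|]; last exact: h3.
have [//|[d|d]] : (j - i) %% 3 = 1 \/ (j - i) %% 3 = 0 \/ (j - i) %% 3 = 2 by mlia.
  have cj : cl i (s j) by rewrite (@cl_mod i j) ?cl_seq //; mlia.
  by have := cl_same (cl_seq (ltn_trans ij jL)) cj; rewrite e.
have e1 : E (s i) (s i.+1) by apply: h3; mlia.
have e2 : E (s i.+1) (s j) by apply: h3; mlia.
by have := tri e1 e2; rewrite e.
Qed.

(** The three classes are distinct. If j = i + 1 mod 3, then s_i sees s_j, so z, which sees s_j,
    misses s_i. If j = i + 2 mod 3, then s_j misses both s_i and z, and [transversal] makes s_i see
    z. *)
Lemma bef_step X i j z : cl X z -> i < j -> j < L ->
  i %% 3 != j %% 3 -> i %% 3 != X %% 3 -> j %% 3 != X %% 3 ->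
  bef X j z -> bef X i z.
Proof.
move=> hz ij jL nij niX njX; have iL : i < L by mlia.
have ci := cl_seq iL; have cj := cl_seq jL; rewrite /bef.
have [e|e] : j %% 3 = i.+1 %% 3 \/ j %% 3 = i.+2 %% 3 by mlia.
  have -> : ((X + 2 * j) %% 3 == 1) = true by mlia.
  have -> : ((X + 2 * i) %% 3 == 1) = false by mlia.
  move=> /eqP jz; apply/eqP/negbTE; apply: tri jz.
  by rewrite seq_adj //; mlia.
have -> : ((X + 2 * j) %% 3 == 1) = false by mlia.
have -> : ((X + 2 * i) %% 3 == 1) = true by mlia.
move=> /eqP jz; apply/eqP.
have cz : cl i.+1 z by rewrite -(@cl_mod X) //; mlia.
have cj' : cl i.+2 (s j) by rewrite -(@cl_mod j) //; mlia.
have := transversal ci cz cj'; rewrite seq_adj // (sym z) jz.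
have -> : ((j - i) %% 3 == 1) = false by mlia.
by rewrite !orbF.
Qed.

Lemma bef_mono X i j z : cl X z -> i <= j -> j < L ->
  i %% 3 != X %% 3 -> j %% 3 != X %% 3 -> bef X j z -> bef X i z.
Proof.
move=> hz ij jL niX njX bj.
have [->//|ij'] : i = j \/ i < j by mlia.
have [e|ne] := eqVneq (i %% 3) (j %% 3); last exact: (@bef_step X i j z hz ij' jL ne niX njX bj).
(* For i = j mod 3, pass through the next index m after i whose residue is neither that of i nor
   that of X; it lies before i + 3, hence before j. *)
pose m := if i.+1 %% 3 == X %% 3 then i.+2 else i.+1.
have [m1 m2 m3 m4] : [/\ i < m, m < j, m %% 3 != i %% 3 & m %% 3 != X %% 3].
  by rewrite /m; case: eqP; split; mlia.
have mj : m %% 3 != j %% 3 by rewrite -e.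
have bm : bef X m z := @bef_step X m j z hz m2 jL mj m4 njX bj.
by apply: (@bef_step X i m z) => //; [mlia|rewrite eq_sym].
Qed.

(** By monotonicity, t would see all s_j with 3 dividing j, and could precede s_0 in a longer
    ladder. *)
Lemma no_front t : cl 2 t -> ~~ E t (s 0).
Proof.
move=> ct; apply/negP => t0.
have /andP[t2 t5] : E t (h 2) && E t (h 5) := ct.
apply: maxL (ladder_cons hl (w := t) _ _ _ sym) => [||j jL j0]; rewrite 1?sym //.
have : ~~ bef 2 j t.
  apply: contraL t0 => bj.
  have /eqP : bef 2 0 t by apply: (@bef_mono 2 0 j) => //; mlia.
  by rewrite sym => ->.
rewrite /bef sym.
have -> : ((2 + 2 * j) %% 3 == 1) = false by mlia.
by case: (E t (s j)).
Qed.

(** By monotonicity, t would relate to every s_i as the term with index L should, and could be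
    appended. *)
Lemma no_end t : cl L t -> ~~ E (s L.-1) t.
Proof.
move=> ct; apply/negP => t0; have [h1 h2 h3] := hl.
apply: (maxL (h' := h) (s' := fun j => if j == L then t else s j)); split=> //.
  move=> i j hi hj e; case: eqP => [ej|nj]; last by apply: h2 => //; mlia.
  by rewrite sym (cl_hex ct) // e ej.
move=> i j ij hj e; have -> : (i == L) = false by mlia.
case: eqP => [ej|nj]; last by apply: h3 => //; mlia.
have : bef L i t.
  apply: (@bef_mono L i L.-1) => //; try mlia.
  by rewrite /bef t0; mlia.
by rewrite /bef => /eqP->; mlia.
Qed.

(** The vertices y1, z, y2 have the classes p+1, p+2, p+3, so they fit between s_p and s_(p+1) and
    shift later indices by three, which keeps residues. The result has L + 3 terms, of which the
    first L + 1 already contradict maximality. *)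
Lemma no_insertion p y1 z y2 : p.+1 < L -> cl p.+1 y1 -> cl p.+2 z -> cl p y2 ->
  E (s p) y1 -> E y1 z -> E z y2 -> E y2 (s p.+1) -> False.
Proof.
move=> pL c1 cz c2 e1 e2 e3 e4; have [h1 h2 h3] := hl.
have pL' : p < L by mlia.
have y12 : ~~ E y1 y2 := tri e2 e3.
have c2' : cl p.+3 y2 by rewrite -(@cl_mod p) //; mlia.
have left1 i : i <= p -> (p.+1 - i) %% 3 = 1 -> E (s i) y1.
  move=> ip ei; have : bef p.+1 i y1.
    by apply: (@bef_mono p.+1 i p) => //; try mlia; rewrite /bef e1; mlia.
  by rewrite /bef => /eqP->; mlia.
have leftz i : i <= p -> (p.+2 - i) %% 3 = 1 -> E (s i) z.
  move=> ip ei; have : bef p.+2 i z.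
    apply: (@bef_mono p.+2 i p) => //; try mlia.
    by rewrite /bef (negbTE (tri e1 e2)); mlia.
  by rewrite /bef => /eqP->; mlia.
(* Monotonicity says nothing at s_p, which has the class of y2, so it starts from s_(p-1): that term
   and y2 both miss y1, and [transversal] makes them adjacent. At s_(p+2), [right1] argues
   symmetrically. *)
have left2 i : i <= p -> (p.+3 - i) %% 3 = 1 -> E (s i) y2.
  move=> ip ei; have : bef p i y2.
    apply: (@bef_mono p i p.-1) => //; try mlia.
    have e0 : E (s p.-1) (s p) by rewrite seq_adj; mlia.
    have cp : cl p.-1 (s p.-1) by apply: cl_seq; mlia.
    have c1' : cl p.-1.+2 y1 by rewrite -(@cl_mod p.+1) //; mlia.
    have c2'' : cl p.-1.+1 y2 by rewrite -(@cl_mod p) //; mlia.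
    have := transversal cp c2'' c1'; rewrite (negbTE (tri e0 e1)) (sym y2) (negbTE y12) !orbF.
    by rewrite /bef => ->; mlia.
  by rewrite /bef => /eqP->; mlia.
have rightz j : p < j -> j < L -> (j.+3 - p.+2) %% 3 = 1 -> E z (s j).
  move=> pj jL ej; have : ~~ bef p.+2 j z.
    have : ~~ bef p.+2 p.+1 z by rewrite /bef sym (negbTE (tri e3 e4)); mlia.
    by apply: contra => bj; apply: (@bef_mono p.+2 p.+1 j) => //; mlia.
  rewrite /bef sym; have -> : ((p.+2 + 2 * j) %% 3 == 1) = false by mlia.
  by case: (E z _).
have right2 j : p < j -> j < L -> (j.+3 - p.+3) %% 3 = 1 -> E y2 (s j).
  move=> pj jL ej; have : ~~ bef p j y2.
    have : ~~ bef p p.+1 y2 by rewrite /bef sym e4; mlia.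
    by apply: contra => bj; apply: (@bef_mono p p.+1 j) => //; mlia.
  rewrite /bef sym; have -> : ((p + 2 * j) %% 3 == 1) = false by mlia.
  by case: (E y2 _).
have right1 j : p < j -> j < L -> (j.+3 - p.+1) %% 3 = 1 -> E y1 (s j).
  move=> pj jL ej; have p2L : p.+2 < L by mlia.
  have : ~~ bef p.+1 j y1.
    have : ~~ bef p.+1 p.+2 y1.
      have e5 : E (s p.+1) (s p.+2) by rewrite seq_adj; mlia.
      have cs : cl p.+2 (s p.+2) by apply: cl_seq.
      have := transversal c1 cs c2'.
      rewrite (negbTE y12) (sym (s p.+2)) (negbTE (tri e4 e5)) !orbF.
      by rewrite /bef sym => ->; mlia.
    by apply: contra => bj; apply: (@bef_mono p.+1 p.+2 j) => //; mlia.
  rewrite /bef sym; have -> : ((p.+1 + 2 * j) %% 3 == 1) = false by mlia.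
  by case: (E y1 _).
pose t j := if j <= p then s j else if j == p.+1 then y1 else
  if j == p.+2 then z else if j == p.+3 then y2 else s (j - 3).
have tP j : (j <= p /\ t j = s j) \/ (j = p.+1 /\ t j = y1) \/ (j = p.+2 /\ t j = z) \/
   (j = p.+3 /\ t j = y2) \/ (p.+3 < j /\ t j = s (j - 3)).
  rewrite /t; have [jp|jp] := leqP j p; first by left.
  case: eqP => [?|n1]; first by (right; left).
  have [?|n2] := eqVneq j p.+2; first by (do 2!right; left).
  have [?|n3] := eqVneq j p.+3; first by (do 3!right; left).
  by (do 4!right; split=> //; mlia).
apply: (maxL (h' := h) (s' := t)); split=> //.
  move=> i j hi hj e.
  case: (tP j) => [|[|[|[|]]]] [hj' ->].
  - by apply: h2; mlia.
  - by rewrite sym (cl_hex c1) // e hj'.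
  - by rewrite sym (cl_hex cz) // e hj'.
  - by rewrite sym (cl_hex c2') // e hj'.
  - by apply: h2; mlia.
move=> i j ij hj e.
case: (tP j) => [|[|[|[|]]]] [hj' ->]; case: (tP i) => [|[|[|[|]]]] [hi' ->]; try mlia.
- by apply: h3; mlia.
- by apply: left1; mlia.
- by apply: leftz; mlia.
- by subst; exact: e2.
- by apply: left2; mlia.
- by subst; exact: e3.
- by apply: h3; mlia.
- by apply: right1; mlia.
- by apply: rightz; mlia.
- by apply: right2; mlia.
- by apply: h3; mlia.
Qed.

(** The order places z just before s_q, where q is the first index not of class X at which [bef]
    fails, or L. If q-1 is of class X, then s_(q-1) is the twin. Otherwise there is room at the
    front, at the end or between s_(q-1) and s_q, and the ladder could be prolonged. *)
Lemma seq_twin X z : cl X z -> exists2 i, i < L &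
  i %% 3 = X %% 3 /\ forall j, j < L -> E z (s j) = E (s i) (s j).
Proof.
move=> cz.
pose P q := (q == L) || (q %% 3 != X %% 3) && ~~ bef X q z.
have exP : exists q, P q by exists L; rewrite /P eqxx.
case: (ex_minnP exP) => q Pq minq.
have qL : q <= L by apply: minq; rewrite /P eqxx.
have before j : j < q -> j %% 3 != X %% 3 -> bef X j z.
  move=> jq nj; apply: contraT => bj.
  by have := minq j; rewrite /P nj bj orbT => /(_ isT); mlia.
have after j : q <= j -> j < L -> j %% 3 != X %% 3 -> ~~ bef X j z.
  move=> qj jL nj; case/orP: Pq => [/eqP|/andP[nq]]; first mlia.
  by apply: contra => bj; apply: (@bef_mono X q j).
have clX i : i %% 3 = X %% 3 -> cl i z by move=> e; rewrite (@cl_mod i X).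
have [[q0 e]|nq1] : (0 < q /\ q.-1 %% 3 = X %% 3) \/ (0 < q -> q.-1 %% 3 != X %% 3).
  have [e|ne] := eqVneq (q.-1 %% 3) (X %% 3); last by right.
  by case: (posnP q) => q0; [right; mlia|left].
  exists q.-1; first mlia.
  split=> // j jL.
  have [ej|nj] := eqVneq (j %% 3) (X %% 3).
    rewrite (negbTE (cl_same (clX j ej) (cl_seq jL))); apply/esym/negbTE.
    have := cl_seq jL; rewrite (@cl_mod j q.-1); last by rewrite e.
    by apply: cl_same; apply: cl_seq; mlia.
  have [jq|qj] := ltnP j q.
    have := before j jq nj; rewrite /bef => /eqP; rewrite sym => ->.
    have jq1 : j < q.-1.
      have : j <> q.-1 by move=> ej; rewrite ej e eqxx in nj.
      mlia.
    by rewrite sym seq_adj //; mlia.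
  have := after j qj jL nj; rewrite /bef sym seq_adj //; [|mlia].
  by case: (E z (s j)); mlia.
exfalso.
(* Here X is 1 or 2. In class 2, z itself could precede s_0; in class 1, a vertex of class 2 from
   [third_class] could. *)
have [q0|q0] := posnP q.
  have X0 : X %% 3 != 0.
    case/orP: Pq => [|/andP[]]; first by rewrite q0; mlia.
    by rewrite q0 eq_sym.
  have L0 : 0 < L by mlia.
  have := after 0; rewrite q0 eq_sym => /(_ isT L0 X0); rewrite /bef.
  have c0 : cl 0 (s 0) by apply: cl_seq.
  have [e|e] : X %% 3 = 1 \/ X %% 3 = 2 by mlia.
    have -> : ((X + 2 * 0) %% 3 == 1) = true by mlia.
    rewrite eqb_id => n0.
    have c1 : cl 1 z by rewrite (@cl_mod 1 X) // e.
    have [t [ct t0 tz]] := third_class c0 c1 n0.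
    by have := no_front ct; rewrite t0.
  have -> : ((X + 2 * 0) %% 3 == 1) = false by mlia.
  have c2 : cl 2 z by rewrite (@cl_mod 2 X) // e.
  by have := no_front c2; rewrite sym; case: (E _ _).
have nq := nq1 q0; have bq : bef X q.-1 z by apply: before => //; mlia.
have cq : cl q.-1 (s q.-1) by apply: cl_seq; mlia.
(* At the end, either z or a vertex of class L from [third_class] could be appended. *)
have [eqL|neL] := eqVneq q L.
  rewrite eqL in bq nq cq.
  have [e|e] : X %% 3 = L %% 3 \/ X %% 3 = L.+1 %% 3 by mlia.
    have cL : cl L z by rewrite (@cl_mod L X).
    have /negP := no_end cL; apply; move: bq; rewrite /bef => /eqP->; mlia.
  have c1 : cl L.-1.+2 z by rewrite (@cl_mod _ X) //; mlia.
  have c0 : cl L.-1.+2.+1 (s L.-1) by rewrite (@cl_mod _ L.-1) //; mlia.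
  have n0 : ~~ E z (s L.-1) by move: bq; rewrite /bef sym => /eqP->; mlia.
  have [t [ct tz t0]] := third_class c1 c0 n0.
  have ct' : cl L t by rewrite (@cl_mod L L.-1.+4) //; mlia.
  by have := no_end ct'; rewrite sym t0.
have qL' : q < L by mlia.
have [nqX nb] : q %% 3 != X %% 3 /\ ~~ bef X q z.
  by case/orP: Pq => [/eqP|/andP[]//]; mlia.
have [p ep] : exists p, q = p.+1 by exists q.-1; mlia.
subst q; rewrite /= in bq nq cq.
have eX : X %% 3 = p.+2 %% 3 by mlia.
have cz2 : cl p.+2 z by rewrite (@cl_mod _ X).
have np : ~~ E (s p) z by move: bq; rewrite /bef => /eqP->; mlia.
have np1 : ~~ E (s p.+1) z.
  move: nb; rewrite /bef; have -> : ((X + 2 * p.+1) %% 3 == 1) = true by mlia.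
  by case: (E _ _).
have cq' : cl p.+2.+1 (s p) by rewrite (@cl_mod _ p) //; mlia.
(* Inside, z is two classes after s_p. The missing neighbours of z on both sides come from
   [third_class], applied to z with s_p and to z with s_(p+1). *)
have [y1 [c1 y1z y1p]] : exists t, [/\ cl p.+2.+2 t, E t z & E t (s p)].
  by apply: third_class => //; rewrite sym.
have cs1 : cl p.+1 (s p.+1) by apply: cl_seq.
have [y2 [c2 y2s y2z]] := third_class cs1 cz2 np1.
by apply: (@no_insertion p y1 z y2) => //; rewrite sym.
Qed.

End Order.

(** * Adjacency of codes in the Vega pattern *)

Lemma adjl_vega L (y : bool) i j : i < 7 + L + y -> j < 7 + L + y ->
  (j \in adjl (7 + L + y) (vega_edges L y) i) = vega_rel L i j || vega_rel L j i.
Proof. exact: mem_adjl_edges_of. Qed.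

Lemma adjl_vega7 i j : i < 14 -> j < 14 ->
  (j \in adjl 14 (vega_edges 7 false) i) = vega_rel 7 i j || vega_rel 7 j i.
Proof. exact: mem_adjl_edges_of. Qed.

Lemma vega_rel_core L L' i j : j < 7 -> vega_rel L i j = vega_rel L' i j.
Proof. by rewrite /vega_rel => ->. Qed.

Lemma vega_rel_seq L i j : i < 7 -> j < L ->
  vega_rel L i (7 + j) = (i < 6) && (i %% 3 == j %% 3).
Proof.
move=> hi hj; rewrite /vega_rel; have -> : (7 + j < 7) = false by lia.
by rewrite ltn_add2l hj hi addKn.
Qed.

Lemma vega_rel_seq_core L i j : i < 7 -> vega_rel L (7 + j) i = false.
Proof.
move=> hi; rewrite /vega_rel hi.
apply/negP; case/orP => [/(allP (isT : all (fun p => p.1 < 7) hex_edges))/=|/andP[]]; lia.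
Qed.

Lemma vega_rel_seqs L i j : j < L ->
  vega_rel L (7 + i) (7 + j) = (i < j) && ((j - i) %% 3 == 1).
Proof.
move=> hj; rewrite /vega_rel; have -> : (7 + j < 7) = false by lia.
rewrite ltn_add2l hj; have -> : (7 + i < 7) = false by lia.
by rewrite ltn_add2l subnDl.
Qed.

Lemma vega_rel_y L i : vega_rel L i (7 + L) = (3 <= i < 7).
Proof.
rewrite /vega_rel; have -> : (7 + L < 7) = false by lia.
by rewrite ltnn.
Qed.

Lemma vega_rel_from_y L i : i <= 7 + L -> vega_rel L (7 + L) i = false.
Proof.
move=> hi; have [i7|i7] := ltnP i 7; first exact: vega_rel_seq_core.
have -> : i = 7 + (i - 7) by lia.
have [ij|ij] := ltnP (i - 7) L; first by rewrite vega_rel_seqs //; lia.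
by have -> : i - 7 = L by [lia]; rewrite vega_rel_y; lia.
Qed.

(** * Full traces for long Vega patterns *)

Section Full.
Variables (E : rel nat) (GE : dense_graph E) (L : nat) (L7 : 7 <= L).
Hypothesis om : omits E [:: vtarget L.+1 false].

Let sym : symmetric E. Proof. exact: dg_sym GE. Qed.
Let tri x y z : E x y -> E y z -> ~~ E x z. Proof. exact: (dg_tri GE). Qed.

Ltac mlia := repeat match goal with
  | H : context [E] |- _ => clear H
  | H : context [adjl] |- _ => clear H
  | H : context [iota] |- _ => clear H
  end; lia.

Lemma max_ladder h s : ~ ladder E L.+1 h s.
Proof. by move/ladder_hom; apply: (om (mem_head _ _)). Qed.

(** If 3 divides L, the six chosen vertices contain a 6-cycle. A vertex seeing more than a third of
    them sees one of its two independent triples, and these are the neighbours that [no_front] and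
    [no_end] forbid. *)
Lemma ladder_mod3 h s : ladder E L h s -> L %% 3 != 0.
Proof.
move=> hl; apply/eqP => L0.
pose g := [:: h 0; h 2; h 3; h 5; s 0; s L.-1].
have [||t] := dg_heavy GE (g := g) (ws := nseq 6 1) => //.
rewrite /wdeg /= !mul1n !addn0.
have nf := no_front GE L7 hl max_ladder (t := t).
have ne := no_end GE L7 hl max_ladder (t := t).
have [h1 h2 _] := hl.
have n1 : E t (h 0) -> ~~ E t (h 5) by move/tri; apply; apply: (h1 (0, 5)).
have n2 : E t (h 2) -> ~~ E t (h 3) by move/tri; apply; apply: (h1 (2, 3)).
have n3 : E t (h 0) -> ~~ E t (s 0) by move/tri; apply; apply: h2 => //; mlia.
have n4 : E t (h 3) -> ~~ E t (s 0) by move/tri; apply; apply: h2 => //; mlia.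
have n5 : E t (h 2) -> ~~ E t (s L.-1) by move/tri; apply; apply: h2; mlia.
have n6 : E t (h 5) -> ~~ E t (s L.-1) by move/tri; apply; apply: h2; mlia.
rewrite sym /cl L0 in ne; move: nf ne n1 n2 n3 n4 n5 n6; rewrite /cl /=.
by case: (E t (h 0)); case: (E t (h 2)); case: (E t (h 3)); case: (E t (h 5));
   case: (E t (s 0)); case: (E t (s L.-1)) => //= a b c d e f k l; try
   (by have := a isT); try (by have := b isT); try (by have := c isT); try (by have := d isT);
   try (by have := e isT); try (by have := f isT); try (by have := k isT); try (by have := l isT).
Qed.

End Full.

Section Full.
Variables (E : rel nat) (GE : dense_graph E) (L : nat) (L7 : 7 <= L).
Hypothesis om : omits E [:: vtarget L.+1 false].

Let sym : symmetric E. Proof. exact: dg_sym GE. Qed.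
Let tri x y z : E x y -> E y z -> ~~ E x z. Proof. exact: (dg_tri GE). Qed.
Let max_ladder h s : ~ ladder E L.+1 h s. Proof. exact: max_ladder om h s. Qed.

Variable y : bool.
Hypothesis omy : ~~ y -> omits E [:: vtarget L true].

Ltac mlia := repeat match goal with
  | H : context [E] |- _ => clear H
  | H : context [adjl] |- _ => clear H
  | H : context [iota] |- _ => clear H
  end; lia.

(** The first seven terms give the type of z by [cases7]. A core type extends along the sequence by
    [hex_like_class] and triangle-freeness, the type of y is realised by y or would supply one, and
    a vertex with a class has a twin by [seq_twin]. *)
Lemma vega_full_traces : full_traces E (7 + L + y) (vega_edges L y).
Proof.
move=> g z hg; have hl := hom_ladder hg.
set h := nth 0 g in hl; set s := fun j => nth 0 g (7 + j) in hl.
have [h1 h2 h3] := hl.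
have hb : hom E 14 (vega_edges 7 false) (base7 h s) := ladder_hom (ladder_le L7 hl).
have nb i : i < 7 -> nth 0 (base7 h s) i = h i.
  by move=> hi; rewrite nth_ladder ?hi //; mlia.
set n := 7 + L + y; set el := vega_edges L y.
have eqtr i : i < n -> (forall k, k < n -> E z (h k) = vega_rel L i k || vega_rel L k i) ->
    exists2 i, i < n & trace E n g z = adjl n el i.
  move=> hi hz; exists i => //; apply: eq_in_filter => k; rewrite mem_iota add0n /= => hk.
  by rewrite hz // !mem_edges_of hi hk.
have split_k (P : nat -> Prop) : (forall k, k < 7 -> P k) -> (forall j, j < L -> P (7 + j)) ->
    (y -> P (7 + L)) -> forall k, k < n -> P k.
  move=> p1 p2 p3 k hk; have [k7|k7] := ltnP k 7; first exact: p1.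
  have [kL|kL] := ltnP (k - 7) L; first by have := p2 _ kL; rewrite subnKC.
  have [y1 e] : y /\ k = 7 + L by move: hk kL; rewrite /n; case: (y) => /=; mlia.
  by rewrite e; apply: p3.
have cls j : j < L -> cl E h j (s j) by move=> hj; apply: (cl_seq GE L7 hl).
have via i j : i < 6 -> j < L -> i %% 3 = j %% 3 -> E z (h i) -> ~~ E z (s j).
  by move=> hi hj e zi; apply: tri zi _; apply: h2.
have traceb i : i < 7 -> (i \in trace E 14 (base7 h s) z) = E z (h i).
  by move=> hi; rewrite mem_trace nb // (leq_trans hi).
have hy i : y -> 3 <= i < 7 -> E (h i) (h (7 + L)).
  by move=> y1 hi; rewrite /h; apply: (hom_ladder_y _ hi); move: hg; rewrite y1.
have [[i hi e]|e|[c hc e]] := cases7 GE hb z.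
- have zk k : k < 7 -> E z (h k) = vega_rel L i k || vega_rel L k i.
    move=> hk; rewrite -traceb // e adjl_vega7; [|mlia|mlia].
    by rewrite (vega_rel_core 7 L) // (vega_rel_core 7 L k).
  apply: (eqtr i); first by rewrite /n; mlia.
  apply: split_k => // [j hj|y1].
    rewrite vega_rel_seq // (vega_rel_seq_core _ _ hi) orbF.
    case: (boolP ((i < 6) && (i %% 3 == j %% 3))) => [/andP[i6 /eqP ij]|nij].
      have /andP[c1 c2] := cls j hj.
      have m3 := ltn_pmod j (isT : 0 < 3).
      by apply: (hex_like_class GE hb i6 e); rewrite nb ?ij //; mlia.
    apply/negbTE.
    have hall : all (fun i => all (fun c => [|| (i < 6) && (i %% 3 == c), c \in adjl 14 (vega_edges 7 false) i
      | c + 3 \in adjl 14 (vega_edges 7 false) i]) (iota 0 3)) (iota 0 7) by vm_compute.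
    have hi' : i \in iota 0 7 by rewrite mem_iota.
    have hj' : j %% 3 \in iota 0 3 by rewrite mem_iota ltn_pmod.
    have := allP (allP hall i hi') _ hj'; rewrite (negbTE nij) -e /=.
    have m3 := ltn_pmod j (isT : 0 < 3).
    rewrite !traceb; [|mlia|mlia].
    by case/orP => hz; apply: (via _ _ _ hj _ hz); mlia.
  rewrite vega_rel_y vega_rel_from_y ?orbF; last by mlia.
  case: (boolP (3 <= i < 7)) => i37.
    have ey : trace E 14 (base7 h s) (h (7 + L)) = [:: 3; 4; 5; 6].
      have t3 k : 3 <= k < 7 -> k \in trace E 14 (base7 h s) (h (7 + L)).
        by move=> hk; rewrite mem_trace nb ?(sym _ (h k)) ?hy ?andbT //; mlia.
      have [[i' hi' e']|//|[c hc e']] := cases7 GE hb (h (7 + L)).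
        exfalso; move: (t3 3 isT) (t3 4 isT) (t3 5 isT) (t3 6 isT); rewrite e'.
        have hall : all (fun i => ~~ [&& 3 \in adjl 14 (vega_edges 7 false) i, 4 \in adjl 14 (vega_edges 7 false) i,
          5 \in adjl 14 (vega_edges 7 false) i & 6 \in adjl 14 (vega_edges 7 false) i]) (iota 0 7) by vm_compute.
        have hi2 : i' \in iota 0 7 by rewrite mem_iota.
        by have := allP hall _ hi2 => /negP h4 a b d f; apply: h4; rewrite a b d f.
      have := e' 3 isT; have := e' 4 isT; rewrite !nb // !(sym (h (7 + L))) !hy //=; mlia.
    by rewrite sym (y_like_edge GE hb ey i37).
  apply/negbTE; have i3 : i < 3 by mlia.
  have hall : all (fun i => has (fun k => k \in adjl 14 (vega_edges 7 false) i) [:: 3; 4; 5; 6]) (iota 0 3) by vm_compute.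
  have hi' : i \in iota 0 3 by rewrite mem_iota.
  have := allP hall i hi' => /hasP[k]; rewrite -e => hk.
  have k37 : 3 <= k < 7 by move: hk; rewrite !inE; mlia.
  by rewrite traceb => [zk'|]; [apply: tri zk' (hy _ y1 k37)|mlia].
- have zk k : k < 7 -> E z (h k) = (3 <= k < 7).
    by move=> hk; rewrite -traceb // e !inE; mlia.
  case: (boolP y) => [y1|ny].
    apply: (eqtr (7 + L)); first by rewrite /n y1; mlia.
    apply: split_k => [k hk|j hj|_].
    + by rewrite zk // vega_rel_y vega_rel_from_y //; mlia.
    + rewrite vega_rel_from_y; last by mlia.
      rewrite vega_rel_y; have -> : (3 <= 7 + j < 7) = false by mlia.
      have m3 := ltn_pmod j (isT : 0 < 3).
      apply/negbTE/(via (j %% 3 + 3)); [mlia|mlia|mlia|]; rewrite zk; mlia.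
    + rewrite vega_rel_y; have -> : (3 <= 7 + L < 7) = false by mlia.
      by apply/negbTE/(tri (y := h 3)); [rewrite zk|apply: hy].
  exfalso; apply: (omy ny (mem_head _ _) (g := (mkseq h 7 ++ mkseq s L) ++ [:: z])).
  apply: (ladder_hom_y hl) => k hk; rewrite sym zk; mlia.
have hzc k : k < 7 -> E z (h k) = (k < 6) && (k %% 3 == c) by move=> hk; rewrite -nb // e.
have cz : cl E h c z.
  by rewrite /cl modn_small // !hzc; [|mlia|mlia]; rewrite modnDr modn_small // eqxx !andbT; mlia.
have [i hi [ic hij]] := seq_twin GE L7 hl max_ladder cz.
apply: (eqtr (7 + i)); first by rewrite /n; mlia.
apply: split_k => [k hk|j hj|y1].
- by rewrite hzc // vega_rel_seq_core // vega_rel_seq // ic (modn_small hc).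
- rewrite -[h (7 + j)]/(s j) hij // !vega_rel_seqs //.
  have [ij|ji|->] := ltngtP i j.
  + by rewrite (seq_adj GE L7 hl) // orbF.
  + by rewrite sym (seq_adj GE L7 hl).
  + by apply/negbTE/(cl_same GE) => //; apply: cls.
rewrite vega_rel_y vega_rel_from_y; last by mlia.
have -> : (3 <= 7 + i < 7) = false by mlia.
apply/negbTE/(tri (y := h (c + 3))); last by apply: hy => //; mlia.
by rewrite hzc ?modnDr ?modn_small ?eqxx ?andbT; mlia.
Qed.

End Full.

(** * Patterns in which no neighbourhood contains another *)

Definition undominated n el := forall i k, i < n -> k < n ->
  {subset adjl n el i <= adjl n el k} -> i = k.

Lemma wf_edges_of n r : irreflexive r -> wf_edges n (edges_of n r).
Proof.
move=> ir; apply/allP => -[i j]; rewrite mem_edges_of => /and3P[-> -> /=].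
by case: eqP => // ->; rewrite ir.
Qed.

Lemma undominated_edges_of n r :
  (forall i k, i < n -> k < n -> i != k ->
    exists2 j, j < n & (r i j || r j i) && ~~ (r k j || r j k)) ->
  undominated n (edges_of n r).
Proof.
move=> h i k hi hk sub; apply/eqP; apply: contraT => ne.
have [j hj /andP[ij]] := h i k hi hk ne; rewrite -(mem_adjl_edges_of r hk hj).
by rewrite sub ?mem_adjl_edges_of.
Qed.

Lemma vega_rel_irr L : irreflexive (vega_rel L).
Proof.
move=> i; rewrite /vega_rel; case: ifP => i7; last by rewrite i7 ltnn andbF; case: ifP.
by move: i i7; do 7!case=> //.
Qed.

Lemma wf_vega L (y : bool) : wf_edges (7 + L + y) (vega_edges L y).
Proof. exact: wf_edges_of (@vega_rel_irr L). Qed.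

Lemma vega_code L (y : bool) i : i < 7 + L + y ->
  [\/ i < 7, exists2 j, j < L & i = 7 + j | y /\ i = 7 + L].
Proof.
move=> hi; have [i7|i7] := ltnP i 7; first by constructor 1.
have [iL|iL] := ltnP (i - 7) L; first by constructor 2; exists (i - 7); lia.
by constructor 3; move: hi; case: y; lia.
Qed.

Definition adj2 L i j := vega_rel L i j || vega_rel L j i.

Lemma adj2_seq L i j : i < 7 -> j < L -> adj2 L i (7 + j) = (i < 6) && (i %% 3 == j %% 3).
Proof. by move=> hi hj; rewrite /adj2 vega_rel_seq // vega_rel_seq_core // orbF. Qed.

Lemma adj2_core L i j : i < 7 -> j < 7 -> adj2 L i j = adj2 4 i j.
Proof. by move=> hi hj; rewrite /adj2 (vega_rel_core L 4) // (vega_rel_core L 4 j). Qed.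

Lemma adj2_sym L i j : adj2 L i j = adj2 L j i.
Proof. by rewrite /adj2 orbC. Qed.

Lemma adj2_y L i : i <= 7 + L -> adj2 L i (7 + L) = (3 <= i < 7).
Proof. by move=> hi; rewrite /adj2 vega_rel_y vega_rel_from_y ?orbF. Qed.

Lemma adj2_seqs L i j : i < L -> j < L -> adj2 L (7 + i) (7 + j) =
  (i < j) && ((j - i) %% 3 == 1) || (j < i) && ((i - j) %% 3 == 1).
Proof. by move=> hi hj; rewrite /adj2 !vega_rel_seqs. Qed.

Lemma adj2_four L i j : 4 <= L -> i < 7 -> j < 10 -> adj2 L i j = adj2 4 i j.
Proof.
move=> L4 hi hj; have [j7|j7] := ltnP j 7; first exact: adj2_core.
have -> : j = 7 + (j - 7) by lia.
by rewrite !adj2_seq //; lia.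
Qed.

(** Ten codes suffice as witnesses: the core and the first three terms, one for each class. This
    makes the comparison independent of L. *)
Definition core_sep (p q : pred nat) : bool := has (fun j => p j && ~~ q j) (iota 0 10).

Lemma undominated_vega L (y : bool) : 4 <= L -> undominated (7 + L + y) (vega_edges L y).
Proof.
move=> L4; apply: undominated_edges_of => i k hi hk ne.
have io a b : a < b -> a \in iota 0 b by rewrite mem_iota.
suff [j hj e] : exists2 j, j < 7 + L & adj2 L i j && ~~ adj2 L k j.
  by exists j => //; lia.
case: (vega_code hk) => [k7|[l hl ek]|[y1 ek]]; case: (vega_code hi) => [i7|[j hj ei]|[y2 ei]].
- have hall : all (fun i => all (fun k => (i != k) ==> core_sep (adj2 4 i) (adj2 4 k)) (iota 0 7)) (iota 0 7) by vm_compute.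
  have := allP (allP hall i (io _ _ i7)) _ (io _ _ k7); rewrite ne => /hasP[j]; rewrite mem_iota => hj.
  rewrite -!(adj2_four L4) //; by exists j; first lia.
- subst i; have hall : all (fun k => all (fun c => ~~ (adj2 4 k c && adj2 4 k (c + 3))) (iota 0 3)) (iota 0 7) by vm_compute.
  have m3 := ltn_pmod j (isT : 0 < 3).
  have := allP (allP hall k (io _ _ k7)) _ (io _ _ m3); rewrite negb_and -!(adj2_four L4) //; try lia.
  case/orP => nk; [exists (j %% 3)|exists (j %% 3 + 3)]; rewrite ?nk ?(adj2_sym L (7 + j)) ?adj2_seq ?andbT //; lia.
- have hall : all (fun k => core_sep (fun j => 3 <= j < 7) (adj2 4 k)) (iota 0 7) by vm_compute.
  have := allP hall k (io _ _ k7) => /hasP[j]; rewrite mem_iota => hj; rewrite -(adj2_four L4) // => e.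
  by exists j; [lia|rewrite ei adj2_sym adj2_y; [|lia]].
- subst k; have hall : all (fun i => all (fun c => core_sep (adj2 4 i) (fun j => (j < 6) && (j %% 3 == c) || (6 < j))) (iota 0 3)) (iota 0 7) by vm_compute.
  have m3 := ltn_pmod l (isT : 0 < 3).
  have := allP (allP hall i (io _ _ i7)) _ (io _ _ m3) => /hasP[j]; rewrite mem_iota => hj.
  rewrite -(adj2_four L4) // => /andP[e e']; exists j; first lia.
  by rewrite e adj2_sym adj2_seq //; lia.
- subst i k; have [e|e] := eqVneq (j %% 3) (l %% 3); last first.
    by exists (j %% 3); [lia|rewrite !(adj2_sym L _ (j %% 3)) !adj2_seq //; lia].
  have [jl|lj|ejl] := ltngtP j l; last by rewrite ejl eqxx in ne.
    by exists (7 + j.+1); [lia|rewrite !adj2_seqs //; lia].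
  by exists (7 + j.-1); [lia|rewrite !adj2_seqs //; lia].
- subst i k; exists (if l %% 3 == 0 then 4 else 3); first by case: ifP; lia.
  by case: ifP => e; rewrite (adj2_sym L (7 + L)) adj2_y ?(adj2_sym L (7 + l)) ?adj2_seq //; lia.
- subst k; have hall : all (fun i => core_sep (adj2 4 i) (fun j => 3 <= j < 7)) (iota 0 7) by vm_compute.
  have := allP hall i (io _ _ i7) => /hasP[j]; rewrite mem_iota => hj; rewrite -(adj2_four L4) // => e.
  by exists j; [lia|rewrite (adj2_sym L (7 + L)) adj2_y; [|lia]].
- subst i k; exists (j %% 3); first lia.
  by rewrite (adj2_sym L (7 + L)) adj2_y ?(adj2_sym L (7 + j)) ?adj2_seq //; lia.
- lia.
Qed.

(** * From full traces to a blow-up *)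

Section Blowup.
Variables (E : rel nat) (GE : dense_graph E).
Variables (n : nat) (el : seq (nat * nat)).
Hypothesis wfe : wf_edges n el.
Hypothesis undominated : forall i k, i < n -> k < n ->
  {subset adjl n el i <= adjl n el k} -> i = k.
Hypothesis full : full_traces E n el.

Lemma blowup_of_full g : hom E n el g ->
  exists f : nat -> nat, [/\ forall x, f x < n, forall i, i < n -> exists x, f x = i
    & forall x y, E x y = (f y \in adjl n el (f x))].
Proof.
move=> hg; have [hs he] := hg.
pose f z := index (trace E n g z) (adjs n el).
have fP z : f z < n /\ trace E n g z = adjl n el (f z).
  have [i hi e] := full z hg.
  have h : trace E n g z \in adjs n el by rewrite e map_f // mem_iota.
  have hf : f z < n by rewrite -[X in _ < X](size_adjs n el) index_mem.
  by split=> //; rewrite -nth_adjs // nth_index.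
have fE z i : i < n -> E z (nth 0 g i) = (i \in adjl n el (f z)).
  by move=> hi; have [_ <-] := fP z; rewrite mem_trace hi.
have sym x y : E x y = E y x by apply: (dg_sym GE).
have adj_sym i k : i < n -> k < n -> (i \in adjl n el k) = (k \in adjl n el i).
  by move=> hi hk; rewrite !mem_filter !mem_iota !add0n hi hk /= !andbT orbC.
exists f; split=> [x|i hi|x y]; first by have [] := fP x.
  (* The trace of the i-th vertex contains the neighbourhood of i, and without domination it can
     only be that neighbourhood. *)
  exists (nth 0 g i); have [h e] := fP (nth 0 g i).
  apply/esym/undominated => // k ki; rewrite -e mem_trace.
  by rewrite (allP (adjl_bound _ _ _) _ ki) (adjl_edge GE hg ki).
have [hx ex] := fP x; have [hy ey] := fP y.
(* Put x in the place of its twin: the trace of y on the new copy agrees with the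
   old one outside that place, so it is the same by absence of domination. *)
pose g' := set_nth 0 g (f x) x.
have hg' : hom E n el g' := set_hom GE wfe hg hx (trace_twin ex).
have [k hk ek] := full y hg'.
have agree i : i < n -> i != f x -> (i \in adjl n el k) = (i \in adjl n el (f y)).
  move=> hi ni; rewrite -ek mem_trace hi /= /g' nth_set_nth /= (negPf ni).
  exact: fE.
have -> : E x y = (f x \in adjl n el k).
  by rewrite -ek mem_trace hx /= /g' nth_set_nth /= eqxx sym.
rewrite [RHS]adj_sym //.
have sub a b : a < n -> b < n ->
    (forall i, i < n -> i != f x -> (i \in adjl n el a) = (i \in adjl n el b)) ->
    f x \in adjl n el a -> f x \in adjl n el b.
  move=> ha hb hab xa; apply: contraT => nxb.
  have /undominated e : {subset adjl n el b <= adjl n el a}.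
    move=> i ib; rewrite hab //; first exact: (allP (adjl_bound _ _ _) _ ib).
    by apply: contraNneq nxb => <-.
  by rewrite e // xa in nxb.
apply/idP/idP; by apply: sub => // i hi ni; rewrite agree.
Qed.

End Blowup.

(** * Graphs without induced hexagon *)

Definition seq_rel : rel nat := fun i j => (i < j) && ((j - i) %% 3 == 1).

(* [seq_rel] on 'I_(3 * k - 1) is the Andrasfai graph, the index 3 p + c standing
   for c k + p. *)
Definition gseq (E : rel nat) m (s : nat -> nat) :=
  forall i j, i < j -> j < m -> (j - i) %% 3 = 1 -> E (s i) (s j).

(** The separating vertex is a cyclic neighbour i - 1 or i + 1 of i. Since m = 2 mod 3, the ends 0
    and m-1 are adjacent, which handles the wrap-around. *)
Lemma undominated_gamma m : m %% 3 = 2 -> undominated m (edges_of m seq_rel).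
Proof.
move=> hm; apply: undominated_edges_of => i k hi hk ne; rewrite /seq_rel.
have [[h1 h2]|[[h1 h2]|[[h1 h2]|[h1 h2]]]] : i < k /\ (k - i) %% 3 <> 2 \/
  i < k /\ (k - i) %% 3 = 2 \/ k < i /\ (i - k) %% 3 <> 2 \/ k < i /\ (i - k) %% 3 = 2 by lia.
- by exists i.+1; lia.
- have [i0|i0] := posnP i; first by exists m.-1; lia.
  by exists i.-1; lia.
- by exists i.-1; lia.
- have [i0|i0] : i = m.-1 \/ i.+1 < m by lia.
    by exists 0; lia.
  by exists i.+1; lia.
Qed.

Section NoHexagon.
Variables (E : rel nat) (GE : dense_graph E).
Hypothesis nohex : ~ induced_hexagon E.

Let sym : symmetric E. Proof. exact: dg_sym GE. Qed.
Let tri x y z : E x y -> E y z -> ~~ E x z. Proof. exact: (dg_tri GE). Qed.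
Let com x y z : E z x -> E z y -> ~~ E x y. Proof. by rewrite sym; apply: tri. Qed.

Ltac mlia := repeat match goal with
  | H : context [E] |- _ => clear H
  end; lia.

Lemma hexagon_absurd a b c d e f : E a b -> E b c -> E c d -> E d e -> E e f -> E f a ->
  ~~ E a d -> ~~ E b e -> ~~ E c f -> False.
Proof.
(* The reordering puts opposite vertices of the cycle a, ..., f at codes i and i + 3. *)
move=> ab bc cd de ef fa ad be cf; apply: nohex; exists [:: a; e; c; d; b; f].
  split=> // p; rewrite !inE.
  by do 5?[case/orP]; move/eqP => -> //=; rewrite sym.
by move=> [|[|[|//]]] _ //=; rewrite sym.
Qed.

(* In a minimal counterexample, three of its vertices and common neighbours of
   the sets obtained by leaving out one of these form an induced hexagon. *)
Lemma common_nbr (l : seq nat) : {in l &, forall x y, ~~ E x y} -> exists z, {in l, forall x, E z x}.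
Proof.
have [n] := ubnP (size l); elim: n l => // n IH [|p [|q [|r l]]] hs ind.
- by exists 0.
- have [z zp _] := dg_com GE (ind p p (mem_head _ _) (mem_head _ _)).
  by exists z => x; rewrite inE sym => /eqP->.
- have [z zp zq] := dg_com GE (ind p q (mem_head _ _) (mem_last p [:: q])).
  by exists z => x; rewrite !inE => /orP[]/eqP->; rewrite // sym.
have sub l' : {subset l' <= [:: p, q, r & l]} -> size l' < n -> exists z, {in l', forall x, E z x}.
  by move=> h hl; apply: IH => // x y /h hx /h hy; apply: ind.
have [||u hu] := sub [:: q, r & l] => //; first by move=> x; rewrite !inE => ->; rewrite orbT.
have [||v hv] := sub [:: p, r & l] => //.
  by move=> x; rewrite !inE => /or3P[] ->; rewrite ?orbT.
have [||w hw] := sub [:: p, q & l] => //.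
  by move=> x; rewrite !inE => /or3P[] ->; rewrite ?orbT.
have [up|nup] := boolP (E u p).
  by exists u => x; rewrite inE => /orP[/eqP->//|/hu].
have [vq|nvq] := boolP (E v q).
  exists v => x; rewrite in_cons => /orP[/eqP->|]; first by apply: hv; rewrite mem_head.
  by rewrite in_cons => /orP[/eqP->//|h]; apply: hv; rewrite in_cons h orbT.
have [wr|nwr] := boolP (E w r).
  by exists w => x; rewrite !inE => /or4P[/eqP->|/eqP->|/eqP->//|h]; apply: hw; rewrite !inE ?eqxx ?h ?orbT.
exfalso; apply: (@hexagon_absurd p v r u q w); rewrite ?(sym p) ?(sym q u) ?(sym r w) //;
  try (by apply: hu; rewrite !inE eqxx ?orbT);
  try (by apply: hv; rewrite !inE eqxx ?orbT);
  try (by apply: hw; rewrite !inE eqxx ?orbT).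
- by rewrite sym; apply: hu; rewrite !inE eqxx ?orbT.
- by rewrite sym; apply: hw; rewrite !inE eqxx ?orbT.
Qed.

(** A common neighbour t of w, p1, p4 and a common neighbour u of w, p3, p0 give the induced hexagon
    w, t, p1, p2, p3, u. *)
Lemma no_isolated_pentagon w p0 p1 p2 p3 p4 : E p0 p1 -> E p1 p2 -> E p2 p3 -> E p3 p4 -> E p4 p0 ->
  ~~ E w p0 -> ~~ E w p1 -> ~~ E w p2 -> ~~ E w p3 -> ~~ E w p4 -> False.
Proof.
have irr x : ~~ E x x by apply/negP => e; have := tri e e; rewrite e.
have triple x y z : ~~ E x y -> ~~ E x z -> ~~ E y z -> exists t, [/\ E t x, E t y & E t z].
  move=> xy xz yz; have [|t ht] := @common_nbr [:: x; y; z].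
    move=> a b; rewrite !inE => /or3P[]/eqP-> /or3P[]/eqP->; rewrite // sym //.
  by exists t; split; apply: ht; rewrite !inE eqxx ?orbT.
move=> e01 e12 e23 e34 e40 n0 n1 n2 n3 n4.
have [t [tw t1 t4]] : exists t, [/\ E t w, E t p1 & E t p4].
  by apply: triple => //; apply: (com e01); rewrite sym.
have [u [uw u3 u0]] : exists t, [/\ E t w, E t p3 & E t p0].
  by apply: triple => //; apply: tri e34 e40.
apply: (@hexagon_absurd w t p1 p2 p3 u) => //; rewrite 1?sym //.
- by apply: (tri e34); rewrite sym.
- by rewrite sym; apply: (com e01); rewrite sym.
Qed.

Section Length.
Variable m : nat.
Hypothesis hm : m %% 3 = 2.
Hypothesis max : forall s, ~ gseq E (m + 3) s.

Section Trace.
Variables (s : nat -> nat) (z : nat).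
Hypothesis hs : gseq E m s.
Hypothesis hz : forall j, j < m -> E z (s j) -> j %% 3 = 1.

Lemma gseq_adj i j : i < j -> j < m -> E (s i) (s j) = ((j - i) %% 3 == 1).
Proof.
move=> ij jm; apply/idP/eqP => [e|]; last exact: hs.
have [//|[d|d]] : (j - i) %% 3 = 1 \/ (j - i) %% 3 = 0 \/ (j - i) %% 3 = 2 by mlia.
  (* With i = 0 there is no s_(i-1), but then j = 0 mod 3 while m-1 = 1 mod 3, so s_(j+1) exists. *)
  have [i0|i0] := posnP i.
    have e1 : E (s j) (s j.+1) by apply: hs; mlia.
    have e2 : E (s i) (s j.+1) by apply: hs; mlia.
    by have := tri e e1; rewrite e2.
  have e1 : E (s i.-1) (s i) by apply: hs; mlia.
  have e2 : E (s i.-1) (s j) by apply: hs; mlia.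
  by have := tri e1 e; rewrite e2.
have e1 : E (s i) (s i.+1) by apply: hs; mlia.
have e2 : E (s i.+1) (s j) by apply: hs; mlia.
by have := tri e1 e2; rewrite e.
Qed.

(** The pattern neighbours of s_i are pairwise non-adjacent, and z sees none of them, as their
    residues are not 1. A common neighbour of them and z can stand in for s_i. *)
Lemma replacement i : i < m -> i %% 3 = 1 -> exists t, E t z /\
  forall j, j < m -> (i < j) && (j %% 3 == 2) || (j < i) && (j %% 3 == 0) -> E t (s j).
Proof.
move=> im i1.
pose l := z :: [seq s j | j <- iota 0 m & (i < j) && (j %% 3 == 2) || (j < i) && (j %% 3 == 0)].
have lP x : x \in l -> x = z \/ exists j, [/\ j < m, j %% 3 != 1, E (s i) (s j) & x = s j].
  rewrite inE => /orP[/eqP|/mapP[j]]; first by left.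
  rewrite mem_filter mem_iota add0n => /andP[hj jm] ->; right; exists j; split=> //; first mlia.
  by case/orP: hj => /andP[ij /eqP e]; [|rewrite sym]; apply: hs; mlia.
have [|t ht] := @common_nbr l.
  have irr x : ~~ E x x by apply/negP => e; have := tri e e; rewrite e.
  have zj j : j < m -> j %% 3 != 1 -> ~~ E z (s j).
    by move=> jm; apply: contra => /(hz jm)->.
  move=> x y /lP[->|[j [jm j1 ij ->]]] /lP[->|[k [km k1 ik ->]]] //; first exact: zj.
    by rewrite sym zj.
  exact: com ij ik.
exists t; split=> [|j jm hj]; apply: ht; rewrite ?mem_head // inE; apply/orP; right.
by apply: map_f; rewrite mem_filter hj mem_iota.
Qed.

(** Terms of residue 1 are pairwise non-adjacent in the pattern, so all of them may be replaced at
    once. *)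
Lemma replace_ones : exists2 s', gseq E m s' &
  forall j, j < m -> (j %% 3 = 1 -> E (s' j) z) /\ (j %% 3 <> 1 -> s' j = s j).
Proof.
have [t ht] : exists t : nat -> nat, forall i, i < m -> i %% 3 = 1 -> E (t i) z /\
  forall j, j < m -> (i < j) && (j %% 3 == 2) || (j < i) && (j %% 3 == 0) -> E (t i) (s j).
  suff [t ht] : exists t : seq nat, forall i, i < m -> i %% 3 = 1 -> E (nth 0 t i) z /\
      forall j, j < m -> (i < j) && (j %% 3 == 2) || (j < i) && (j %% 3 == 0) -> E (nth 0 t i) (s j).
    by exists (nth 0 t).
  have : m <= m by []; move: {1 3}m => n; elim: n => [|n IH] hn; first by exists [::].
  have [|t ht] := IH; first exact: ltnW.
  have [u hu] : exists u, n %% 3 = 1 -> E u z /\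
      forall j, j < m -> (n < j) && (j %% 3 == 2) || (j < n) && (j %% 3 == 0) -> E u (s j).
    have [e|ne] := eqVneq (n %% 3) 1; last by exists 0 => e; rewrite e in ne.
    by have [u hu] := replacement hn e; exists u.
  exists (mkseq (fun i => if i == n then u else nth 0 t i) n.+1) => i hi.
  rewrite nth_mkseq //; case: eqP => [->|ni]; first exact: hu.
  by apply: ht; mlia.
exists (fun j => if j %% 3 == 1 then t j else s j) => [i j ij jm e|j jm]; last first.
  by case: eqP => // j1; split=> // _; have [] := ht j jm j1.
case: eqP => i1; case: eqP => j1; first mlia.
- by have [_] := ht i (ltn_trans ij jm) i1; apply; mlia.
- by rewrite sym; have [_] := ht j jm j1; apply; mlia.
- exact: hs.
Qed.

(* Otherwise z, a common neighbour of z, s_(m-1) and all s_j with j = 2 mod 3, and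
   s_(m-1) itself would prolong the sequence by three. *)
Lemma last_in_trace : E z (s m.-1).
Proof.
apply: contraT => nl; exfalso.
have [s' hs' hz'] := replace_ones.
pose l := [:: z, s m.-1 & [seq s j | j <- iota 0 m & j %% 3 == 2]].
have [|b hb] := @common_nbr l.
  have irr x : ~~ E x x by apply/negP => e; have := tri e e; rewrite e.
  have lP x : x \in l -> [\/ x = z, x = s m.-1 | exists j, [/\ j < m, j %% 3 = 2 & x = s j]].
    rewrite !inE => /or3P[/eqP|/eqP|/mapP[j]]; [by constructor 1|by constructor 2|].
    by rewrite mem_filter mem_iota add0n => /andP[/eqP e jm] ->; constructor 3; exists j.
  have zj j : j < m -> j %% 3 = 2 -> ~~ E z (s j).
    by move=> jm e; apply/negP => /(hz jm); rewrite e.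
  have lj j : j < m -> j %% 3 = 2 -> ~~ E (s j) (s m.-1).
    by move=> jm e; rewrite gseq_adj; mlia.
  move=> x y /lP[->|->|[j [jm j2 ->]]] /lP[->|->|[k [km k2 ->]]] //; try (by rewrite sym ?zj ?lj).
  - exact: zj.
  - by rewrite sym.
  - exact: lj.
  - have [jk|kj|->//] := ltngtP j k.
      by rewrite gseq_adj //; mlia.
    by rewrite sym gseq_adj //; mlia.
(* The positions m, m+1, m+2 have residues 2, 0, 1. So z has to see the replaced terms of residue 1,
   b the terms of residue 2 and z, and s_(m-1) the terms of residue 0 and b. *)
apply: (max (s := fun j => if j < m then s' j else if j == m then z else if j == m.+1 then b else s m.-1)).
move=> i j ij jm e; case: (ltnP j m) => jm'.
  by rewrite (ltn_trans ij jm'); apply: hs'.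
have [ej|nj] := eqVneq j m.
  have im : i < m by mlia.
  by rewrite im; have [h _] := hz' i im; apply: h; mlia.
have [ej'|nj'] := eqVneq j m.+1.
  have [im|mi] := ltnP i m.
    have [_ ->] := hz' i im; last by mlia.
    rewrite sym; apply: hb; rewrite !inE; apply/or3P; constructor 3; apply: map_f.
    by rewrite mem_filter mem_iota im andbT; mlia.
  have -> : i == m by mlia.
  by rewrite sym; apply: hb; rewrite mem_head.
have [im|mi] := ltnP i m.
  have [_ ->] := hz' i im; last by mlia.
  by apply: hs; mlia.
have -> : (i == m) = false by mlia.
have -> : i == m.+1 by mlia.
by apply: hb; rewrite !inE eqxx orbT.
Qed.

End Trace.

(** The reflection preserves residue 1 because m = 2 mod 3, and it exchanges s_1 and s_(m-1); thus
    [last_in_trace] also yields s_1. *)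
Lemma gseq_reflect s : gseq E m s -> gseq E m (fun i => s ((m - i) %% m)).
Proof.
move=> hs i j ij jm e.
rewrite [X in E _ (s X)]modn_small; last by mlia.
have [i0|i0] := posnP i.
  by subst i; rewrite subn0 modnn; apply: hs; mlia.
by rewrite sym modn_small; [apply: hs|]; mlia.
Qed.

Lemma mod_if i r : i < m -> r < m -> (i + r) %% m = if i + r < m then i + r else i + r - m.
Proof.
move=> im rm; case: ltnP => h; first by rewrite modn_small.
by rewrite -{1}(subnK h) modnDr modn_small //; mlia.
Qed.

(** When one index wraps around, a difference d = 1 mod 3 becomes m - d, which is again 1 mod 3: the
    pattern is circulant. *)
Lemma gseq_rot s r : r < m -> gseq E m s -> gseq E m (fun i => s ((i + r) %% m)).
Proof.
move=> rm hs i j ij jm e; rewrite !mod_if //; last by mlia.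
case: ltnP => h1; case: ltnP => h2; [| |mlia|].
- by apply: hs; mlia.
- by rewrite sym; apply: hs; mlia.
- by apply: hs; mlia.
Qed.

Lemma full_trace s z : gseq E m s ->
  (forall j, j < m -> E z (s j) -> j %% 3 = 1) ->
  forall j, j < m -> E z (s j) = (j %% 3 == 1).
Proof.
move=> hs hz j jm; apply/idP/eqP => [|j1]; first exact: hz.
have zl := last_in_trace hs hz.
have z1 : E z (s 1).
  have := last_in_trace (gseq_reflect hs) (z := z); have -> : (m - m.-1) %% m = 1.
    by rewrite modn_small; mlia.
  apply=> i im; have [i0|i0] := posnP i; last by rewrite modn_small => [/hz|]; mlia.
  by rewrite i0 subn0 modnn => /hz; mlia.
(* s_j would be isolated from the pentagon z, s_1, s_2, s_(m-2), s_(m-1). *)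
apply: contraT => nzj; exfalso.
have [ne1 nel] : j <> 1 /\ j <> m.-1 by split=> e; rewrite e ?z1 ?zl in nzj.
have hj i : i < m -> i %% 3 = 1 \/ i < j /\ i %% 3 <> 0 \/ j < i /\ i %% 3 <> 2 -> ~~ E (s j) (s i).
  move=> im h; have [ij|ji|e] := ltngtP i j.
  - by rewrite sym (gseq_adj hs); mlia.
  - by rewrite (gseq_adj hs); mlia.
  - by rewrite e; apply/negP => e'; have := tri e' e'; rewrite e'.
apply: (@no_isolated_pentagon (s j) z (s 1) (s 2) (s m.-2) (s m.-1)) => //; try (by apply: hs; mlia);
  try (by apply: hj; mlia); by rewrite sym.
Qed.

(** Let e be the least index seen. No two seen indices differ by 1 mod 3, so each is e or e + 2 mod
    3; once q = e + 2 mod 3 is seen, later ones equal q mod 3. Rotating the first such q, or e if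
    there is none, to position 1 gives all residue 1. *)
Lemma trace_in_nbhd s z : gseq E m s ->
  exists2 r, r < m & forall i, i < m -> E z (s ((i + r) %% m)) -> i %% 3 = 1.
Proof.
move=> hs; have m2 : 1 < m by mlia.
pose P i := (i < m) && E z (s i).
have ind i j : P i -> P j -> i < j -> (j - i) %% 3 <> 1.
  move=> /andP[_ zi] /andP[jm zj] ij e; have := com zi zj; by rewrite hs.
have suf t0 : P t0 -> (forall i, P i -> i < t0 -> (t0 - i) %% 3 = 2) ->
    (forall i, P i -> t0 <= i -> (i - t0) %% 3 = 0) ->
    exists2 r, r < m & forall i, i < m -> E z (s ((i + r) %% m)) -> i %% 3 = 1.
  move=> /andP[t0m _] h1 h2; exists (if t0 == 0 then m.-1 else t0.-1); first by case: ifP; mlia.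
  move=> i im; rewrite mod_if //; last by case: ifP; mlia.
  set j := if _ then _ else _ => zj.
  have jm : j < m by rewrite /j; case: (t0 =P 0) => ?; case: ifP; mlia.
  have Pj : P j by rewrite /P jm.
  have := h1 j Pj; have := h2 j Pj; rewrite /j; case: (t0 =P 0) => ?; case: ifP; mlia.
have [/existsP[e0 Pe]|none] := boolP [exists i : 'I_m, P i]; last first.
  exists 0; first mlia.
  move=> i im zi; case/negP: none; apply/existsP; exists (Ordinal im).
  by move: zi; rewrite /P addn0 modn_small // im.
have exP : exists i, P i by exists e0.
case: (ex_minnP exP) => e {}Pe mine.
pose Q i := P i && ((i - e) %% 3 == 2).
have [/existsP[q0 Qq]|none] := boolP [exists i : 'I_m, Q i]; last first.
  apply: (suf e Pe) => i Pi h; first by have := mine i Pi; mlia.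
  have [->|ei] : i = e \/ e < i by mlia.
    by rewrite subnn.
  have := ind e i Pe Pi ei; have : ~~ Q i.
    apply/negP => Qi; case/negP: none; apply/existsP; have /andP[im _] := Pi.
    by exists (Ordinal im).
  by rewrite /Q Pi /=; mlia.
have exQ : exists i, Q i by exists q0.
case: (ex_minnP exQ) => q {}Qq minq; have /andP[Pq q2] := Qq.
have nb i : P i -> (i - e) %% 3 = 0 \/ (i - e) %% 3 = 2.
  move=> Pi; have ei := mine i Pi; have [->|ei'] : i = e \/ e < i by mlia.
    by left; rewrite subnn.
  by have := ind e i Pe Pi ei'; mlia.
apply: (suf q Pq) => i Pi h; have ei := mine i Pi; have eq := mine q Pq.
- have [i0|i2] := nb i Pi; first mlia.
  by have := minq i; rewrite /Q Pi i2 => /(_ isT); mlia.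
- have [i0|i2] := nb i Pi; last mlia.
  have [ei'|qi] : i = q \/ q < i by mlia.
    mlia.
  by have := ind q i Pq Pi qi; mlia.
Qed.

(** After rotation by r, z sees exactly the offsets that are 1 mod 3. These are the neighbours of
    offset 0, so z is a twin of s_r. *)
Lemma gamma_full_traces : full_traces E m (edges_of m seq_rel).
Proof.
move=> g z /hom_edges_of[hsz hg].
have hs : gseq E m (nth 0 g).
  by move=> i j ij jm e; apply: hg => //; [mlia|rewrite /seq_rel ij e].
have [r rm hr] := trace_in_nbhd z hs.
have ft := full_trace (gseq_rot rm hs) hr.
exists r => //; apply: eq_in_filter => i; rewrite mem_iota add0n /= => im.
rewrite !mem_edges_of im rm /= /seq_rel.
have jm : (i + (m - r)) %% m < m by rewrite ltn_pmod; mlia.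
have := ft _ jm; rewrite modnDml -addnA subnK; last exact: ltnW.
rewrite modnDr (modn_small im) => ->.
have [r0|r0] := posnP r; first by rewrite r0 subn0 modnDr (modn_small im); mlia.
by rewrite mod_if //; [case: ifP|]; mlia.
Qed.
End Length.
End NoHexagon.

(** * Density *)

Definition ncount (E : rel nat) v n : nat := \sum_(i < n) E v i.

(* The lower densities of the neighbourhoods exceed (1 + 1/K) / 3. *)
Definition dense_by K (E : rel nat) := forall v, exists N, forall n, N <= n ->
  K.+1 * n < 3 * K * ncount E v n.

Section Counting.
Variables (E : rel nat) (K : nat).
Hypotheses (sym : symmetric E) (dE : dense_by K E).

Lemma dense_by_seq (g : seq nat) : exists2 n, 0 < n &
  {in g, forall v, K.+1 * n < 3 * K * ncount E v n}.
Proof.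
suff [N hN] : exists N, {in g, forall v, forall n, N <= n -> K.+1 * n < 3 * K * ncount E v n}.
  by exists N.+1 => // v vg; apply: hN.
elim: g => [|v g [N IH]]; first by exists 0.
have [M hM] := dE v; exists (maxn M N) => u; rewrite inE => /orP[/eqP->|ug] n; rewrite geq_max => /andP[h1 h2].
  exact: hM.
exact: IH.
Qed.

Lemma sum_wdeg g ws n : \sum_(z < n) wdeg E z g ws =
  sumn [seq p.2 * ncount E p.1 n | p <- zip g ws].
Proof.
rewrite /wdeg; elim: (zip g ws) => [|p l IH] /=; first by rewrite big1.
rewrite big_split /= IH; congr (_ + _).
by rewrite /ncount big_distrr; apply: eq_bigr => i _; rewrite sym.
Qed.

(** Average the seen weight over the first n vertices, with n beyond all thresholds for [g]; by
    symmetry the sum counts neighbours of the members of [g]. *)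
Lemma dense_by_wdeg g ws : size g = size ws -> 0 < sumn ws ->
  exists z, K.+1 * sumn ws < 3 * K * wdeg E z g ws.
Proof.
move=> hs ws0; have [n n0 hn] := dense_by_seq g.
have [/existsP[z hz]|none] := boolP [exists z : 'I_n, K.+1 * sumn ws < 3 * K * wdeg E z g ws].
  by exists z.
exfalso; have /negP := none; apply.
have h1 : \sum_(z < n) 3 * K * wdeg E z g ws <= \sum_(z < n) K.+1 * sumn ws.
  apply: leq_sum => z _; rewrite leqNgt; apply: contra none => hz; apply/existsP; by exists z.
move: h1; rewrite -big_distrr sum_nat_const card_ord /= sum_wdeg.
suff h : K.+1 * n * sumn ws < 3 * K * sumn [seq p.2 * ncount E p.1 n | p <- zip g ws].
  rewrite mulnCA mulnA leqNgt; by rewrite h.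
elim: g ws hs ws0 hn {none} => [|v g IH] [|w ws] //= [hs] ws0 hn.
have hv : K.+1 * n < 3 * K * ncount E v n by apply: hn; rewrite mem_head.
have hg : {in g, forall v, K.+1 * n < 3 * K * ncount E v n}.
  by move=> u ug; apply: hn; rewrite inE ug orbT.
have h1 : w * (K.+1 * n) <= w * (3 * K * ncount E v n) by rewrite leq_mul2l (ltnW hv) orbT.
have [s0|s0] := posnP (sumn ws).
  have w0 : 0 < w by lia.
  have h2 : w * (K.+1 * n) < w * (3 * K * ncount E v n) by rewrite ltn_pmul2l.
  by rewrite s0; nia.
by have := IH ws hs s0 hg; nia.
Qed.

Lemma heavy_of_dense_by : heavy_nbr E.
Proof.
move=> g ws hs ws0; have [z hz] := dense_by_wdeg hs ws0; exists z.
have := hz; case: K => [|k]; first by rewrite muln0.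
nia.
Qed.

Hypothesis tri : forall x y z, E x y -> E y z -> ~~ E x z.

(** A vertex sees an independent part of the sequence, at most L/3 + 1 terms, but some vertex sees
    more than (1 + 1/K) L/3 of them. *)
Lemma gseq_bound L s : gseq E L s -> L < 3 * K.
Proof.
move=> hs; have [->|L0] := posnP L.
  have [N hN] := dE 0; have := hN N.+1 (leqnSn N); case: K => //; by rewrite muln0.
have [||z] := @dense_by_wdeg (mkseq s L) (nseq L 1).
- by rewrite size_mkseq size_nseq.
- by rewrite sumn_nseq; lia.
rewrite sumn_nseq mul1n.
pose T := [seq i <- iota 0 L | E z (s i)].
have -> : wdeg E z (mkseq s L) (nseq L 1) = size T.
  rewrite /T /wdeg /mkseq size_filter; move: (iota 0 L) (size_iota 0 L) => l <-.
  by elim: l => //= i l ->; rewrite mul1n.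
have hT i : i \in T -> i < L /\ E z (s i) by rewrite mem_filter mem_iota add0n => /andP[].
have ind i j : i \in T -> j \in T -> i < j -> (j - i) %% 3 <> 1.
  move=> /hT[_ zi] /hT[jL zj] ij e; have := tri zi (hs i j ij jL e); by rewrite zj.
suff : size T <= L %/ 3 + 1 by nia.
have sT : sorted ltn T by apply: sorted_filter (iota_ltn_sorted 0 L); apply: ltn_trans.
case eT : T => [|e T'] //; rewrite -eT.
have eL : e \in T by rewrite eT mem_head.
have mine i : i \in T -> e <= i.
  rewrite eT in sT *; rewrite inE => /orP[/eqP->//|iT].
  have /allP := order_path_min ltn_trans sT; by move=> /(_ i iT)/ltnW.
have cl i : i \in T -> (i - e) %% 3 <> 1.
  move=> iT; have := mine i iT; rewrite leq_eqVlt => /orP[/eqP<-|ei]; first by rewrite subnn.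
  exact: ind.
(* A block of three indices congruent to e-1, e, e+1 contains at most one
   neighbour, as those congruent to e+1 are excluded by e. *)
rewrite -(size_map (fun i => (i - e + 1) %/ 3)) -(size_iota 0 (L %/ 3 + 1)).
apply: uniq_leq_size.
  rewrite map_inj_in_uniq ?filter_uniq ?iota_uniq // => i j iT jT h.
  have hi := cl i iT; have hj := cl j jT; have ei := mine i iT; have ej := mine j jT.
  have [ij|ji|//] := ltngtP i j.
    by have := ind i j iT jT ij; lia.
  by have := ind j i jT iT ji; lia.
move=> _ /mapP[i iT ->]; have [iL _] := hT i iT; rewrite mem_iota.
lia.
Qed.

End Counting.

(** * Andrasfai graphs in the numbering of sequences *)

Definition circ k i := (i %% 3) * k + i %/ 3.
Definition uncirc k q := 3 * (q %% k) + q %/ k.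

Lemma andr_adjE k p q : 0 < k -> p < 3 * k - 1 -> q < 3 * k - 1 ->
  andr_adj k p q = if q <= p then k <= p - q <= 2 * k - 1 else k <= p + (3 * k - 1) - q <= 2 * k - 1.
Proof.
move=> k0 hp hq; rewrite /andr_adj.
have -> : (p + (3 * k - 1) - q) %% (3 * k - 1) = if q <= p then p - q else p + (3 * k - 1) - q.
  case: leqP => h; last by rewrite modn_small //; lia.
  by rewrite -addnBAC // modnDr modn_small //; lia.
by case: ifP.
Qed.

Lemma circ_lt k i : 0 < k -> i < 3 * k - 1 -> circ k i < 3 * k - 1.
Proof.
move=> k0 hi; rewrite /circ; have : i %% 3 = 0 \/ i %% 3 = 1 \/ i %% 3 = 2 by lia.
by case=> [|[]] e; rewrite e; lia.
Qed.

Lemma uncircK k q : 0 < k -> q < 3 * k - 1 -> uncirc k q < 3 * k - 1 /\ circ k (uncirc k q) = q.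
Proof.
move=> k0 hq; rewrite /circ /uncirc.
have := divn_eq q k; have := ltn_pmod q k0.
have c3 : q %/ k < 3 by rewrite ltn_divLR //; lia.
move: (q %/ k) (q %% k) c3 => c r c3 rk hd.
have -> : (3 * r + c) %% 3 = c by lia.
have -> : (3 * r + c) %/ 3 = r by lia.
by split=> //; move: c3 hd; do 3?[case: c => [|c]] => // _; lia.
Qed.

(** [circ k] is multiplication by k modulo 3k-1: as 3k = 1, the difference 3p + 1 becomes k + p, and
    p runs through 0, ..., k-1. *)
Lemma andr_adj_circ k i j : 0 < k -> i < 3 * k - 1 -> j < 3 * k - 1 ->
  andr_adj k (circ k i) (circ k j) = seq_rel i j || seq_rel j i.
Proof.
move=> k0 hi hj; rewrite andr_adjE ?circ_lt // /circ /seq_rel.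
have : i %% 3 = 0 \/ i %% 3 = 1 \/ i %% 3 = 2 by lia.
have : j %% 3 = 0 \/ j %% 3 = 1 \/ j %% 3 = 2 by lia.
by case=> [|[]] ej; case=> [|[]] ei; rewrite ei ej; case: ifP; lia.
Qed.

Lemma gamma_blowup E k f : 0 < k -> (forall x : nat, f x < 3 * k - 1) ->
  (forall i, i < 3 * k - 1 -> exists x, f x = i) ->
  (forall x y, E x y = (f y \in adjl (3 * k - 1) (edges_of (3 * k - 1) seq_rel) (f x))) ->
  blowup_of E (@andrasfai k) (fun _ => true).
Proof.
move=> k0 fb fs fE; exists (fun x => Ordinal (circ_lt k0 (fb x))); split=> //; split.
  move=> q _; have [h1 h2] := uncircK k0 (ltn_ord q).
  by have [x fx] := fs _ h1; exists x; apply: val_inj; rewrite /= fx.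
by move=> x y; rewrite fE mem_adjl_edges_of // /andrasfai /= andr_adj_circ.
Qed.

(** * Vega graphs in the numbering of the pattern *)

Definition vega_core := nth Va [:: Va; Vb; Vc; Vu; Vv; Vw; Vx].

(** The default of [insubd] is never taken on sequence codes, because [circ_lt] bounds their
    images. *)
Definition vega_of_code L i (i0 : 0 < 3 * i - 1) c : vega_vertex i :=
  if c < 7 then inr (vega_core c)
  else if c < 7 + L then inl (insubd (Ordinal i0) (circ i (c - 7))) else inr Vy.

Section Codes.
Variables (i L : nat) (nu y : bool).
Hypotheses (i2 : 2 <= i) (eL : L + nu = 3 * i - 1).
Variable i0 : 0 < 3 * i - 1.
Notation F := (vega_of_code L i0).

Let gt0 : 0 < i. Proof. by lia. Qed.

Lemma code_core c : c < 7 -> F c = inr (vega_core c).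
Proof. by rewrite /vega_of_code => ->. Qed.

Lemma code_y : F (7 + L) = inr Vy.
Proof. by rewrite /vega_of_code; have -> : (7 + L < 7) = false by [lia]; rewrite ltnn. Qed.

Lemma code_seq j : j < L -> exists2 p : 'I_(3 * i - 1), F (7 + j) = inl p & p = circ i j :> nat.
Proof.
move=> jL; exists (insubd (Ordinal i0) (circ i j)).
  by rewrite /vega_of_code; have -> : (7 + j < 7) = false by [lia]; rewrite ltn_add2l jL addKn.
by rewrite val_insubd circ_lt //; lia.
Qed.

(** Residues mod 3 become the three intervals by which the Vega graph attaches its cycle to the
    hexagon. *)
Lemma circ_class j : j < L -> [/\ (circ i j < i) = (j %% 3 == 0),
  (i <= circ i j <= 2 * i - 1) = (j %% 3 == 1) & (2 * i <= circ i j <= 3 * i - 2) = (j %% 3 == 2)].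
Proof.
move=> jL; rewrite /circ; have : j %% 3 = 0 \/ j %% 3 = 1 \/ j %% 3 = 2 by lia.
by case=> [|[]] e; rewrite e; split; lia.
Qed.

Lemma vegaC s t : @vega i s t = vega t s.
Proof. by rewrite /vega orbC. Qed.

Lemma vega_core_seq c j : c < 7 -> j < L -> vega (F c) (F (7 + j)) = adj2 L c (7 + j).
Proof.
move=> c7 jL; rewrite code_core // adj2_seq //; have [p -> ep] := code_seq jL.
have [h0 h1 h2] := circ_class jL; rewrite /vega /=.
by case: c c7 => [|[|[|[|[|[|[|c]]]]]]] // _ /=; rewrite ep ?h0 ?h1 ?h2 ?orbF //; lia.
Qed.

Lemma vega_seq_seq j l : j < L -> l < L -> vega (F (7 + j)) (F (7 + l)) = adj2 L (7 + j) (7 + l).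
Proof.
move=> jL lL; rewrite adj2_seqs //; have [p -> ep] := code_seq jL; have [q -> eq] := code_seq lL.
rewrite /vega /= ep eq !andr_adj_circ //; [|lia..].
by rewrite /seq_rel; lia.
Qed.

Lemma vega_code_adj c d : c < 7 + L + y -> d < 7 + L + y -> vega (F c) (F d) = adj2 L c d.
Proof.
have core_y a : a < 7 -> vega (F a) (F (7 + L)) = adj2 L a (7 + L).
  by move=> a7; rewrite adj2_y ?code_y ?code_core //; [case: a a7 => [|[|[|[|[|[|[|a]]]]]]] // | lia].
have seq_y j : j < L -> vega (F (7 + j)) (F (7 + L)) = adj2 L (7 + j) (7 + L).
  by move=> jL; rewrite code_y adj2_y; [have [p -> _] := code_seq jL; rewrite /vega /=|]; lia.
case/vega_code => [c7|[j jL ->]|[_ ->]]; case/vega_code => [d7|[l lL ->]|[_ ->]].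
- rewrite !code_core // adj2_core //.
  have hall : all (fun c => all (fun d => adj2 4 c d == @vega i (inr (vega_core c)) (inr (vega_core d))) (iota 0 7)) (iota 0 7) by [].
  have c' : c \in iota 0 7 by rewrite mem_iota.
  have d' : d \in iota 0 7 by rewrite mem_iota.
  by have /eqP := allP (allP hall c c') d d'.
- exact: vega_core_seq.
- exact: core_y.
- by rewrite vegaC adj2_sym vega_core_seq.
- exact: vega_seq_seq.
- exact: seq_y.
- by rewrite vegaC adj2_sym core_y.
- by rewrite vegaC adj2_sym seq_y.
- by rewrite code_y adj2_y //= ; lia.
Qed.

Lemma vega_code_keep c : c < 7 + L + y -> vega_keep (~~ y) nu (F c).
Proof.
case/vega_code => [c7|[j jL ->]|[y1 ->]].
- by rewrite code_core // /vega_keep; case: c c7 => [|[|[|[|[|[|[|c]]]]]]] //= _; rewrite andbF.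
- have [p -> ep] := code_seq jL; rewrite /vega_keep ep /circ.
  have : j %% 3 = 0 \/ j %% 3 = 1 \/ j %% 3 = 2 by lia.
  by case=> [|[]] e; rewrite e; case: (nu) eL; lia.
- by rewrite code_y /= y1.
Qed.

Lemma vega_code_onto s : vega_keep (~~ y) nu s -> exists2 c, c < 7 + L + y & F c = s.
Proof.
case: s => [p|t] /=.
  move=> hp; have [h1 h2] := uncircK gt0 (ltn_ord p).
  have jL : uncirc i p < L.
    case: (nu) eL hp => /= e hp; last by lia.
    (* The deleted vertex 2i-1 is the image of index 3i-2, the last one of a sequence of length
       3i-1. *)
    have : uncirc i p <> 3 * i - 2; last by lia.
    move=> e'; rewrite e' /circ in h2; case/negP: hp; apply/eqP; rewrite -h2.
    have -> : (3 * i - 2) %% 3 = 1 by lia.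
    lia.
  have [q e eq] := code_seq jL; exists (7 + uncirc i p); first by lia.
  by rewrite e; congr inl; apply: val_inj; rewrite /= eq.
case: t => h; [exists 0|exists 1|exists 2|exists 3|exists 4|exists 5|exists 6|exists (7 + L)]; rewrite ?code_y //; try lia.
by case: (y) h => //=; lia.
Qed.

Lemma vega_blowup (E : rel nat) f : (forall x : nat, f x < 7 + L + y) ->
  (forall c, c < 7 + L + y -> exists x, f x = c) ->
  (forall x z, E x z = (f z \in adjl (7 + L + y) (vega_edges L y) (f x))) ->
  blowup_of E (@vega i) (@vega_keep i (~~ y) nu).
Proof.
move=> fb fs fE; exists (fun x => F (f x)); split; first by move=> x; apply: vega_code_keep.
split; first by move=> s /vega_code_onto[c /fs[x <-] <-]; exists x.
by move=> x z; rewrite fE adjl_vega // vega_code_adj.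
Qed.

End Codes.

(** * Assembling the two cases *)

Lemma max_exists (P : nat -> Prop) b n0 : P n0 -> (forall n, P n -> n <= b) ->
  exists2 n, n0 <= n & P n /\ ~ P n.+1.
Proof.
move=> P0 hb; have exP : exists n, `[< P n >] by exists n0; apply/asboolP.
have bP n : `[< P n >] -> n <= b by move/asboolP; apply: hb.
case: (ex_maxnP exP bP) => n /asboolP Pn maxn; exists n; first by apply: maxn; apply/asboolP.
by split=> // /asboolP/maxn; rewrite ltnn.
Qed.

Lemma hom_or_omits E L (y : bool) :
  (exists g, hom E (7 + L + y) (vega_edges L y) g) \/ omits E [:: vtarget L y].
Proof.
have [h|h] := pselect (exists g, hom E (7 + L + y) (vega_edges L y) g); first by left.
by right=> p; rewrite inE => /eqP-> g hg; apply: h; exists g.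
Qed.

Lemma omits_cons E t u : omits E [:: t] -> omits E [:: u] -> omits E [:: t; u].
Proof.
by move=> ht hu p; rewrite inE => /orP[/eqP->|]; [apply: ht; rewrite mem_head|apply: hu].
Qed.

Section Main.
Variables (E : rel nat) (GE : dense_graph E) (K : nat).
Hypothesis dE : dense_by K E.

Let bound L s : gseq E L s -> L < 3 * K.
Proof. exact: (gseq_bound (dg_sym GE) dE (dg_tri GE)). Qed.

Lemma andrasfai_case : ~ induced_hexagon E ->
  exists k, 1 <= k /\ blowup_of E (@andrasfai k) (fun _ => true).
Proof.
move=> nohex; have irr : ~~ E 0 0 by apply/negP => e; have := dg_tri GE e e; rewrite e.
have [z e _] := dg_com GE irr.
pose P k := exists s, gseq E (3 * k - 1) s.
have P1 : P 1 by exists (fun i => if i == 0 then 0 else z) => -[|[|i]] [|[|j]].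
have [|k k1 [[s hs] nP]] := @max_exists P K 1 P1.
  by move=> n [s /bound]; lia.
exists k; split=> //; have hm : (3 * k - 1) %% 3 = 2 by lia.
have noext s' : ~ gseq E (3 * k - 1 + 3) s'.
  by move=> hs'; apply: nP; exists s'; have -> : 3 * k.+1 - 1 = 3 * k - 1 + 3 by lia.
have ft := gamma_full_traces GE nohex hm noext.
have wf : wf_edges (3 * k - 1) (edges_of (3 * k - 1) seq_rel).
  by apply: wf_edges_of => i; rewrite /seq_rel ltnn.
have hg : hom E (3 * k - 1) (edges_of (3 * k - 1) seq_rel) (mkseq s (3 * k - 1)).
  apply/hom_edges_of; rewrite size_mkseq; split=> // i j hi hj /andP[ij /eqP e'].
  by rewrite !nth_mkseq //; apply: hs.
have [f [fb fs fE]] := blowup_of_full GE wf (undominated_gamma hm) ft hg.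
exact: gamma_blowup k1 fb fs fE.
Qed.

Definition vega_conclusion := exists (i : nat) (mu nu : bool),
  2 <= i /\ blowup_of E (@vega i) (@vega_keep i mu nu).

(** The parameters solve L + nu = 3i - 1: nu = 1 when L = 1 mod 3 and nu = 0 when L = 2 mod 3. *)
Lemma vega_of_full L (y : bool) g : 4 <= L -> L %% 3 != 0 -> hom E (7 + L + y) (vega_edges L y) g ->
  full_traces E (7 + L + y) (vega_edges L y) -> vega_conclusion.
Proof.
move=> L4 L3 hg ft; pose i := (L + 2) %/ 3; pose nu := L %% 3 == 1.
have [f [fb fs fE]] := blowup_of_full GE (@wf_vega L y) (@undominated_vega L y L4) ft hg.
exists i, (~~ y), nu; split; first by rewrite /i; lia.
have i2 : 2 <= i by rewrite /i; lia.
have eL : L + nu = 3 * i - 1 by rewrite /i /nu; case: eqP; lia.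
have i0 : 0 < 3 * i - 1 by lia.
exact: (vega_blowup i2 eL i0 fb fs fE).
Qed.

(** Patterns are tried from the largest down, since full traces of each small one rest on the
    absence of larger ones; L = 6 disappears together with L = 7. *)
Lemma vega_case : induced_hexagon E -> vega_conclusion.
Proof.
move=> hex.
have [[g7 hg7]|om7] := hom_or_omits E 7 false.
  pose P L := exists g, hom E (7 + L + false) (vega_edges L false) g.
  have P7 : P 7 by exists g7.
  have [|L L7 [[g hg] nP]] := @max_exists P (3 * K) 7 P7.
    by move=> L [g /hom_ladder[_ _ h]]; apply/ltnW/bound; exact: h.
  have om : omits E [:: vtarget L.+1 false].
    by move=> p; rewrite inE => /eqP-> g' hg'; apply: nP; exists g'.
  have L3 := ladder_mod3 GE L7 om (hom_ladder hg).
  have L4 : 4 <= L by lia.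
  have [[gy hgy]|omy] := hom_or_omits E L true.
    by apply: (vega_of_full L4 L3 hgy); apply: vega_full_traces.
  by apply: (vega_of_full L4 L3 hg); apply: vega_full_traces.
have om6 := omits_vega6 GE om7.
have [[g hg]|om5y] := hom_or_omits E 5 true.
  by apply: (vega_of_full _ _ hg) => //; apply: (full_traces5y GE); apply: omits_cons.
have [[g hg]|om5] := hom_or_omits E 5 false.
  by apply: (vega_of_full _ _ hg) => //; apply: (full_traces5 GE); apply: omits_cons.
have [[g hg]|om4] := hom_or_omits E 4 false.
  by apply: (vega_of_full _ _ hg) => //; apply: (full_traces4 GE).
by case: (hexagon_vega4 GE om4 hex).
Qed.

End Main.

(* From lower densities to the counting condition *)
From mathcomp Require Import all_boot all_order all_algebra.
From mathcomp Require Import all_classical all_reals.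
From mathcomp Require Import ereal topology normedtype sequences.
From mathcomp Require Import lra.
Import Order.TTheory GRing.Theory Num.Theory.
Local Open Scope ring_scope.
Local Open Scope classical_set_scope.

Lemma limn_einf_gt (R : realType) (u : (\bar R)^nat) (r : R) :
  (r%:E < limn_einf u)%E -> exists N, forall n, (N <= n)%N -> (r%:E < u n)%E.
Proof.
rewrite limn_einf_lim (cvg_lim _ (@cvg_einfs_sup _ u)) // => /ereal_sup_gt[_ [N _ <-]] h.
exists N => n Nn; apply: (lt_le_trans h); apply: ereal_inf_lbound; by exists n.
Qed.

Lemma dense_by_of_lower_deg (R : realType) (E : rel nat) :
  (((3%:R)^-1 : R)%:E < ereal_inf [set lower_deg R E v | v in [set: nat]])%E ->
  exists K, dense_by K E.
Proof.
set x := ereal_inf _ => hx.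
have [r r3 rx] : exists2 r : R, 3^-1 < r & (r%:E < x)%E.
  case: x hx => [r| |] //; rewrite ?lte_fin => h.
    by exists ((3^-1 + r) / 2); rewrite ?lte_fin; lra.
  by exists 1; [lra|rewrite ltry].
have r0 : 0 < 3 * r - 1 by lra.
(* Chosen so that K (3r - 1) > 1, that is, 3r > 1 + 1/K. *)
pose K := (Num.bound (3 * r - 1)^-1).+1.
have hK : 1 < K%:R * (3 * r - 1).
  have h : (3 * r - 1)^-1 < (Num.bound (3 * r - 1)^-1)%:R :> R.
    by rewrite archi_boundP // invr_ge0 ltW.
  rewrite -ltr_pdivrMr // mul1r; apply: lt_trans h _.
  by rewrite ltr_nat.
exists K => v.
have [|N hN] := @limn_einf_gt R (fun n => (nbr_density R E v n)%:E) r.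
  apply: (lt_le_trans rx); apply: ereal_inf_lbound; by exists v.
exists N.+1 => n Nn; have := hN n (ltnW Nn); rewrite lte_fin /nbr_density => h.
have n0 : 0 < n%:R :> R by rewrite ltr0n; case: (n) Nn.
rewrite ltr_pdivlMr // in h; rewrite -(ltr_nat R) !natrM /ncount.
have k0 : 0 < K%:R :> R by rewrite ltr0n.
rewrite -natr1; nra.
Qed.

Theorem theorem5p4 (R : realType) (E : rel nat) :
  maximal_triangle_free E ->
  (((3%:R)^-1 : R)%:E < ereal_inf [set lower_deg R E v | v in [set: nat]])%E ->
  (exists k : nat, (1 <= k)%N /\ blowup_of E (@andrasfai k) (fun _ => true)) \/
  (exists (i : nat) (mu nu : bool),
      (2 <= i)%N /\ blowup_of E (@vega i) (@vega_keep i mu nu)).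
Proof.
move=> [[sym irr] [tri com]] /dense_by_of_lower_deg[K dE].
have triE x y z : E x y -> E y z -> ~~ E x z.
  by move=> xy yz; apply/negP => xz; apply: (tri x y z).
have GE : dense_graph E.
  split=> //; last exact: heavy_of_dense_by sym dE.
  move=> x y nxy; have [exy|/eqP nexy] := eqVneq x y; last first.
    by have [z /andP[xz zy]] := com x y nexy nxy; exists z.
  (* For x = y any neighbour of x will do, and positive density provides one. *)
  have [N /(_ N (leqnn N))] := dE x; rewrite -exy.
  have [/existsP[z xz] _|none] := boolP [exists z : 'I_N, E x z].
    by exists z; rewrite // sym.
  rewrite /ncount big1 ?muln0 // => z _; apply/eqP; rewrite eqb0.
  by apply: contra none => xz; apply/existsP; exists z.
have [hex|nohex] := pselect (induced_hexagon E); first by right; exact: (vega_case GE dE hex).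
by left; exact: (andrasfai_case GE dE nohex).
Qed.
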